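(* Let $d \ge 1$ be an integer and let $\alpha > 0$ be a real number. There exists a constant $C' > 0$, depending on $\alpha$ and $d$, such that for every $\varphi \in C_c^\infty(\mathbb{R}^d)$, $$\int_{\mathbb{R}^d} |\varphi| \, \mathrm{d}\operatorname{cap}_{W^{\alpha,1}} \leq C'\|\varphi\|_{W^{\alpha,1}(\mathbb{R}^d)}.$$
   Context: Functions are real-valued. For $k \in \mathbb{N} = \{0,1,2,\ldots\}$, $W^{k,1}(\mathbb{R}^d)$ is the space of $u \in L^1(\mathbb{R}^d)$ with weak derivatives $D^i u \in L^1(\mathbb{R}^d, \mathbb{R}^{d^i})$ for $i \in \{1,\ldots,k\}$, with norm $\|u\|_{W^{k,1}(\mathbb{R}^d)} := \sum_{i=0}^{k} \|D^i u\|_{L^1(\mathbb{R}^d)}$, $D^0u := u$. For non-integer $\alpha > 0$, write $\alpha = k + \theta$ with $k \in \mathbb{N}$ and $0 < \theta < 1$; then $u \in W^{\alpha,1}(\mathbb{R}^d)$ if $u \in W^{k,1}(\mathbb{R}^d)$ and $$\|u\|_{W^{\alpha,1}(\mathbb{R}^d)} := \|u\|_{W^{k,1}(\mathbb{R}^d)} + \int_{\mathbb{R}^d}\int_{\mathbb{R}^d} \frac{|D^k u(x) - D^k u(y)|}{|x-y|^{\theta+d}} \,\mathrm{d}x\,\mathrm{d}y$$ is finite. The Sobolev capacity of a compact set $K \subset \mathbb{R}^d$ is $$\operatorname{cap}_{W^{\alpha,1}}(K) := \inf\{ \|\varphi\|_{W^{\alpha,1}(\mathbb{R}^d)} : \varphi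 \in C_c^\infty(\mathbb{R}^d),\ \varphi \ge 0 \text{ in } \mathbb{R}^d,\ \varphi > 1 \text{ on } K\},$$ and for an open set $\omega \subset \mathbb{R}^d$, $\operatorname{cap}_{W^{\alpha,1}}(\omega) := \sup\{\operatorname{cap}_{W^{\alpha,1}}(K) : K \subset \omega \text{ compact}\}$. The Choquet integral is $\int_{\mathbb{R}^d} |\varphi| \, \mathrm{d}\operatorname{cap}_{W^{\alpha,1}} := \int_0^\infty \operatorname{cap}_{W^{\alpha,1}}(\{|\varphi| > t\}) \, \mathrm{d}t$. *)

(* Defs.v *)
From HB Require Import structures.
From mathcomp Require Import all_boot all_order all_algebra.
From mathcomp Require Import all_classical all_reals all_analysis.

Set Implicit Arguments.
Unset Strict Implicit.
Unset Printing Implicit Defensive.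
Import Order.TTheory GRing.Theory Num.Theory.
Import numFieldNormedType.Exports.

Local Open Scope classical_set_scope.
Local Open Scope ring_scope.

(** The measurable space R^n: row vectors with the product sigma-algebra, which
    is also the Borel sigma-algebra of the topology of ['rV[R]_n]. *)
Fact measure_rV_display : measure_display.
Proof. exact: default_measure_display. Qed.

Section measurable_rV.
Context {R : realType}.
Variable n : nat.

Definition rV_coord (i : 'I_n) (x : 'rV[R]_n) : R := x ord0 i.

Let rV_set0 : g_sigma_preimage rV_coord set0.
Proof. exact: sigma_algebra0. Qed.

Let rV_setC A : g_sigma_preimage rV_coord A -> g_sigma_preimage rV_coord (~` A).
Proof. exact: sigma_algebraC. Qed.

Let rV_bigcup (F : (set 'rV[R]_n)^nat) :
  (forall i, g_sigma_preimage rV_coord (F i)) ->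
  g_sigma_preimage rV_coord (\bigcup_i F i).
Proof. exact: sigma_algebra_bigcup. Qed.

HB.instance Definition _ := @isMeasurable.Build measure_rV_display 'rV[R]_n
  (g_sigma_preimage rV_coord) rV_set0 rV_setC rV_bigcup.

Lemma measurable_rV_coord (i : 'I_n) : measurable_fun setT (rV_coord i).
Proof.
move=> _ Y mY; rewrite setTI; apply: sub_sigma_algebra => /=.
rewrite -bigcup_seq/=; exists i => /=; first by rewrite mem_index_enum.
by exists Y => //; rewrite setTI.
Qed.

Lemma measurable_fun_rVP d (T : measurableType d) (f : T -> 'rV[R]_n) :
  measurable_fun setT f <-> forall i, measurable_fun setT (rV_coord i \o f).
Proof.
split=> [mf i|mf].
  by apply: measurableT_comp => //; exact: measurable_rV_coord.
rewrite -[X in measurable_fun _ X]/(f) => _ Y; rewrite setTI.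
rewrite {1}/measurable /=.
pose G : set (set 'rV[R]_n) := [set A | measurable (f @^-1` A)].
suff : g_sigma_preimage rV_coord `<=` G by exact.
apply: smallest_sub.
  split => [|A GA|F GF].
  - by rewrite /G /= preimage_set0; exact: measurable0.
  - by rewrite /G /= setTD preimage_setC; exact: measurableC.
  - by rewrite /G /= preimage_bigcup; exact: bigcupT_measurable.
move=> A; rewrite -bigcup_seq => -[i _ [B mB <-]].
by rewrite /G /= setTI -[_ @^-1` _]setTI -comp_preimage; exact: mf.
Qed.

End measurable_rV.

Section lebesgue_measure_rV.
Context {R : realType}.

Definition rV_cons n (p : R * 'rV[R]_n) : 'rV[R]_n.+1 :=
  row_mx (p.1)%:M p.2.

Lemma rV_cons0 n p : @rV_cons n p ord0 ord0 = p.1.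
Proof.
rewrite /rV_cons; have -> : (ord0 : 'I_(1 + n)) = lshift n ord0 by exact/val_inj.
by rewrite (@row_mxEl _ 1 1 n) mxE eqxx mulr1n.
Qed.

Lemma rV_consS n p (i : 'I_n) : rV_cons p ord0 (lift ord0 i) = p.2 ord0 i.
Proof.
rewrite /rV_cons; have -> : (lift ord0 i : 'I_(1 + n)) = rshift 1 i by exact/val_inj.
by rewrite (@row_mxEr _ 1 1 n).
Qed.

Lemma measurable_rV_cons n : measurable_fun setT (@rV_cons n).
Proof.
apply/measurable_fun_rVP => i.
have [->|[j ->]] : i = ord0 \/ exists j, i = lift ord0 j.
  by case: (unliftP ord0 i) => [j ->|->]; [right; exists j|left].
- rewrite (_ : _ \o _ = fst); first exact: measurable_fst.
  by apply/funext => p /=; rewrite /rV_coord rV_cons0.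
- rewrite (_ : _ \o _ = rV_coord j \o snd).
    by apply: measurableT_comp; [exact: measurable_rV_coord|exact: measurable_snd].
  by apply/funext => p /=; rewrite /rV_coord rV_consS.
Qed.

Section step.
Variables (n : nat) (mu : {sigma_finite_measure set 'rV[R]_n -> \bar R}).

Definition rV_cons_measure : set 'rV[R]_n.+1 -> \bar R :=
  pushforward (lebesgue_measure \x mu)%E (@rV_cons n).

Let m0 : rV_cons_measure set0 = 0%E.
Proof. by rewrite /rV_cons_measure /pushforward preimage_set0 measure0. Qed.

Let m_ge0 A : (0 <= rV_cons_measure A)%E.
Proof. exact: measure_ge0 (lebesgue_measure \x mu)%E _. Qed.

Let m_sigma_additive : semi_sigma_additive rV_cons_measure.
Proof.
move=> F mF tF mUF; rewrite /rV_cons_measure /pushforward preimage_bigcup.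
apply: measure_semi_sigma_additive.
- by move=> k; rewrite -[X in measurable X]setTI; exact: measurable_rV_cons.
- apply/trivIsetP => /= i j _ _ ij; rewrite -preimage_setI.
  by move/trivIsetP : tF => /(_ _ _ _ _ ij) ->//; rewrite preimage_set0.
- rewrite -preimage_bigcup -[X in measurable X]setTI.
  exact: measurable_rV_cons.
Qed.

HB.instance Definition _ :=
  isMeasure.Build _ _ _ rV_cons_measure m0 m_ge0 m_sigma_additive.

Let m_sigma_finite : sigma_finite setT rV_cons_measure.
Proof.
have /sigma_finiteP[F [TF ndF Foo]] := sigma_finiteT (@lebesgue_measure R).
have /sigma_finiteP[G [TG ndG Goo]] := sigma_finiteT mu.
pose uncons (v : 'rV[R]_n.+1) : R * 'rV[R]_n :=
  (v ord0 ord0, \row_j v ord0 (lift ord0 j)).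
have consK : cancel (@rV_cons n) uncons.
  move=> [x v]; congr pair; first by rewrite rV_cons0.
  by apply/rowP => j; rewrite mxE rV_consS.
have mu1 : measurable_fun setT uncons.
  apply: measurable_fun_pair; first exact: (@measurable_rV_coord _ _ ord0).
  apply/measurable_fun_rVP => i.
  rewrite (_ : _ \o _ = rV_coord (lift ord0 i)).
    exact: measurable_rV_coord.
  by apply/funext => v /=; rewrite /rV_coord mxE.
exists (fun k => uncons @^-1` (F k `*` G k)).
  apply/esym; rewrite -subTset => v _.
  have [k _ Fk] : (\bigcup_k F k) (uncons v).1 by rewrite -TF.
  have [l _ Gl] : (\bigcup_k G k) (uncons v).2 by rewrite -TG.
  exists (maxn k l) => //; split.
  - by move: Fk; exact/subsetPset/ndF/leq_maxl.
  - by move: Gl; exact/subsetPset/ndG/leq_maxr.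
move=> k; have [mF F_fin] := Foo k; have [mG G_fin] := Goo k; split.
  by rewrite -[X in measurable X]setTI; apply: mu1 => //; exact: measurableX.
rewrite /rV_cons_measure /pushforward -comp_preimage (_ : _ \o _ = id); last first.
  by apply/funext => p /=; rewrite consK.
by rewrite preimage_id product_measure1E// lte_mul_pinfty// ge0_fin_numE.
Qed.

HB.instance Definition _ :=
  Measure_isSigmaFinite.Build _ _ _ rV_cons_measure m_sigma_finite.

End step.

(** Lebesgue measure on R^n, by recursion on n: the image of the product of
    the Lebesgue measures of R and R^(n-1); on the one-point space R^0 it is the
    unit mass. *)
Fixpoint lebesgue_rV (n : nat) :
    {sigma_finite_measure set 'rV[R]_n -> \bar R} :=
  match n with
  | 0 => dirac (0 : 'rV[R]_0)
  | m.+1 => rV_cons_measure (lebesgue_rV m)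
  end.

Lemma lebesgue_rV_box n (A : 'I_n -> set R) : (forall i, measurable (A i)) ->
  lebesgue_rV n [set x | forall i, A i (x ord0 i)]
  = (\prod_(i < n) lebesgue_measure (A i))%E.
Proof.
elim: n A => [|n IHn] A mA.
  by rewrite big_ord0 /= diracE mem_set// => -[].
have mbox : measurable [set x : 'rV[R]_n | forall i, A (lift ord0 i) (x ord0 i)].
  rewrite (_ : [set x | _] =
      \bigcap_(i in [set: 'I_n]) (rV_coord i @^-1` A (lift ord0 i))).
    apply: fin_bigcap_measurable => // i _.
    by rewrite -[X in measurable X]setTI; apply: measurable_rV_coord.
  by apply/seteqP; split => [x Ax i _|x Ax i]; [exact: Ax|exact: (Ax i)].
rewrite big_ord_recl -IHn; last by move=> i; exact: mA.
rewrite -(product_measure1E lebesgue_measure (lebesgue_rV n)) //; last exact: mA.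
rewrite /= /rV_cons_measure /pushforward; congr product_measure1.
apply/seteqP; split => [p /= Ap|p /= [Ap0 ApS] i].
  by split=> [|i]; [rewrite -(rV_cons0 p)|rewrite -rV_consS].
case: (unliftP ord0 i) => [j ->|->]; first by rewrite rV_consS.
by rewrite rV_cons0.
Qed.

End lebesgue_measure_rV.

Section test_functions.
Context {R : realType} {n : nat}.
Implicit Types (f : 'rV[R]_n -> R) (s : seq 'I_n).

Definition unit_vec (i : 'I_n) : 'rV[R]_n := delta_mx ord0 i.

(** [iter_partial [:: i1; ...; ik] f] is d_i1 (... (d_ik f)). *)
Definition iter_partial s f : 'rV[R]_n -> R :=
  foldr (fun i g => 'D_(unit_vec i) g) f s.

(** Class C^oo: the iterated partial derivatives of every order exist
    everywhere and are continuous. *)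
Definition smooth f : Prop :=
  forall s, continuous (iter_partial s f) /\
    forall i x, derivable (iter_partial s f) x (unit_vec i).

(** The space C_c^oo(R^n). *)
Definition test_function f : Prop :=
  smooth f /\ compact (closure [set x | f x != 0]).

End test_functions.

Section sobolev.
Context {R : realType} {n : nat}.
Implicit Types (u : 'rV[R]_n -> R) (i k : nat).

Local Notation mu := (@lebesgue_rV R n).

(** The normed structure of the library on ['rV[R]_n] is the sup norm. *)
Definition euclidean_norm (x : 'rV[R]_n) : R :=
  Num.sqrt (\sum_(j < n) x ord0 j ^+ 2).

(** R^(n^i), with coordinates indexed by [i.-tuple 'I_n]. *)
Definition tensor_norm i (T : i.-tuple 'I_n -> R) : R :=
  Num.sqrt (\sum_(s : i.-tuple 'I_n) T s ^+ 2).

Definition L1 u : Prop := mu.-integrable setT (EFin \o u).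

(** [v] is a weak derivative of [u] with respect to the directions in [s]. *)
Definition weak_partial (s : seq 'I_n) u (v : 'rV[R]_n -> R) : Prop :=
  forall psi, test_function psi ->
    \int[mu]_x (u x * iter_partial s psi x) =
    (-1) ^+ size s * \int[mu]_x (v x * psi x).

(** [V] is an L^1 weak derivative of order [i] of [u]. *)
Definition weak_derivative i u (V : 'rV[R]_n -> i.-tuple 'I_n -> R) : Prop :=
  forall s : i.-tuple 'I_n, L1 (V^~ s) /\ weak_partial s u (V^~ s).

Definition sobolev_int k u : Prop :=
  L1 u /\ forall i, (1 <= i <= k)%N -> exists V, @weak_derivative i u V.

(** D^i u, a chosen representative of the weak derivative (which is unique up
    to a null set), with D^0 u = u. *)
Definition Dw i u : 'rV[R]_n -> i.-tuple 'I_n -> R :=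
  if i is 0 then fun x _ => u x
  else xget (fun _ _ => 0) [set V | @weak_derivative i u V].
Arguments Dw i u : clear implicits.

(** The norms take the value [+oo] outside of the corresponding space. *)
Definition sobolev_int_norm k u : \bar R :=
  if `[< sobolev_int k u >] then
    (\sum_(i < k.+1) \int[mu]_x (tensor_norm (Dw i u x))%:E)%E
  else +oo%E.

Definition gagliardo k (theta : R) u : \bar R :=
  (\int[mu]_y \int[mu]_x
     (tensor_norm (fun s => Dw k u x s - Dw k u y s)
      / euclidean_norm (x - y) `^ (theta + n%:R))%:E)%E.

(** For [0 < alpha], [k] is the integer part of [alpha], so alpha = k + theta
    with 0 <= theta < 1. *)
Definition sobolev_norm (alpha : R) u : \bar R :=
  let k := Num.truncn alpha in
  let theta := alpha - k%:R in
  if theta == 0 then sobolev_int_norm k u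
  else (sobolev_int_norm k u + gagliardo k theta u)%E.

Definition cap_compact (alpha : R) (K : set 'rV[R]_n) : \bar R :=
  ereal_inf [set sobolev_norm alpha phi | phi in
    [set phi | [/\ test_function phi, (forall x, 0 <= phi x) &
                   (forall x, K x -> 1 < phi x)]]].

Definition cap_open (alpha : R) (omega : set 'rV[R]_n) : \bar R :=
  ereal_sup [set cap_compact alpha K | K in
    [set K | compact K /\ K `<=` omega]].

(** The Choquet integral of |phi|. *)
Definition choquet_integral (alpha : R) (phi : 'rV[R]_n -> R) : \bar R :=
  (\int[lebesgue_measure]_(t in `]0%R, +oo[)
     cap_open alpha [set x | (t < `|phi x|)%R])%E.

End sobolev.
Arguments Dw {R n} i u x s.

(* Main.v *)
(** The sets [|phi| > t] are covered by dyadic cubes chosen once for all t. If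
    |phi| <= sum_Q c_Q 1_Q, the sum running over dyadic cubes Q of side l_Q <= 1,
    then at each point x with |phi x| > t there is a cube Q containing x at which
    the partial sums of c over the cubes containing Q cross t, and Q is used for a
    set of values t of measure c_Q. As a bump on Q has W^{alpha,1} norm at most
    C l_Q^(d - alpha), integrating in t bounds the Choquet integral by
    C sum_Q c_Q l_Q^(d - alpha). It remains to choose c with
    sum_Q c_Q l_Q^(d - alpha) <= C |phi|_{W^{alpha,1}}. For 0 < alpha < 1 take the
    mean oscillation of phi on Q, which the Gagliardo seminorm controls; for
    alpha = 1 truncate |phi| repeatedly, from coarse to fine cubes, at the least
    level exceeded on at most half of each cube one scale finer, and use the
    Poincare inequality; and pass from alpha to alpha + 1 through the oscillations
    of phi on Q, bounded by those cubes which decompose the gradient. The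
    decompositions are made on a finite grid, whose mesh tends to 0 at the end. *)

Require Import Defs.
From mathcomp Require Import all_boot all_order all_algebra.
From mathcomp Require Import zify ring lra.
Set Implicit Arguments.
Unset Strict Implicit.
Unset Printing Implicit Defensive.
Import Order.TTheory GRing.Theory Num.Theory.
Local Open Scope ring_scope.

(** * Averages and oscillations on a finite grid *)

(** The obstacle is order $1$. A cube of side $l$ costs $l^{d-1}$ and the oscillation on it is at
    most a multiple of $l$ times the mean gradient, so each scale would pay for the whole gradient
    and the total would grow with the number of scales. Truncation gives each scale its own slice of
    values, and the variations of the slices add up to that of the function. In the fractional case
    two points at distance $r$ share only cubes of side at least about $r$; the weights of these
    cubes grow geometrically towards that scale, so their sum is comparable with the Gagliardo
    kernel. Capacities are never added: for each $t$ the cubes in use yield one competitor, a sum of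
    bumps. Sides at most $1$ let the lower order terms of the norm of a bump be absorbed by the
    highest one; in exchange the means over unit cubes remain, and the $L^1$ norm pays for them.
    Sampling errs by a Lipschitz constant times the mesh on each cell of a box of fixed volume, and
    by $2^{-N} 2^{\theta N}$ in the Gagliardo sums. Both errors vanish in the limit, so they may
    contain constants that depend on the function. *)

Section grid.
Variables (R : realFieldType) (d n : nat).
Local Notation cell := {ffun 'I_d -> 'I_n}.
Implicit Types (a b w y z : cell) (f g u : cell -> R) (q : nat).

(** Membership in the same aligned block with [q] cells to a side. For [q] a power of two these
    blocks are the dyadic cubes. *)
Definition same q a b := [forall i, (a i %/ q == b i %/ q)%N].

Lemma sameP q a b : reflect (forall i, a i %/ q = b i %/ q)%N (same q a b).
Proof. by apply: (iffP forallP) => H i; apply/eqP; exact: H. Qed.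

Lemma same_refl q a : same q a a.
Proof. exact/sameP. Qed.

Lemma same_sym q a b : same q a b = same q b a.
Proof. by apply/sameP/sameP => H i; rewrite H. Qed.

Lemma same_trans q : transitive (same q).
Proof. by move=> b a c /sameP ab /sameP bc; apply/sameP => i; rewrite ab. Qed.

Lemma same_eq q a b : same q a b -> same q a =1 same q b.
Proof.
move=> ab c; apply/idP/idP; last exact: same_trans.
by apply: same_trans; rewrite same_sym.
Qed.

Lemma same_dvd q q' a b : (q %| q')%N -> same q a b -> same q' a b.
Proof.
move=> /dvdnP[m ->] /sameP ab; apply/sameP => i.
by rewrite mulnC !divnMA ab.
Qed.

Lemma same1 a b : same 1 a b = (a == b).
Proof.
apply/sameP/eqP => [H|-> //]; apply/ffunP => i; apply/val_inj.
by have := H i; rewrite !divn1.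
Qed.

Definition upd a (k : 'I_d) (t : 'I_n) : cell :=
  [ffun i => if i == k then t else a i].

(** At the last index the default of [insubd] returns the index itself, so an edge that would leave
    the grid has equal ends. *)
Definition next_ord (t : 'I_n) : 'I_n := insubd t t.+1.

Definition next k a : cell := upd a k (next_ord (a k)).

Lemma upd_same q a k t : same q a (upd a k t) = (t %/ q == a k %/ q)%N.
Proof.
apply/sameP/eqP => [/(_ k)|H i]; rewrite ffunE; first by rewrite eqxx.
by case: eqP => [->|//]; rewrite H.
Qed.

Lemma updK a k t : upd (upd a k t) k (a k) = a.
Proof. by apply/ffunP => i; rewrite !ffunE; case: eqP => // ->. Qed.

Lemma upd_upd a k t s : upd (upd a k t) k s = upd a k s.
Proof. by apply/ffunP => i; rewrite !ffunE; case: eqP. Qed.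

Lemma next_upd a k t : next k (upd a k t) = upd a k (next_ord t).
Proof. by rewrite /next upd_upd ffunE eqxx. Qed.

Lemma card_block q (c : 'I_n) : (q %| n)%N ->
  #|[pred t : 'I_n | t %/ q == c %/ q]%N| = q.
Proof.
move=> /dvdnP[m nE].
have q0 : (0 < q)%N.
  have : (0 < n)%N by apply: leq_ltn_trans (ltn_ord c).
  by rewrite nE muln_gt0 => /andP[].
have cm : (c %/ q < m)%N by rewrite ltn_divLR// -nE.
have Hlt (s : 'I_q) : (c %/ q * q + s < n)%N.
  rewrite [leqRHS]nE; apply: (@leq_trans ((c %/ q).+1 * q)%N); last by rewrite leq_mul2r cm orbT.
  by rewrite mulSn addnC ltn_add2r.
have inj : injective (fun s : 'I_q => Ordinal (Hlt s)).
  by move=> s s' /(congr1 val)/= /addnI /val_inj.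
transitivity #|codom (fun s : 'I_q => Ordinal (Hlt s))|; last by rewrite card_codom// card_ord.
apply: eq_card => t; rewrite inE; apply/eqP/codomP => [tc|[s ->]]/=.
  exists (Ordinal (ltn_pmod t q0)); apply/val_inj => /=.
  by rewrite -tc -divn_eq.
by rewrite divnMDl// [(s %/ q)%N]divn_small ?ltn_ord// addn0.
Qed.

Lemma card_same q a : (q %| n)%N -> #|same q a| = (q ^ d)%N.
Proof.
move=> qn.
have -> : #|same q a| =
    #|family (fun i : 'I_d => [pred t : 'I_n | t %/ q == a i %/ q]%N)|.
  apply: eq_card => b; apply/sameP/familyP => H i.
    by rewrite inE H.
  by have := H i; rewrite inE => /eqP.
rewrite card_family foldrE big_image /=.
under eq_bigr do rewrite card_block//.
by rewrite prod_nat_const card_ord.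
Qed.

(** Telescoping from [x] to [y]: every step in between stays in the block. *)
Lemma line_bound q (F : 'I_n -> R) (x y : 'I_n) : (x %/ q = y %/ q)%N ->
  `|F x - F y| <= \sum_(t : 'I_n | ((t %/ q == x %/ q) && (next_ord t %/ q == t %/ q))%N)
     `|F (next_ord t) - F t|.
Proof.
wlog xy : x y / (x <= y)%N => [hw xyq|].
  have [xy|/ltnW yx] := leqP x y; first exact: hw.
  by rewrite distrC (le_trans (hw _ _ yx (esym xyq)))// xyq.
move=> xyq.
pose G (t : nat) := F (insubd x t).
have GE (t : 'I_n) : G t = F t by rewrite /G valKd.
rewrite distrC -(GE x) -(GE y) -(telescope_sumr G xy).
apply: (le_trans (ler_norm_sum _ _ _)).
have nx (t : 'I_n) : (t < y)%N -> next_ord t = t.+1 :> nat.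
  by move=> ty; rewrite /next_ord val_insubd (leq_ltn_trans ty).
rewrite (big_nat_widen _ _ n) ?(ltnW (ltn_ord y))// big_geq_mkord.
rewrite big_mkcond [leRHS]big_mkcond; apply: ler_sum => t _ /=.
case: ifPn => [/andP[ty xt]|_]; last by case: ifP.
have tq : (t %/ q = x %/ q)%N.
  by apply/eqP; rewrite eqn_leq {1}xyq !leq_div2r// ltnW.
have sq : (t.+1 %/ q = x %/ q)%N.
  by apply/eqP; rewrite eqn_leq {1}xyq !leq_div2r// ltnW.
by rewrite nx// tq sq !eqxx /= -GE nx// GE.
Qed.

(* Swapping the first [m] coordinates of a pair of points of a cube is an
   involution, which makes the coordinate-by-coordinate path average well. *)
Definition mix m y z : cell := [ffun i : 'I_d => if (i < m)%N then z i else y i].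

Lemma mixK m y z : mix m (mix m y z) (mix m z y) = y.
Proof. by apply/ffunP => i; rewrite !ffunE; case: (i < m)%N. Qed.

Lemma same_mix q a m y z :
  same q a (mix m y z) && same q a (mix m z y) = same q a y && same q a z.
Proof.
have H y' z' : same q a y' && same q a z' -> same q a (mix m y' z').
  move=> /andP[/sameP ay /sameP az]; apply/sameP => i.
  by rewrite ffunE; case: (i < m)%N.
have H2 y' z' : same q a y' && same q a z' ->
    same q a (mix m y' z') && same q a (mix m z' y').
  by move=> yz; rewrite !H// andbC.
by apply/idP/idP => /H2//; rewrite !mixK.
Qed.

Lemma mixS (k : 'I_d) y z : mix k.+1 y z = upd (mix k y z) k (z k).
Proof.
apply/ffunP => i; rewrite !ffunE ltnS leq_eqVlt.
have [->|ne] := eqVneq i k; first by rewrite eqxx.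
by have -> : (i == k :> nat) = false := negbTE ne.
Qed.

Lemma dist_path f y z :
  `|f y - f z| <= \sum_(k < d) `|f (mix k y z) - f (upd (mix k y z) k (z k))|.
Proof.
have -> : f y - f z = - (f (mix d y z) - f (mix 0 y z)).
  rewrite opprB; congr (f _ - f _); apply/ffunP => i; rewrite ffunE//.
  by rewrite ltn_ord.
rewrite normrN -(telescope_sumr (fun m => f (mix m y z)) (leq0n d)) big_mkord.
apply: le_trans (ler_norm_sum _ _ _) _; apply: ler_sum => k _.
by rewrite mixS distrC.
Qed.

(** Once the involution is applied, the [k]-th step of the path starts at an arbitrary cell [y] of
    the cube and only its [k]-th coordinate moves. *)
Lemma dist_path_sum q a f :
  \sum_(y | same q a y) \sum_(z | same q a z) `|f y - f z| <=
  \sum_(k < d) \sum_(y | same q a y) \sum_(z | same q a z)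
     `|f y - f (upd y k (z k))|.
Proof.
apply: (@le_trans _ _ (\sum_(k < d) \sum_(y | same q a y) \sum_(z | same q a z)
   `|f (mix k y z) - f (upd (mix k y z) k (z k))|)).
  rewrite [leRHS]exchange_big; apply: ler_sum => y ay.
  by rewrite [leRHS]exchange_big; apply: ler_sum => z az; exact: dist_path.
apply: ler_sum => k _; rewrite !pair_big /=.
pose h (p : cell * cell) := (mix k p.1 p.2, mix k p.2 p.1).
have hK : involutive h by case=> y z; rewrite /h/= !mixK.
rewrite [leRHS](reindex_inj (inv_inj hK)) /=.
rewrite [leRHS](eq_bigl (fun p => same q a p.1 && same q a p.2)); last first.
  by move=> p; exact: same_mix.
by apply: ler_sum => -[y z] _ /=; rewrite ffunE ltnn.
Qed.

(** The discrete total variation, restricted to edges that do not leave a block of side [q]. *)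
Definition edge_sum q (P : pred cell) f : R :=
  \sum_(k < d) \sum_(w | P w && same q w (next k w)) `|f (next k w) - f w|.

(** In [dist_path_sum] the cell [z] matters only through [z k], and [line_bound] replaces the step
    by the variation along a whole line of the cube: the sum over [z] gives the factor [q ^ d].
    Exchanging [y k] with the position [t] on the line then shows that each edge is counted once for
    each of the [q] values of [y k]. *)
Lemma poincare q a f : (q %| n)%N ->
  \sum_(y | same q a y) \sum_(z | same q a z) `|f y - f z| <=
  (q ^ d * q)%:R * edge_sum q (same q a) f.
Proof.
move=> qn; apply: (le_trans (dist_path_sum _ _ _)).
rewrite /edge_sum mulr_sumr; apply: ler_sum => k _.
apply: (@le_trans _ _ (\sum_(y | same q a y) \sum_(z | same q a z)
   \sum_(t : 'I_n | (t %/ q == y k %/ q)%N)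
     (if same q (upd y k t) (next k (upd y k t))
      then `|f (next k (upd y k t)) - f (upd y k t)| else 0))).
  apply: ler_sum => y ay; apply: ler_sum => z az.
  have zy : (y k %/ q = z k %/ q)%N by rewrite -(sameP _ _ _ ay) (sameP _ _ _ az).
  rewrite -[y in f y](updK y k (y k)) upd_upd.
  apply: (le_trans (line_bound (fun t => f (upd y k t)) zy)).
  rewrite big_mkcondr /=; apply: ler_sum => t _.
  by rewrite next_upd -(upd_upd y k t) upd_same ffunE eqxx.
rewrite (eq_bigr (fun y => (q ^ d)%:R * \sum_(t : 'I_n | (t %/ q == y k %/ q)%N)
     (if same q (upd y k t) (next k (upd y k t))
      then `|f (next k (upd y k t)) - f (upd y k t)| else 0))); last first.
  by move=> y _; rewrite sumr_const card_same// mulr_natl.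
rewrite -mulr_sumr natrM -mulrA ler_wpM2l//.
pose G w := if same q w (next k w) then `|f (next k w) - f w| else 0.
rewrite -/(G _) big_mkcondr -[in leRHS]/(G _).
rewrite (pair_big_dep (same q a) (fun y (t : 'I_n) => t %/ q == y k %/ q)%N
  (fun y t => G (upd y k t))) /=.
pose h (p : cell * 'I_n) := (upd p.1 k p.2, p.1 k).
have hK : involutive h.
  by case=> y t; rewrite /h/= updK ffunE eqxx.
rewrite (reindex_inj (inv_inj hK)) /=.
rewrite (eq_bigl (fun p : cell * 'I_n => same q a p.1 && (p.2 %/ q == p.1 k %/ q)%N)).
  rewrite -(pair_big_dep (same q a) (fun y (t : 'I_n) => t %/ q == y k %/ q)%N
    (fun y t => G (upd (upd y k t) k (y k)))) /=.
  rewrite mulr_sumr; apply: ler_sum => y _.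
  under eq_bigr do rewrite updK.
  by rewrite sumr_const card_block// mulr_natl.
case=> y t /=; rewrite ffunE eqxx.
rewrite [(y k %/ q == _)%N]eq_sym; have [ty|] := boolP (t %/ q == y k %/ q)%N; last by rewrite !andbF.
rewrite !andbT; apply/idP/idP => H; apply: same_trans H _; last by rewrite upd_same.
by rewrite same_sym upd_same.
Qed.

Definition avg q f a : R := (q ^ d)%:R^-1 * \sum_(b | same q a b) f b.

(** A mean over pairs rather than around the average: both the Gagliardo double integral and the
    paths of [poincare] produce this form. *)
Definition osc q f a : R :=
  (q ^ d)%:R^-1 ^+ 2 * \sum_(y | same q a y) \sum_(z | same q a z) `|f y - f z|.

Definition level q f := forall a b, same q a b -> f a = f b.

Lemma level_avg q q' f : (q %| q')%N -> level q (avg q' f).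
Proof.
move=> qq a b ab; rewrite /avg; congr (_ * _); apply: eq_bigl.
exact/same_eq/(same_dvd qq).
Qed.

Lemma level_osc q f : level q (osc q f).
Proof.
move=> a b ab; rewrite /osc; congr (_ * _).
rewrite (eq_bigl _ _ (same_eq ab)); apply: eq_bigr => y _.
by rewrite (eq_bigl _ _ (same_eq ab)).
Qed.

Lemma level_dvd q q' f : (q %| q')%N -> level q' f -> level q f.
Proof. by move=> qq lf a b ab; apply: lf; exact: same_dvd qq ab. Qed.

Lemma avg_ge0 q f a : (forall b, 0 <= f b) -> 0 <= avg q f a.
Proof. by move=> f0; rewrite mulr_ge0// ?invr_ge0// sumr_ge0. Qed.

Lemma osc_ge0 q f a : 0 <= osc q f a.
Proof.
rewrite mulr_ge0// ?exprn_ge0 ?invr_ge0//.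
by apply: sumr_ge0 => y _; apply: sumr_ge0.
Qed.

Lemma avg_norm q f a : `|avg q f a| <= avg q (fun b => `|f b|) a.
Proof.
rewrite normrM ger0_norm ?invr_ge0// ler_wpM2l ?invr_ge0//.
exact: ler_norm_sum.
Qed.

Lemma avg_sum (I : Type) (r : seq I) (P : pred I) (F : I -> cell -> R) q a :
  avg q (fun b => \sum_(i <- r | P i) F i b) a = \sum_(i <- r | P i) avg q (F i) a.
Proof. by rewrite /avg exchange_big mulr_sumr. Qed.

Lemma avg_level q f a : (0 < q)%N -> (q %| n)%N -> level q f -> avg q f a = f a.
Proof.
move=> q0 qn lf; rewrite /avg (eq_bigr (fun=> f a)) => [|b ab]; last exact/esym/lf.
rewrite sumr_const card_same// -[f a *+ _]mulr_natl mulKf//.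
by rewrite pnatr_eq0 expn_eq0 negb_and -lt0n q0.
Qed.

Lemma avg1 f a : avg 1 f a = f a.
Proof. by apply: avg_level => // b c; rewrite same1 => /eqP ->. Qed.

Lemma sum_avg q f : (0 < q)%N -> (q %| n)%N -> \sum_a avg q f a = \sum_a f a.
Proof.
move=> q0 qn; rewrite /avg -mulr_sumr.
rewrite (exchange_big_dep xpredT)//= mulr_sumr; apply: eq_bigr => b _.
under eq_bigl do rewrite same_sym.
rewrite sumr_const card_same// -[f b *+ _]mulr_natl mulKf//.
by rewrite pnatr_eq0 expn_eq0 negb_and -lt0n q0.
Qed.

(** The difference is the mean of [f y - f z] over [y] in the subcube and [z] in the cube. The
    subcube is the fraction $2^{-d}$ of the cube, so letting [y] range over the whole cube costs
    $2^d$. *)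
Lemma avg_half p f a : (0 < p)%N -> (p.*2 %| n)%N ->
  `|avg p f a - avg p.*2 f a| <= 2 ^+ d * osc p.*2 f a.
Proof.
move=> p0 pn.
have pp : (p %| p.*2)%N by rewrite -muln2 dvdn_mulr.
have pn' := dvdn_trans pp pn.
have x0 m : (0 < m)%N -> (m ^ d)%:R != 0 :> R.
  by move=> m0; rewrite pnatr_eq0 expn_eq0 negb_and -lt0n m0.
have -> : avg p f a - avg p.*2 f a = (p ^ d)%:R^-1 * (p.*2 ^ d)%:R^-1 *
    \sum_(y | same p a y) \sum_(z | same p.*2 a z) (f y - f z).
  under eq_bigr do rewrite big_split/= sumr_const card_same// sumrN.
  rewrite big_split/= sumr_const card_same// sumrMnl /avg.
  have p20 : (0 < p.*2)%N by rewrite double_gt0.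
  set S1 := \sum_(_ | _) _; set S2 := \sum_(_ | _) _.
  rewrite -[S1 *+ _]mulr_natl -[(- S2) *+ _]mulr_natl.
  by field; rewrite !x0.
rewrite normrM ger0_norm ?mulr_ge0 ?invr_ge0//.
rewrite /osc mulrA; apply: ler_pM => //.
- by rewrite mulr_ge0 ?invr_ge0.
- have PE : (p.*2 ^ d)%:R = 2 ^+ d * (p ^ d)%:R :> R.
    by rewrite -mul2n expnMn natrM natrX.
  rewrite le_eqVlt PE; apply/orP; left; apply/eqP; field.
  by rewrite x0// expf_neq0// pnatr_eq0.
- apply: (le_trans (ler_norm_sum _ _ _)).
  apply: (@le_trans _ _ (\sum_(y | same p a y) \sum_(z | same p.*2 a z) `|f y - f z|)).
    by apply: ler_sum => y _; exact: ler_norm_sum.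
  rewrite big_mkcond [leRHS]big_mkcond; apply: ler_sum => y _.
  case: ifPn => [/(same_dvd pp) -> //|_].
  by case: ifP => // _; exact: sumr_ge0.
Qed.

Lemma osc_gradient q f a : (0 < q)%N -> (q %| n)%N ->
  osc q f a <= q%:R * avg q (fun w => \sum_(k < d)
     if same q w (next k w) then `|f (next k w) - f w| else 0) a.
Proof.
move=> q0 qn.
have x0 : (q ^ d)%:R != 0 :> R by rewrite pnatr_eq0 expn_eq0 negb_and -lt0n q0.
rewrite /osc avg_sum.
apply: le_trans (ler_wpM2l _ (poincare a f qn)) _; first by rewrite exprn_ge0 ?invr_ge0.
rewrite /avg -mulr_sumr.
under [in leRHS]eq_bigr do rewrite -big_mkcondr.
rewrite -/(edge_sum _ _ _) natrM le_eqVlt; apply/orP; left; apply/eqP; field.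
exact: x0.
Qed.

End grid.

(** * Dyadic decompositions on a finite grid *)

Section decomposition.
Variables (R : realFieldType) (d n N : nat).
Hypothesis Nn : (2 ^ N %| n)%N.
Local Notation cell := {ffun 'I_d -> 'I_n}.
Implicit Types (a b w y z : cell) (f g u : cell -> R) (q : nat) (c : nat -> cell -> R).

Local Notation side j := (2 ^ (N - j))%N.

(** [c j a] is the coefficient of the cube of side $2^{-j}$ that contains the cell [a]. It is stored
    at each cell and required to be constant on cubes, which replaces a type of dyadic cubes. *)
Definition decomposes f c :=
  [/\ forall j a, 0 <= c j a, forall j, level (side j) (c j) &
      forall a, f a <= \sum_(j < N.+1) c j a].

(** Each coefficient is counted once per cell of its cube. Times the volume of a cell, a cube of
    side $l = 2^{-j}$ thus has weight $l^d v^j$, which is $l^{d-\alpha}$ for $v = 2^\alpha$. *)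
Definition cost (v : R) c : R := \sum_(j < N.+1) v ^+ j * \sum_a c j a.

Lemma edge_sum_ge0 q P f : 0 <= edge_sum q P f.
Proof. by apply: sumr_ge0 => k _; apply: sumr_ge0. Qed.

Let pow2_ge0 m : 0 <= 2 ^+ m :> R.
Proof. exact: exprn_ge0. Qed.

Lemma side_gt0 j : (0 < side j)%N. Proof. by rewrite expn_gt0. Qed.

Lemma side_dvd j : (side j %| n)%N.
Proof. by apply: dvdn_trans Nn; rewrite dvdn_exp2l// leq_subr. Qed.

Lemma side_mono i j : (i <= j)%N -> (side j %| side i)%N.
Proof. by move=> ij; rewrite dvdn_exp2l// leq_sub2l. Qed.

Lemma sideS j : (j < N)%N -> side j = (side j.+1).*2.
Proof. by move=> jN; rewrite -mul2n -expnS subnSK. Qed.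

(** The averages telescope from the unit cube down to the single cell, and each halving is paid by
    [avg_half]. *)
Lemma norm_le_osc f a :
  `|f a| <= avg (2 ^ N) (fun b => `|f b|) a + \sum_(j < N) 2 ^+ d * osc (side j) f a.
Proof.
have -> : f a = avg (side 0) f a +
    \sum_(0 <= j < N) (avg (side j.+1) f a - avg (side j) f a).
  by rewrite telescope_sumr// subnn expn0 avg1 addrC subrK.
rewrite subn0; apply: (le_trans (ler_normD _ _)); apply: lerD; first exact: avg_norm.
rewrite big_mkord; apply: (le_trans (ler_norm_sum _ _ _)); apply: ler_sum => j _.
by rewrite (sideS (ltn_ord j)) avg_half// ?side_gt0// -sideS ?side_dvd.
Qed.

(** The terms of [norm_le_osc] are already constant on cubes. The passage from generation [j] to the
    next is charged at [j], so generation [N] carries an oscillation only as zero. *)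
Lemma decompose_osc (v : R) f : 0 <= v ->
  exists2 c, decomposes (fun a => `|f a|) c &
    cost v c <= \sum_a `|f a| +
      2 ^+ d * \sum_(j < N) v ^+ j * \sum_a osc (side j) f a.
Proof.
move=> v0.
pose c j a := (if j == 0%N then avg (2 ^ N) (fun b => `|f b|) a else 0) +
  (if (j < N)%N then 2 ^+ d * osc (side j) f a else 0).
exists c; first split.
- move=> j a; rewrite addr_ge0//; case: ifP => // _; first exact: avg_ge0.
  by rewrite mulr_ge0 ?exprn_ge0 ?osc_ge0.
- move=> j a b ab; rewrite /c; congr (_ + _).
    by case: eqP ab => // ->; rewrite subn0 => ab; apply: level_avg ab.
  by case: ifP => // _; rewrite (level_osc _ ab).
- move=> a; apply: (le_trans (norm_le_osc f a)); rewrite /c big_split/=; apply: lerD.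
    by rewrite big_ord_recl/= lerDl sumr_ge0.
  rewrite big_ord_recr/= ltnn addr0; apply: ler_sum => j _.
  by rewrite ltn_ord.
rewrite /cost /c.
under eq_bigr do rewrite big_split/= mulrDr.
rewrite big_split/=; apply: lerD.
  rewrite big_ord_recl/= [X in _ + X]big1 ?addr0; last by move=> i _; rewrite big1 ?mulr0.
  by rewrite expr0 mul1r sum_avg ?expn_gt0.
rewrite big_ord_recr/= ltnn [X in _ * X]big1// mulr0 addr0 mulr_sumr.
by apply: ler_sum => j _; rewrite ltn_ord -mulr_sumr mulrCA.
Qed.

Lemma sum_pow_half l m : \sum_(j < m | (l < j)%N) (2^-1 : R) ^+ j <= 2^-1 ^+ l.
Proof.
(* The rest of the geometric series is carried along so that the induction closes. *)
have H : \sum_(j < m | (l < j)%N) (2^-1 : R) ^+ j +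
    (if (l < m)%N then 2 * 2^-1 ^+ m else 2^-1 ^+ l) <= 2^-1 ^+ l.
  elim: m => [|m IH]; first by rewrite big_ord0 add0r.
  rewrite big_mkcond big_ord_recr/= -big_mkcond/= ltnS.
  have e : 2 * 2^-1 ^+ m.+1 = 2^-1 ^+ m :> R by rewrite exprS mulrA divff ?mul1r// pnatr_eq0.
  case: (ltngtP l m) IH => [lm|lm|->] IH.
  - by rewrite e; move: IH; lra.
  - by rewrite addr0.
  - by rewrite e; move: IH; rewrite addr0.
apply: le_trans H; rewrite lerDl; case: ifP => _; rewrite ?mulr_ge0// exprn_ge0// invr_ge0//.
Qed.

Lemma sum_pow_le (v : R) l : 1 < v -> \sum_(j < l.+1) v ^+ j <= v / (v - 1) * v ^+ l.
Proof.
move=> v1.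
have v10 : v - 1 != 0 by rewrite subr_eq0 gt_eqF.
have := subrX1 v l.+1 => /(congr1 (fun x => x / (v - 1))).
rewrite mulrAC divff// mul1r => <-.
rewrite mulrAC; apply: ler_wpM2r; first by rewrite invr_ge0 subr_ge0 ltW.
by rewrite -exprS lerBlDr lerDl.
Qed.

Definition raise_const (v : R) : R := 2 ^+ d * (v / (v - 1) + 1).

(** The oscillation on a cube of side $2^{-j}$ is at most $2^{-j}$ times the mean there of the sum
    of the [c l]. For [l >= j] this mean is kept at generation [j]. For [l < j] the function [c l]
    is constant on the cube, and the sum of $2^{-j}$ over all [j > l] lets the whole contribution be
    moved back to generation [l] with factor $2^{-l}$. In the cost, $(2v)^j 2^{-j} = v^j$, averaging
    preserves sums, and $v > 1$ bounds the sum of $v^j$ over [j <= l] by a multiple of $v^l$. *)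
Lemma decompose_gradient (v : R) f (G : 'I_d -> cell -> R) c : 1 < v ->
    (forall k w, same (2 ^ N) w (next k w) -> 2 ^+ N * `|f (next k w) - f w| <= G k w) ->
    (forall k w, 0 <= G k w) ->
    decomposes (fun a => \sum_(k < d) G k a) c ->
  exists2 c', decomposes (fun a => `|f a|) c' &
    cost (2 * v) c' <= \sum_a `|f a| + raise_const v * cost v c.
Proof.
move=> v1 fG G0 [c0 cl cG].
have v0 : 0 <= v by rewrite (le_trans _ (ltW v1)).
pose s j : R := 2^-1 ^+ j.
have s0 j : 0 <= s j by rewrite exprn_ge0// invr_ge0.
pose c' j a := (if j == 0%N then avg (2 ^ N) (fun b => `|f b|) a else 0) +
  2 ^+ d * (s j * (\sum_(l < N.+1 | (j <= l)%N) avg (side j) (c l) a + c j a)).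
exists c'; first split.
- move=> j a; rewrite addr_ge0//.
    by case: ifP => // _; exact: avg_ge0.
  rewrite mulr_ge0 ?exprn_ge0// mulr_ge0// addr_ge0// sumr_ge0// => l _.
  exact: avg_ge0.
- move=> j a b ab; rewrite /c'; congr (_ + _ * (_ * (_ + _))).
  + by case: eqP ab => // ->; rewrite subn0 => ab; apply: level_avg ab.
  + by apply: eq_bigr => l _; apply: level_avg ab.
  + exact: cl.
- move=> a; apply: (le_trans (norm_le_osc f a)); rewrite /c' big_split/=; apply: lerD.
    by rewrite big_ord_recl/= lerDl sumr_ge0.
  rewrite -!mulr_sumr ler_wpM2l ?exprn_ge0//.
  apply: (@le_trans _ _ (\sum_(j < N) s j * \sum_(l < N.+1) avg (side j) (c l) a)).
    apply: ler_sum => j _.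
    apply: le_trans (osc_gradient f a (side_gt0 j) (side_dvd j)) _.
    (* The length of the cube is $2^{-j}$ in units where a cell has length $2^{-N}$; the factor
       $2^N$ left over turns differences between neighbours into difference quotients. *)
    have -> : (side j)%:R = s j * 2 ^+ N :> R.
      have -> : 2 ^+ N = 2 ^+ (N - j) * 2 ^+ j :> R.
        by rewrite -exprD subnK// ltnW.
      by rewrite natrX mulrCA /s -exprMn mulVf ?pnatr_eq0// expr1n mulr1.
    rewrite -mulrA ler_wpM2l// -avg_sum mulrC /avg mulrC mulrCA mulr_sumr.
    rewrite ler_wpM2l ?invr_ge0//; apply: ler_sum => b _; apply: le_trans (cG b).
    rewrite mulr_sumr; apply: ler_sum => k _; case: ifP => [|_]; last by rewrite mulr0 G0.
    by move=> bb; have := same_dvd (side_mono (leq0n j)) bb; rewrite subn0; exact: fG.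
  rewrite [leRHS](eq_bigr (fun j : 'I_N.+1 => s j * (\sum_(l < N.+1 | (j <= l)%N) avg (side j) (c l) a)
      + s j * c j a)); last by move=> j _; rewrite mulrDr.
  rewrite [leRHS]big_split/=.
  rewrite (eq_bigr (fun j : 'I_N => s j * (\sum_(l < N.+1 | (j <= l)%N) avg (side j) (c l) a)
      + \sum_(l < N.+1 | (l < j)%N) s j * c l a)); last first.
    move=> j _; rewrite (bigID (fun l : 'I_N.+1 => (j <= l)%N))/= mulrDr; congr (_ + _).
    rewrite mulr_sumr; apply: eq_big => l; rewrite -ltnNge// => lj; congr (_ * _).
    apply: avg_level; rewrite ?side_gt0 ?side_dvd//.
    by apply: level_dvd (cl l); apply: side_mono; exact: ltnW.
  rewrite big_split/=; apply: lerD.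
    rewrite [leRHS]big_ord_recr/= lerDl mulr_ge0// sumr_ge0// => l _.
    exact: avg_ge0.
  rewrite (exchange_big_dep xpredT)//=; apply: ler_sum => l _.
  by rewrite -mulr_suml ler_wpM2r// sum_pow_half.
rewrite /cost /c'.
under eq_bigr do rewrite big_split/= mulrDr.
rewrite big_split/=; apply: lerD.
  rewrite big_ord_recl/= [X in _ + X]big1 ?addr0; last by move=> i _; rewrite big1 ?mulr0.
  by rewrite expr0 mul1r sum_avg ?expn_gt0.
have sE j : (2 * v) ^+ j * s j = v ^+ j.
  by rewrite exprMn mulrAC /s -exprMn divff ?expr1n ?mul1r// pnatr_eq0.
rewrite (eq_bigr (fun j : 'I_N.+1 => 2 ^+ d * (v ^+ j *
    (\sum_(l < N.+1 | (j <= l)%N) \sum_a c l a + \sum_a c j a)))); last first.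
  move=> j _; rewrite -mulr_sumr mulrCA -mulr_sumr; congr (_ * _).
  rewrite mulrA sE; congr (_ * _).
  rewrite big_split/= exchange_big/=; congr (_ + _).
  by apply: eq_bigr => l _; rewrite sum_avg ?side_gt0 ?side_dvd.
rewrite -mulr_sumr /raise_const -mulrA ler_wpM2l ?exprn_ge0//.
under [leLHS]eq_bigr do rewrite mulrDr.
rewrite big_split/= mulrDl mul1r lerD2r.
under [leLHS]eq_bigr do rewrite mulr_sumr.
rewrite (exchange_big_dep xpredT)//= mulr_sumr; apply: ler_sum => l _.
rewrite -mulr_suml mulrA ler_wpM2r ?sumr_ge0//.
apply: le_trans (sum_pow_le l v1).
by rewrite (big_ord_widen N.+1 (fun j => v ^+ j) (ltn_ord l)).
Qed.

(** Only $0$ and the values of [g] are tried as levels. If the least admissible one is positive, the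
    largest candidate below it has [[set x | M <= g x]] as its strict superlevel set, so [P] fails
    there by minimality. *)
Lemma threshold (T : finType) (g : T -> R) (P : {set T} -> bool) :
  (forall x, 0 <= g x) -> P set0 ->
  exists M, [/\ 0 <= M, P [set x | M < g x] &
                M = 0 \/ ~~ P [set x | M <= g x]].
Proof.
move=> g0 P0.
pose v (o : option T) := if o is Some x then g x else 0.
have v0 o : 0 <= v o by case: o => /=.
pose Q := [pred o | P [set x | v o < g x]].
have [o0 Qo0] : exists o, Q o.
  pose o := [arg max_(o > None) v o]%O.
  exists o; rewrite /= (_ : [set x | _] = set0)//; apply/setP => x.
  rewrite !inE /o; case: arg_maxP => //= o' _ /(_ (Some x) isT) /=.
  by rewrite ltNge => ->.
pose o := [arg min_(o < o0 | Q o) v o]%O.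
have [Qo omin] : Q o /\ forall o', Q o' -> v o <= v o'.
  by rewrite /o; case: arg_minP.
exists (v o); split => //.
have [->|/eqP vo0] := eqVneq (v o) 0; [by left|right].
have {}vo0 : 0 < v o by rewrite lt_def v0 andbT; apply/eqP.
pose o' := [arg max_(o' > None | v o' < v o) v o']%O.
have [vo' omax] : v o' < v o /\ forall o'', v o'' < v o -> v o'' <= v o'.
  by rewrite /o'; case: arg_maxP.
apply/negP => Pvo; have : v o <= v o'.
  apply: omin; rewrite /= (_ : [set x | _] = [set x | v o <= g x])//.
  apply/setP => x; rewrite !inE; apply/idP/idP => [|/(lt_le_trans vo')//].
  by rewrite ltNge [in X in _ -> X]leNgt; apply: contra => /(omax (Some x)).
by rewrite leNgt vo'.
Qed.

(* [M] is the least level such that [g - M] is nonpositive on at least half of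
   every subcube of half side. *)
Lemma median_level (p : nat) (g : cell -> R) :
    (0 < p)%N -> (p.*2 %| n)%N -> (forall b, 0 <= g b) ->
    (forall a, (2 * #|[set b | same p.*2 a b & (0 < g b)%R]| <= p.*2 ^ d)%N) ->
  exists M : cell -> R,
    [/\ forall a, 0 <= M a, level p.*2 M,
        forall a, (2 * #|[set b | same p a b & (M a < g b)%R]| <= p ^ d)%N &
        \sum_a M a <= 2 ^+ d.+2 * p.*2%:R *
          edge_sum p.*2 xpredT (fun b => Num.min (g b) (M b))].
Proof.
move=> p0 pn g0 Hg.
have pp : (p %| p.*2)%N by rewrite -muln2 dvdn_mulr.
have pn' := dvdn_trans pp pn.
pose P a (S : {set cell}) :=
  [forall b, same p.*2 a b ==> (2 * #|[set c in S | same p b c]| <= p ^ d)%N].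
have P0 a : P a set0.
  apply/forallP => b; apply/implyP => _.
  by rewrite (_ : [set c in _ | _] = set0) ?cards0//; apply/setP => c; rewrite !inE.
have /fin_all_exists[M0 HM0] a := threshold g0 (P0 a).
(* One threshold per cube, taken at a representative, makes [M] constant on cubes. *)
pose rep a := odflt a [pick b | same p.*2 a b].
have repP a : same p.*2 a (rep a).
  by rewrite /rep; case: pickP => //= _; exact: same_refl.
have rep_eq a b : same p.*2 a b -> rep a = rep b.
  move=> ab; rewrite /rep (eq_pick (same_eq ab)); case: pickP => //= /(_ b).
  by rewrite same_refl.
pose M a := M0 (rep a).
have M_ge0 a : 0 <= M a by have [] := HM0 (rep a).
have Ml : level p.*2 M by move=> a b ab; rewrite /M (rep_eq _ _ ab).
exists M; split => // [a|].
  have [_ /forallP/(_ a)/implyP + _] := HM0 (rep a).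
  rewrite same_sym => /(_ (repP a)); congr (2 * _ <= _)%N.
  by apply: eq_card => c; rewrite !inE andbC.
pose u b := Num.min (g b) (M b).
have key a : (p.*2 ^ d)%:R * M a <=
    2 ^+ d.+2 * p.*2%:R * edge_sum p.*2 (same p.*2 a) u.
  have E0 : 0 <= edge_sum p.*2 (same p.*2 a) u.
    exact: edge_sum_ge0.
  have [_ _ [M0a|]] := HM0 (rep a).
    by rewrite {1}/M M0a mulr0 mulr_ge0// mulr_ge0// exprn_ge0.
  rewrite negb_forall => /existsP[b]; rewrite negb_imply -ltnNge => /andP[ab Hb].
  have {}ab : same p.*2 a b by apply: same_trans ab; exact: repP.
  (* [g] vanishes on [Y], at least half of the cube; since a positive [M] cannot be lowered,
     [g >= M] on [Z], which fills at least half of some subcube. Each pair in [Y] and [Z]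
     contributes exactly [M] to the oscillation of the truncated function. The two halves give the
     factor $4$ and the subcube the factor $2^d$ of the constant. *)
  pose Y := [set y | same p.*2 a y & ~~ (0 < g y)].
  pose Z := [set z | same p.*2 a z & M a <= g z].
  have cY : (p.*2 ^ d <= 2 * #|Y|)%N.
    have := Hg a; have := card_same a pn.
    rewrite -(cardsE (same _ _)) -(cardsID [set b | 0 < g b] [set x in same p.*2 a]).
    rewrite (_ : _ :&: _ = [set b | same p.*2 a b & 0 < g b]); last first.
      by apply/setP => x; rewrite !inE.
    rewrite (_ : _ :\: _ = Y); last by apply/setP => x; rewrite !inE andbC.
    by lia.
  have cZ : (p ^ d <= 2 * #|Z|)%N.
    apply: (leq_trans (ltnW Hb)); rewrite leq_mul2l/=; apply: subset_leq_card.
    apply/subsetP => z; rewrite !inE /M => /andP[-> bz]; rewrite andbT.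
    by apply: same_trans ab _; exact: same_dvd bz.
  have Ma : (#|Y| * #|Z|)%:R * M a <=
      \sum_(y | same p.*2 a y) \sum_(z | same p.*2 a z) `|u y - u z|.
    apply: (@le_trans _ _ (\sum_(y in Y) \sum_(z in Z) M a)).
      by rewrite !sumr_const -mulrnA mulr_natl mulnC.
    rewrite big_mkcond [leRHS]big_mkcond; apply: ler_sum => y _.
    rewrite inE; case: ifPn => [/andP[-> gy]|_]; last first.
      by case: ifP => // _; exact: sumr_ge0.
    rewrite big_mkcond [leRHS]big_mkcond; apply: ler_sum => z _.
    rewrite inE; case: ifPn => [/andP[az Mz]|_]; last by case: ifP.
    have uz : u z = M a by rewrite /u -(Ml _ _ az) min_r.
    have gy0 : g y = 0 by apply/eqP; rewrite eq_le g0 andbT leNgt.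
    by rewrite az uz /u gy0 min_l// sub0r normrN ger0_norm.
  have := le_trans Ma (poincare a u pn).
  move: E0; set E := edge_sum _ _ _ => E0 H.
  have pd0 m : (0 < m)%N -> 0 < (m ^ d)%:R :> R.
    by move=> m0; rewrite ltr0n expn_gt0 m0.
  have p20 : (0 < p.*2)%N by rewrite double_gt0.
  rewrite -(ler_pM2l (pd0 _ p0)) -(ler_pM2l (pd0 _ p20)).
  apply: (@le_trans _ _ (4 * (p.*2 ^ d)%:R * ((#|Y| * #|Z|)%:R * M a))).
    have H1 : (p.*2 ^ d * p ^ d)%:R <= 4 * (#|Y| * #|Z|)%:R :> R.
      by rewrite -natrM ler_nat; nia.
    have := ler_wpM2l (mulr_ge0 (ler0n R (p.*2 ^ d)) (M_ge0 a)) H1.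
    by rewrite !natrM; congr (_ <= _); ring.
  apply: (@le_trans _ _ (4 * (p.*2 ^ d)%:R * ((p.*2 ^ d * p.*2)%:R * E))).
    by rewrite ler_wpM2l// mulr_ge0.
  have -> : (p.*2 ^ d)%:R = 2 ^+ d * (p ^ d)%:R :> R.
    by rewrite -mul2n expnMn natrM natrX.
  rewrite natrM.
  have -> : (p.*2 ^ d)%:R = 2 ^+ d * (p ^ d)%:R :> R.
    by rewrite -mul2n expnMn natrM natrX.
  by rewrite !exprS le_eqVlt; apply/orP; left; apply/eqP; ring.
have pd0 : (p.*2 ^ d)%:R != 0 :> R.
  by rewrite pnatr_eq0 expn_eq0 negb_and double_eq0 -lt0n p0.
have : (p.*2 ^ d)%:R * \sum_a M a <=
    (p.*2 ^ d)%:R * (2 ^+ d.+2 * p.*2%:R * edge_sum p.*2 xpredT u).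
  have A0 : 0 <= 2 ^+ d.+2 * p.*2%:R :> R by apply: mulr_ge0 => //; exact: exprn_ge0.
  rewrite mulr_sumr; apply: (le_trans (ler_sum _ (fun a _ => key a))).
  rewrite -mulr_sumr mulrCA (ler_wpM2l A0)//.
  rewrite /edge_sum exchange_big mulr_sumr; apply: ler_sum => k _.
  under eq_bigr do rewrite big_mkcondl.
  rewrite exchange_big mulr_sumr/=; apply: ler_sum => w _.
  rewrite -big_mkcond; under eq_bigl do rewrite same_sym.
  by rewrite sumr_const card_same// mulr_natl.
by rewrite ler_pM2l// lt_def pd0 ler0n.
Qed.

(** On an edge inside a block both ends are cut at the same height. The part below and the part
    above are nondecreasing in the value and add up to it, so their increments along the edge have
    the same sign. *)
Lemma edge_sum_truncate q (g M : cell -> R) : (forall b, 0 <= M b) -> level q M ->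
  edge_sum q xpredT g = edge_sum q xpredT (fun b => Num.min (g b) (M b)) +
                        edge_sum q xpredT (fun b => Num.max (g b - M b) 0).
Proof.
move=> M0 Ml; rewrite /edge_sum -big_split; apply: eq_bigr => k _ /=.
rewrite -big_split; apply: eq_bigr => w /= wn.
rewrite -(Ml _ _ wn); move: (g w) (g _) (M w) => x y m.
have [xm|mx] := leP x m; have [ym|my] := leP y m.
- by rewrite !max_r ?subr_le0// subrr normr0 addr0.
- rewrite max_l ?subr_ge0 1?ltW// max_r ?subr_le0// !ger0_norm; lra.
- rewrite max_r ?subr_le0// max_l ?subr_ge0 1?ltW// !ler0_norm; lra.
- rewrite !max_l ?subr_ge0 1?ltW// subrr normr0 add0r; congr (`|_|); lra.
Qed.

Lemma edge_sum_sub p q (g : cell -> R) : (p %| q)%N ->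
  edge_sum p xpredT g <= edge_sum q xpredT g.
Proof.
move=> pq; apply: ler_sum => k _; rewrite big_mkcond [leRHS]big_mkcond.
by apply: ler_sum => w _ /=; case: ifP => [/(same_dvd pq) ->//|_]; case: ifP.
Qed.

(** The level [M] of [median_level] is charged to the cubes of side [2 ^ m], and the excess over [M]
    satisfies the hypothesis one scale finer. By [edge_sum_truncate] the level pays only with the
    variation of the slice below it and the rest is left to finer scales, so no factor [N]
    appears. *)
Lemma decompose_vanishing m (g : cell -> R) :
    (m <= N)%N -> (forall b, 0 <= g b) ->
    (forall a, (2 * #|[set b | same (2 ^ m) a b & (0 < g b)%R]| <= (2 ^ m) ^ d)%N) ->
  exists c, [/\ forall j a, 0 <= c j a, forall j, level (side j) (c j),
    forall a, g a <= \sum_(j < N) c j a &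
    \sum_(j < N) 2 ^+ j * \sum_a c j a <=
      2 ^+ N * 2 ^+ d.+2 * edge_sum (2 ^ m) xpredT g].
Proof.
elim: m g => [|m IH] g mN g0 Hg.
  exists (fun _ _ => 0); split => // [a|].
    (* Blocks of side one are cells, where being positive on at most half means vanishing. *)
    have := Hg a; rewrite exp1n leqNgt; apply: contraNle => ga.
    rewrite big1// in ga.
    rewrite (_ : [set b | _] = [set a]) ?cards1//; apply/setP => b.
    by rewrite !inE same1 eq_sym; case: eqP => // ->.
  rewrite big1 => [|j _]; last by rewrite big1// mulr0.
  by apply: mulr_ge0; [apply: mulr_ge0; exact: pow2_ge0|exact: edge_sum_ge0].
have jN : (N - m.+1 < N)%N by lia.
have sE : side (N - m.+1) = (2 ^ m).*2 by rewrite subKn// expnS mul2n.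
have sE' : (2 ^ m.+1 = (2 ^ m).*2)%N by rewrite expnS mul2n.
rewrite sE' in Hg *.
have m0 : (0 < 2 ^ m)%N by rewrite expn_gt0.
have mn : ((2 ^ m).*2 %| n)%N by rewrite -sE side_dvd.
have [M [M0 Ml Mhalf Msum]] := median_level m0 mn g0 Hg.
pose g' b := Num.max (g b - M b) 0.
have [||b|c [c0 cl cg ccost]] := IH g'.
- exact: ltnW.
- by move=> b; rewrite le_max lexx orbT.
- move: (Mhalf b); congr (2 * _ <= _)%N; apply: eq_card => x; rewrite !inE.
  rewrite lt_max ltxx orbF subr_gt0; case: (boolP (same _ _ _)) => // bx.
  by rewrite (Ml b x)// (same_dvd _ bx)// -muln2 dvdn_mulr.
pose j0 := Ordinal jN.
exists (fun j a => c j a + if j == j0 then M a else 0); split.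
- by move=> j a; rewrite addr_ge0//; case: ifP.
- move=> j a b ab; congr (_ + _); first exact: cl ab.
  by case: eqP ab => // ->; rewrite /= sE => /Ml ->.
- move=> a; rewrite big_split/= -big_mkcond/= [X in _ + X](big_pred1 j0)//.
  apply: (@le_trans _ _ (g' a + M a)); first by rewrite -lerBlDr le_max lexx.
  by rewrite lerD2r cg.
under eq_bigr do rewrite big_split mulrDr.
rewrite big_split/= (edge_sum_truncate _ M0 Ml) mulrDr addrC; apply: lerD; last first.
  apply: (le_trans ccost); apply: ler_wpM2l; first by apply: mulr_ge0; exact: pow2_ge0.
  by apply: edge_sum_sub; rewrite -muln2 dvdn_mulr.
rewrite (bigD1 j0)//= [X in _ + X]big1 => [|j /negbTE jj]; last first.
  by rewrite -val_eqE/= in jj; rewrite jj big1 ?mulr0.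
rewrite eqxx addr0; apply: le_trans (ler_wpM2l _ Msum) _; first exact: exprn_ge0.
rewrite mulrA; apply: ler_wpM2r; first exact: edge_sum_ge0.
have -> : 2 ^+ N = 2 ^+ (N - m.+1) * (2 ^ m).*2%:R :> R.
  by rewrite -sE' natrX -exprD subnK.
by rewrite le_eqVlt; apply/orP; left; apply/eqP; ring.
Qed.

Lemma edge_sum_norm q (g f : cell -> R) :
    (forall a b, same q a b -> `|g a - g b| <= `|f a - f b|) ->
  edge_sum q xpredT g <= edge_sum q xpredT f.
Proof.
by move=> gf; apply: ler_sum => k _; apply: ler_sum => w /= wn; rewrite gf// same_sym.
Qed.

(** By Chebyshev's inequality [|f|] exceeds twice its mean on at most half of each unit cube, so the
    excess falls under [decompose_vanishing]. Twice the mean is charged at generation [0]. *)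
Lemma decompose_edges f :
  exists2 c, decomposes (fun a => `|f a|) c &
    cost 2 c <= 2 * \sum_a `|f a| + 2 ^+ N * 2 ^+ d.+2 * edge_sum (2 ^ N) xpredT f.
Proof.
have N0 : (0 < 2 ^ N)%N by rewrite expn_gt0.
pose A a := avg (2 ^ N) (fun b => `|f b|) a.
have A0 a : 0 <= A a by exact: avg_ge0.
have Al : level (2 ^ N) A by exact: level_avg.
pose g a := Num.max (`|f a| - 2 * A a) 0.
have [|a|c [c0 cl cg ccost]] := @decompose_vanishing N g (leqnn _).
- by move=> b; rewrite le_max lexx orbT.
- have Nd0 : 0 < ((2 ^ N) ^ d)%:R :> R by rewrite ltr0n !expn_gt0.
  set S := [set b | _ & _].
  have : 2 * A a * #|S|%:R <= ((2 ^ N) ^ d)%:R * A a.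
    rewrite [in leRHS]/A /avg mulVKf ?gt_eqF//.
    rewrite mulr_natr -sumr_const big_mkcond [leRHS]big_mkcond.
    apply: ler_sum => b _; rewrite inE; case: ifPn => [/andP[ab]|_].
      rewrite ab lt_max ltxx orbF subr_gt0 => /ltW.
      by rewrite (Al _ _ ab).
    by case: ifP.
  (* The inequality cannot be divided by a zero mean, but then [f] vanishes on the whole cube. *)
  have [Aa|Aa] := eqVneq (A a) 0.
    move=> _; rewrite (_ : S = set0) ?cards0//; apply/setP => b; rewrite !inE.
    apply/negP => /andP[ab]; rewrite lt_max ltxx orbF -(Al _ _ ab) Aa mulr0 subr0.
    move=> fb; move: Aa => /eqP; rewrite mulf_eq0 invr_eq0 gt_eqF//= => /eqP.
    move/psumr_eq0P => /(_ (fun _ _ => normr_ge0 _)) /(_ b ab) f0.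
    by rewrite f0 ltxx in fb.
  rewrite mulrAC ler_pM2r; last by rewrite lt_def Aa A0.
  by rewrite -natrM ler_nat.
(* [decompose_vanishing] controls only the generations below [N], so its coefficients are cut off at
   [N]. *)
exists (fun j a => c j a * (j < N)%:R + if j == 0%N then 2 * A a else 0); first split.
- by move=> j a; rewrite addr_ge0// ?mulr_ge0//; case: ifP => // _; rewrite mulr_ge0.
- move=> j a b ab; congr (_ * _ + _); first exact: cl ab.
  by case: eqP ab => // ->; rewrite subn0 => /Al ->.
- move=> a; rewrite big_split/= [X in _ + X]big_ord_recl/= [X in _ + (_ + X)]big1//.
  rewrite addr0 -lerBlDr big_ord_recr/= ltnn mulr0 addr0.
  apply: (@le_trans _ _ (g a)); first by rewrite le_max lexx.
  by apply: (le_trans (cg a)); apply: ler_sum => j _; rewrite ltn_ord mulr1.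
rewrite /cost; under eq_bigr do rewrite big_split mulrDr.
rewrite big_split/= addrC; apply: lerD.
  rewrite big_ord_recl/= [X in _ + X]big1 => [|i _]; last by rewrite big1 ?mulr0.
  by rewrite addr0 expr0 mul1r -mulr_sumr sum_avg.
rewrite big_ord_recr/= ltnn [X in _ + _ * X]big1 ?mulr0 ?addr0; last first.
  by move=> i _; rewrite mulr0.
apply: (@le_trans _ _ (\sum_(j < N) 2 ^+ j * \sum_a c j a)).
  by apply: ler_sum => j _; under eq_bigr do rewrite ltn_ord mulr1.
apply: (le_trans ccost); apply: ler_wpM2l; first by apply: mulr_ge0; exact: pow2_ge0.
apply: edge_sum_norm => a b ab; rewrite /g (Al _ _ ab).
apply: le_trans (ler_dist_dist _ _).
move: (`|f a|) (`|f b|) (2 * A b) => x y m.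
have [xm|mx] := leP (x - m) 0; have [ym|my] := leP (y - m) 0.
- by rewrite subrr normr0.
- rewrite !ler0_norm; lra.
- rewrite !ger0_norm; lra.
- by rewrite (_ : x - m - (y - m) = x - y)//; lra.
Qed.

End decomposition.

From mathcomp Require Import all_classical all_reals all_analysis measurable_realfun.
Import numFieldNormedType.Exports.
Local Open Scope classical_set_scope.
Local Open Scope ring_scope.

(** * Integrals of nonnegative functions and grids of cubes *)

Section le_integral.
Context d (T : measurableType d) (R : realType) (mu : {measure set T -> \bar R}).
Import HBNNSimple.
Local Open Scope ereal_scope.

(* Neither function is assumed measurable: the integral of a nonnegative
   function is a supremum over simple functions. *)
Lemma ge0_le_integral_ae (f g : T -> \bar R) :
  (forall x, 0 <= f x) -> (forall x, 0 <= g x) ->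
  {ae mu, forall x, f x <= g x} ->
  \int[mu]_x f x <= \int[mu]_x g x.
Proof.
move=> f0 g0 [A [mA A0 fgA]].
rewrite !ge0_integralTE//; apply: ge_ereal_sup => _ /= [h hf <-].
(* Set to zero on the exceptional set, the simple function keeps its integral and lies below [g]
   everywhere. *)
pose h' : {nnsfun T >-> R} := proj_nnsfun h (measurableC mA).
have h'E x : h' x = (h x * \1_(~` A) x)%R by [].
apply: (@le_trans _ _ (sintegral mu h')); last first.
  suff H x : (h' x)%:E <= g x by apply: ereal_sup_ubound; exists h'.
  rewrite h'E indicE.
  have [Ax|Ax] := pselect (A x).
    by rewrite memNset ?mulr0//= => /(_ Ax).
  rewrite mem_set// mulr1; apply: le_trans (hf x) _.
  by have [//|/fgA] := pselect (f x <= g x).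
rewrite -!integralT_nnsfun le_eqVlt; apply/orP; left; apply/eqP.
apply: ge0_ae_eq_integral => //.
- by apply/measurable_EFinP; exact: measurable_funP.
- by apply/measurable_EFinP; exact: measurable_funP.
- by move=> x _; rewrite lee_fin; exact: fun_ge0.
- by move=> x _; rewrite lee_fin; exact: fun_ge0.
- exists A; split => // x /= hx; apply: contrapT => Ax; apply: hx => _.
  congr EFin; transitivity (h x * \1_(~` A) x)%R => //.
  by rewrite indicE mem_set// mulr1.
Qed.

Lemma ge0_le_integralT (f g : T -> \bar R) :
  (forall x, 0 <= f x) -> (forall x, f x <= g x) ->
  \int[mu]_x f x <= \int[mu]_x g x.
Proof.
move=> f0 fg; apply: ge0_le_integral_ae => // [x|]; first exact: le_trans (fg x).
exact: aeW.
Qed.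

Lemma integral_sum_indic (I : finType) (K : I -> R) (A : I -> set T) :
  (forall i, 0 <= K i)%R -> (forall i, measurable (A i)) ->
  \int[mu]_x (\sum_i K i * \1_(A i) x)%:E = \sum_i (K i)%:E * mu (A i).
Proof.
move=> K0 mA; under eq_integral do rewrite -sumEFin.
rewrite ge0_integral_sum//.
- apply: eq_bigr => i _.
  under eq_integral do rewrite EFinM.
  rewrite ge0_integralZl_EFin//; first by rewrite integral_indic// setIT.
  + by apply/measurable_EFinP; exact: measurable_indic.
- move=> i; apply/measurable_EFinP; apply: measurable_funM => //.
- by move=> i x _; rewrite lee_fin mulr_ge0// indicE.
Qed.

End le_integral.

Section boxes.
Context {R : realType} {d : nat}.
Local Notation mu := (@lebesgue_rV R d).

Lemma measurable_box (A : 'I_d -> set R) : (forall i, measurable (A i)) ->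
  measurable [set x : 'rV[R]_d | forall i, A i (x ord0 i)].
Proof.
move=> mA; rewrite (_ : [set x | _] =
    \bigcap_(i in [set: 'I_d]) (rV_coord i @^-1` A i)).
  apply: fin_bigcap_measurable => // i _.
  by rewrite -[X in measurable X]setTI; apply: measurable_rV_coord.
by apply/seteqP; split => [x Ax i _|x Ax i]; [exact: Ax|exact: (Ax i)].
Qed.

Definition cube (p : 'rV[R]_d) (h : R) : set 'rV[R]_d :=
  [set x | forall i, p ord0 i <= x ord0 i < p ord0 i + h].

Lemma cubeE p h : cube p h = [set x | forall i, `[p ord0 i, p ord0 i + h[%classic (x ord0 i)].
Proof. by apply/seteqP; split => x Hx i; have := Hx i; rewrite /= in_itv. Qed.

Lemma measurable_cube p h : measurable (cube p h).
Proof.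
rewrite cubeE.
apply: (@measurable_box (fun i => `[p ord0 i, p ord0 i + h[%classic)) => i.
exact: measurable_itv.
Qed.

Lemma lebesgue_cube p h : 0 <= h -> mu (cube p h) = (h ^+ d)%:E.
Proof.
move=> h0; rewrite cubeE (@lebesgue_rV_box _ _ (fun i => `[p ord0 i, p ord0 i + h[%classic)); last first.
  by move=> i; exact: measurable_itv.
rewrite (eq_bigr (fun=> h%:E)) => [|i _].
  by rewrite prodEFin prodr_const card_ord.
rewrite lebesgue_measure_itv/= lte_fin ltrDl; case: ltP => h1.
  by rewrite -EFinB addrAC subrr add0r.
by congr EFin; apply/eqP; rewrite eq_le h0.
Qed.

End boxes.

(** * The grid of cells of side $2^{-N}$ on the box $[-L, L)^d$ *)

Section grid.
Context {R : realType} {d : nat}.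
Variables (L N : nat).
Local Notation mu := (@lebesgue_rV R d).

Definition grid_size := (L.*2 * 2 ^ N)%N.
Definition mesh : R := 2^-1 ^+ N.
Local Notation cell := {ffun 'I_d -> 'I_grid_size}.
Implicit Types a b : cell.

Definition corner a : 'rV[R]_d := \row_i ((a i)%:R * mesh - L%:R).

Definition cell_set a : set 'rV[R]_d := cube (corner a) mesh.

Lemma meshE : mesh = 2^-1 ^+ N. Proof. by []. Qed.

Lemma mesh_gt0 : 0 < mesh. Proof. by rewrite exprn_gt0// invr_gt0. Qed.

Lemma mesh_inv : 2 ^+ N * mesh = 1 :> R.
Proof. by rewrite -exprMn divff ?expr1n// pnatr_eq0. Qed.

Lemma cell_setP a x : cell_set a x <->
  forall i, (a i)%:R <= (x ord0 i + L%:R) * 2 ^+ N < (a i).+1%:R.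
Proof.
have E (k y0 l P m : R) : 0 < m -> P * m = 1 ->
    (k * m - l <= y0 < k * m - l + m) = (k <= (y0 + l) * P < k + 1).
  move=> m0 Pm; have yP y : y = y * P * m by rewrite -mulrA Pm mulr1.
  congr (_ && _); first by rewrite lerBlDr [X in _ <= X]yP ler_pM2r.
  by rewrite addrAC ltrBrDr [X in X < _]yP -[X in _ < _ + X]mul1r -mulrDl ltr_pM2r.
have E' i : (corner a ord0 i <= x ord0 i < corner a ord0 i + mesh) =
    ((a i)%:R <= (x ord0 i + L%:R) * 2 ^+ N < (a i).+1%:R).
  by rewrite mxE (E _ _ _ _ _ mesh_gt0 mesh_inv) natr1.
by split => H i; have := H i; rewrite E'.
Qed.

Lemma cell_set_inj a b x : cell_set a x -> cell_set b x -> a = b.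
Proof.
move=> /cell_setP ax /cell_setP bx; apply/ffunP => i; apply/val_inj => /=.
have /andP[a1 a2] := ax i; have /andP[b1 b2] := bx i.
have := le_lt_trans a1 b2; have := le_lt_trans b1 a2; rewrite !ltr_nat !ltnS.
by move=> ba ab; apply/eqP; rewrite eqn_leq ab ba.
Qed.

Lemma cell_set_cover (x : 'rV[R]_d) : (forall i, - L%:R <= x ord0 i < L%:R) ->
  exists a, cell_set a x.
Proof.
move=> xL.
have P0 : 0 < 2 ^+ N :> R by rewrite exprn_gt0.
have y0 i : 0 <= (x ord0 i + L%:R) * 2 ^+ N.
  by have /andP[x1 _] := xL i; rewrite mulr_ge0 ?(ltW P0)// -lerBlDr sub0r.
have yn i : (Num.truncn ((x ord0 i + L%:R) * 2 ^+ N) < grid_size)%N.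
  have /andP[t1 _] := truncn_itv (y0 i).
  rewrite -(ltr_nat R); apply: (le_lt_trans t1).
  have /andP[_ x2] := xL i.
  by rewrite /grid_size natrM natrX ltr_pM2r// -addnn natrD ltrD2r.
exists [ffun i => Ordinal (yn i)]; apply/cell_setP => i; rewrite ffunE /=.
by have := truncn_itv (y0 i).
Qed.

Lemma lebesgue_cell a : mu (cell_set a) = (mesh ^+ d)%:E.
Proof. by rewrite lebesgue_cube// ltW// mesh_gt0. Qed.

(** Integrals of nonnegative functions are monotone whatever the functions, so [f] may itself be an
    integral in a further variable, as in the Gagliardo double integral. *)
Lemma lower_sum (f : 'rV[R]_d -> \bar R) (K : cell -> R) :
  (forall a, 0 <= K a) -> (forall x, 0 <= f x)%E ->
  {ae mu, forall x, forall a, cell_set a x -> ((K a)%:E <= f x)%E} ->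
  ((mesh ^+ d * \sum_a K a)%:E <= \int[mu]_x f x)%E.
Proof.
move=> K0 f0 Kf.
have -> : ((mesh ^+ d * \sum_a K a)%:E = \int[mu]_x (\sum_a K a * \1_(cell_set a) x)%:E)%E.
  rewrite integral_sum_indic//; last by move=> a; exact: measurable_cube.
  rewrite mulr_sumr -sumEFin; apply: eq_bigr => a _.
  by rewrite [X in _ = (_ * X)%E](_ : _ = (mesh ^+ d)%:E) ?EFinM 1?muleC//; exact: lebesgue_cell.
apply: ge0_le_integral_ae => // [x|].
  by rewrite lee_fin sumr_ge0// => a _; rewrite mulr_ge0.
apply: filterS Kf => x Kf.
have [[a ax]|nax] := pselect (exists a, cell_set a x).
  rewrite (bigD1 a)//= big1 => [|b ba]; last first.
    rewrite indicE memNset ?mulr0// => bx.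
    by rewrite (cell_set_inj ax bx) eqxx in ba.
  by rewrite addr0 indicE mem_set// mulr1 Kf.
rewrite big1// => b _; rewrite indicE memNset ?mulr0// => bx.
by apply: nax; exists b.
Qed.

End grid.

(** * Test functions *)

Section test_functions.
Context {R : realType} {d : nat}.
Implicit Types (f g : 'rV[R]_d -> R) (x y v : 'rV[R]_d) (s : seq 'I_d).
Local Notation partial i f := ('D_(unit_vec i) f).

Lemma iter_partial_rcons s i f :
  iter_partial (rcons s i) f = iter_partial s (partial i f).
Proof. by rewrite /iter_partial foldr_rcons. Qed.

Lemma line_derive f x v (t : R) : derivable f (t *: v + x) v ->
  is_derive t 1 (fun r : R => f (r *: v + x)) ('D_v f (t *: v + x)).
Proof.
have E : (fun h : R => h^-1 *: (((fun r : R => f (r *: v + x)) \o shift t) (h *: 1) - f (t *: v + x)))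
   = (fun h : R => h^-1 *: ((f \o shift (t *: v + x)) (h *: v) - f (t *: v + x))).
  apply/funext => h /=; congr (_ *: (f _ - _)).
  by rewrite scaler1 scalerDl addrA.
by move=> df; split; rewrite /derivable /derive E.
Qed.

Lemma is_derive_line f x v (l : R) :
  is_derive (0 : R) 1 (fun h : R => f (h *: v + x)) l -> is_derive x v f l.
Proof.
have E : (fun h : R => h^-1 *: (((fun r : R => f (r *: v + x)) \o shift 0) (h *: 1) - f (0 *: v + x)))
   = (fun h : R => h^-1 *: ((f \o shift x) (h *: v) - f x)).
  apply/funext => h /=; congr (_ *: (f _ - f _)).
    by rewrite scaler1 addr0.
  by rewrite scale0r add0r.
by case=> df dl; split; move: df dl; rewrite /derivable /derive E.
Qed.

Lemma MVT_line f x v (h : R) : (forall y, derivable f y v) -> 0 <= h ->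
  exists2 t, 0 <= t <= h & f (h *: v + x) - f x = h * 'D_v f (t *: v + x).
Proof.
move=> df h0.
have dF (t : R) : is_derive t 1 (fun r : R => f (r *: v + x)) ('D_v f (t *: v + x)).
  exact: line_derive.
have cF : {within `[0, h], continuous (fun r : R => f (r *: v + x))}.
  apply: derivable_within_continuous => t _; exact: ex_derive.
have [t + E] := MVT_segment h0 (fun t _ => dF t) cF.
rewrite in_itv /= => th; exists t => //.
by move: E; rewrite scale0r add0r subr0 mulrC.
Qed.

Lemma derive_notin_support f v x :
  ~ closure [set y | f y != 0] x -> 'D_v f x = 0.
Proof.
move=> nx.
have f0 : \near x, f x = cst 0 x.
  have : (~` closure [set y | f y != 0]) x by [].
  move: (closed_openC (@closed_closure _ [set y | f y != 0])).
  rewrite openE => /[apply]; apply: filterS => y /= ny.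
  apply/eqP; apply: contrapT => /negP fy; apply: ny; exact: subset_closure.
by rewrite (near_eq_derive v f0) derive_cst.
Qed.

Lemma smooth_partial i f : smooth f -> smooth (partial i f).
Proof. by move=> sf s; have := sf (rcons s i); rewrite iter_partial_rcons. Qed.

Lemma test_partial i f : test_function f -> test_function (partial i f).
Proof.
move=> [sf cf]; split; first exact: smooth_partial.
apply: (subclosed_compact _ cf); first exact: closed_closure.
rewrite [X in _ `<=` X](closure_id _).1; last exact: closed_closure.
apply: closure_subset => x /= fx; apply: contrapT => /(@derive_notin_support f (unit_vec i)).
by move/eqP: fx.
Qed.

Lemma test_iter_partial s f : test_function f -> test_function (iter_partial s f).
Proof. by move=> tf; elim: s => //= i s; exact: test_partial. Qed.

Lemma test_continuous f : test_function f -> continuous f.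
Proof. by move=> [sf _]; have [] := sf [::]. Qed.

Lemma test_derivable f i x : test_function f -> derivable f x (unit_vec i).
Proof. by move=> [sf _]; have [_] := sf [::]; apply. Qed.

Lemma le_coord_norm x i : `|x ord0 i| <= `|x|.
Proof.
rewrite [leRHS]/Num.Def.normr/= mx_normrE.
by apply/bigmax_geP; right => /=; exists (ord0, i).
Qed.

Definition box_support (L : nat) f := forall x, f x != 0 -> forall i, `|x ord0 i| < L%:R.

Lemma test_box f : test_function f -> exists2 L, (0 < L)%N & box_support L f.
Proof.
move=> [_ /compact_bounded[M [_ HM]]].
exists (Num.truncn (M + 1)).+1 => // x fx i.
apply: (le_lt_trans (le_coord_norm x i)).
have /HM : M < M + 1 by rewrite ltrDl.
have cx : closure [set x | f x != 0] x by exact: subset_closure.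
move=> /(_ x cx) /le_lt_trans; apply.
exact: truncnS_gt.
Qed.

Lemma test_bounded f : test_function f -> exists2 B, 0 <= B & forall x, `|f x| <= B.
Proof.
move=> tf; have [_ cK] := tf; set K := closure _ in cK.
have cfK : compact ((fun x => f x) @` K).
  by apply: continuous_compact => //; apply: continuous_subspaceT; exact: test_continuous.
have [M [_ HM]] := compact_bounded cfK.
exists (`|M| + 1); first by rewrite addr_ge0.
move=> x; have [->|fx] := eqVneq (f x) 0; first by rewrite normr0 addr_ge0.
apply: HM; first by rewrite (le_lt_trans (ler_norm M))// ltrDl.
by exists x => //; exact: subset_closure.
Qed.

(** The Lipschitz property for the sup distance, in the form in which two points of a cell provide
    it. *)
Definition sup_lipschitz (B : R) f := forall x y h,
  (forall i, `|x ord0 i - y ord0 i| <= h) -> `|f x - f y| <= B * h.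

Definition mix_rV (m : nat) x y : 'rV[R]_d :=
  \row_i (if (i < m)%N then y ord0 i else x ord0 i).

(** The mean value theorem along the path that changes one coordinate at a time, whence the factor
    [d]. *)
Lemma lipschitz_of_partial f (B : R) : 0 <= B ->
    (forall i x, derivable f x (unit_vec i)) ->
    (forall i x, `|partial i f x| <= B) ->
  sup_lipschitz (d%:R * B) f.
Proof.
move=> B0 df dB x y h xyh.
have step z i (t : R) : `|f (t *: unit_vec i + z) - f z| <= B * `|t|.
  wlog t0 : t z / 0 <= t.
    move=> H; have [|t0] := leP 0 t; first exact: H.
    have := H (- t) (t *: unit_vec i + z).
    rewrite addrA -scalerDl addNr scale0r add0r normrN distrC; apply.
    by rewrite oppr_ge0 ltW.
  have [s _ ->] := @MVT_line f z (unit_vec i) t (df i) t0.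
  by rewrite normrM mulrC ler_wpM2r.
have -> : f x - f y = \sum_(0 <= m < d) (f (mix_rV m x y) - f (mix_rV m.+1 x y)).
  rewrite -[RHS]opprK -sumrN.
  under eq_bigr do rewrite opprB.
  rewrite telescope_sumr// opprB; congr (f _ - f _); apply/rowP => i; rewrite mxE//.
  by rewrite ltn_ord.
rewrite big_mkord; apply: (le_trans (ler_norm_sum _ _ _)).
apply: (@le_trans _ _ (\sum_(i < d) B * h)); last first.
  by rewrite sumr_const card_ord -mulrA mulr_natl.
apply: ler_sum => i _; rewrite distrC.
have -> : mix_rV i.+1 x y = (y ord0 i - x ord0 i) *: unit_vec i + mix_rV i x y.
  apply/rowP => j; rewrite !mxE ltnS leq_eqVlt eqxx /=.
  have [->|ji] := eqVneq j i; first by rewrite eqxx ltnn mulr1 subrK.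
  by have -> : (j == i :> nat) = false := negbTE ji; rewrite mulr0 add0r.
by apply: (le_trans (step _ _ _)); rewrite distrC ler_wpM2l.
Qed.

Lemma test_lipschitz f : test_function f -> exists2 B, 0 <= B & sup_lipschitz B f.
Proof.
move=> tf.
have /fin_all_exists2[B B0 HB] i := test_bounded (test_partial i tf).
exists (d%:R * \sum_i B i); first by rewrite mulr_ge0// sumr_ge0.
apply: lipschitz_of_partial; first exact: sumr_ge0.
- by move=> i x; exact: test_derivable.
- move=> i x; apply: (le_trans (HB i x)).
  by rewrite (bigD1 i)//= lerDl sumr_ge0.
Qed.

End test_functions.

(** * Integration by parts *)

Section step_approximation.
Context {R : realType} {d : nat}.
Variables (L : nat) (B : R) (f : 'rV[R]_d -> R).
Hypothesis (fL : box_support L f) (fB : sup_lipschitz B f) (B0 : 0 <= B).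
Local Notation mu := (@lebesgue_rV R d).
Local Notation cell N := {ffun 'I_d -> 'I_(grid_size L N)}.

Definition step N (K : cell N -> R) (x : 'rV[R]_d) : R :=
  \sum_a K a * \1_(cell_set a) x.

Lemma step_cell N (K : cell N -> R) a x : cell_set a x -> step K x = K a.
Proof.
move=> ax; rewrite /step (bigD1 a)//= big1 => [|b ba]; last first.
  rewrite indicE memNset ?mulr0// => bx.
  by rewrite (cell_set_inj ax bx) eqxx in ba.
by rewrite addr0 indicE mem_set// mulr1.
Qed.

Lemma step_out N (K : cell N -> R) x : (forall a : cell N, ~ cell_set a x) -> step K x = 0.
Proof.
by move=> nx; rewrite /step big1// => b _; rewrite indicE memNset ?mulr0// => /nx.
Qed.

Lemma support_cell N x : f x != 0 -> exists a : cell N, cell_set a x.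
Proof.
move=> fx; apply: cell_set_cover => i.
by have := fL fx i; rewrite ltr_norml => /andP[/ltW -> ->].
Qed.

Lemma cell_set_near N (a : cell N) x y : cell_set a x -> cell_set a y ->
  forall i, `|x ord0 i - y ord0 i| <= @mesh R N.
Proof.
move=> ax ay i; have /andP[x1 x2] := ax i; have /andP[y1 y2] := ay i.
by rewrite ler_norml; apply/andP; split; lra.
Qed.

Lemma corner_in N (a : cell N) : @cell_set R d L N a (corner a).
Proof. by move=> i; rewrite lexx ltrDl mesh_gt0. Qed.

Lemma step_near N (K : cell N -> R) (e : R) : 0 <= e ->
  (forall a x, cell_set a x -> `|f x - K a| <= e) ->
  forall x, `|f x - step K x| <= e.
Proof.
move=> e0 H x; have [[a ax]|nx] := pselect (exists a : cell N, cell_set a x).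
  by rewrite (step_cell _ ax) H.
rewrite step_out; last by move=> a ax; apply: nx; exists a.
have [->|/(@support_cell N)//] := eqVneq (f x) 0.
by rewrite subr0 normr0.
Qed.

Lemma measurable_step N (K : cell N -> R) : measurable_fun setT (step K).
Proof.
apply: measurable_sum => a; apply: measurable_funM => //.
by apply: measurable_indic; exact: measurable_cube.
Qed.

Lemma mesh_cvg0 : @mesh R N @[N --> \oo] --> 0.
Proof.
apply: cvg_expr; rewrite ger0_norm ?invr_ge0// invf_lt1// ltr1n//.
Qed.

(** [f] is the uniform limit of the step functions that sample it at the corners of the cells. *)
Lemma measurable_lipschitz : measurable_fun setT f.
Proof.
pose F N := step (fun a : cell N => f (corner a)).
apply: (@measurable_fun_cvg _ _ _ _ F); first by move=> N; exact: measurable_step.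
move=> x _; apply/cvgrPdist_le => e e0.
have : B * @mesh R N @[N --> \oo] --> B * 0 by apply: cvgMr; exact: mesh_cvg0.
rewrite mulr0 => /cvgr0Pnorm_le/(_ e e0); apply: filterS => N HN.
apply: step_near; first exact: ltW.
move=> a y ay; apply: le_trans HN; apply: le_trans (ler_norm _).
by apply: fB; exact: (cell_set_near ay (corner_in a)).
Qed.

Lemma integral_step N (K : cell N -> R) : (forall a, 0 <= K a) ->
  (\int[mu]_x (step K x)%:E = (@mesh R N ^+ d * \sum_a K a)%:E)%E.
Proof.
move=> K0; rewrite integral_sum_indic//; last by move=> a; exact: measurable_cube.
rewrite mulr_sumr -sumEFin; apply: eq_bigr => a _.
by rewrite [X in (_ * X = _)%E](_ : _ = (@mesh R N ^+ d)%:E) ?EFinM 1?muleC//; exact: lebesgue_cell.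
Qed.

Lemma integrable_step N (K : cell N -> R) : mu.-integrable setT (EFin \o step K).
Proof.
apply/integrableP; split; first by apply/measurable_EFinP; exact: measurable_step.
apply: (@le_lt_trans _ _ (\int[mu]_x (step (fun a => `|K a|) x)%:E)%E).
  apply: ge0_le_integralT => // x; rewrite lee_fin.
  apply: (le_trans (ler_norm_sum _ _ _)); apply: ler_sum => a _.
  by rewrite normrM [`|\1_ _ _|]ger0_norm.
by rewrite integral_step ?ltry.
Qed.

Lemma integrable_lipschitz : mu.-integrable setT (EFin \o f).
Proof.
apply: (@le_integrable _ _ _ mu _ measurableT _
  (EFin \o step (fun a : cell 0 => `|f (corner a)| + B))).
- by apply/measurable_EFinP; exact: measurable_lipschitz.
- move=> x _; rewrite lee_fin /=.
  have [->|/(@support_cell 0)[a ax]] := eqVneq (f x) 0; first by rewrite normr0.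
  rewrite (step_cell _ ax) [leRHS]ger0_norm ?addr_ge0// -lerBlDl.
  apply: le_trans (lerB_dist _ _) _; apply: le_trans (fB (cell_set_near ax (corner_in a))) _.
  by rewrite /mesh expr0 mulr1.
- exact: integrable_step.
Qed.

End step_approximation.

Section mesh_limit.
Context {R : realType}.

Lemma le0_of_mesh (x C : R) : (forall N, x <= C * @mesh R N) -> x <= 0.
Proof.
move=> H; rewrite leNgt; apply/negP => x0.
have : C * @mesh R N @[N --> \oo] --> C * 0 by apply: cvgMr; exact: mesh_cvg0.
have x20 : 0 < x / 2 by rewrite divr_gt0.
rewrite mulr0 => /cvgr0Pnorm_le/(_ _ x20)[N _ /(_ N (leqnn _))] /= HN.
have := le_trans (H N) (le_trans (ler_norm _) HN); lra.
Qed.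

Lemma mesh_grid_size L N : @mesh R N * (grid_size L N)%:R = L.*2%:R.
Proof. by rewrite /grid_size natrM natrX mulrCA [mesh N * _]mulrC mesh_inv mulr1. Qed.

(** The cells fill a box of volume $(2L)^d$ for every [N]: an error of order [mesh N] in each cell
    stays of that order in total. *)
Lemma mesh_sum_const d L N (c : R) :
  @mesh R N ^+ d * (\sum_(a : {ffun 'I_d -> 'I_(grid_size L N)}) c) = L.*2%:R ^+ d * c.
Proof.
by rewrite sumr_const card_ffun !card_ord -[c *+ _]mulr_natl natrX mulrA -exprMn mesh_grid_size.
Qed.

End mesh_limit.

Section integration_by_parts.
Context {R : realType} {d : nat}.
Variables (L : nat).
Local Notation mu := (@lebesgue_rV R d).
Implicit Types (f g w : 'rV[R]_d -> R).

Lemma Rintegral_step N (K : {ffun 'I_d -> 'I_(grid_size L N)} -> R) :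
  \int[mu]_x step K x = @mesh R N ^+ d * \sum_a K a.
Proof.
pose P a := Num.max (K a) 0; pose Q a := Num.max (- K a) 0.
have KE a : K a = P a - Q a by rewrite /P /Q; have [|] := leP (K a) 0 => k0;
  [rewrite max_l ?oppr_ge0//|rewrite max_r ?oppr_le0 1?ltW//]; lra.
have -> : step K = fun x => step P x - step Q x.
  apply/funext => x; rewrite /step -sumrB; apply: eq_bigr => a _.
  by rewrite KE mulrBl.
rewrite RintegralB//; [|exact: integrable_step..].
rewrite /Rintegral !integral_step/=; [|by move=> a; rewrite le_max lexx orbT..].
by rewrite -mulrBr -sumrB; congr (_ * _); apply: eq_bigr => a _; rewrite KE.
Qed.

(** The difference quotients of [w] at the corners sum to zero, because translation by one cell
    permutes the cells. By the mean value theorem they approximate the derivative up to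
    [B * mesh N]. *)
Lemma Rintegral_partial_eq0 w (i : 'I_d) (B : R) :
    box_support L w -> box_support L ('D_(unit_vec i) w) ->
    (forall x, derivable w x (unit_vec i)) ->
    sup_lipschitz B ('D_(unit_vec i) w) -> 0 <= B ->
  \int[mu]_x ('D_(unit_vec i) w x) = 0.
Proof.
move=> wL gL dw gB B0; set g := 'D_(unit_vec i) w.
apply/eqP; rewrite -normr_eq0 eq_le normr_ge0 andbT.
apply: (@le0_of_mesh _ _ (L.*2%:R ^+ d * B)) => N.
have m0 := @mesh_gt0 R N.
set h := mesh N in m0 *.
pose K (a : {ffun 'I_d -> 'I_(grid_size L N)}) :=
  (w (h *: unit_vec i + corner a) - w (corner a)) / h.
have K0 : \sum_a K a = 0.
  rewrite -mulr_suml sumrB; apply/eqP; rewrite mulf_eq0 subr_eq0; apply/orP; left.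
  (* The shift is cyclic, hence bijective; wrapping around is harmless because [w] vanishes at $x_i
     = -L$ and at $x_i = L$. *)
  pose sh (a : {ffun 'I_d -> 'I_(grid_size L N)}) :=
    [ffun j => if j == i then ordS (a j) else a j].
  have sh_inj : injective sh.
    move=> a b /ffunP ab; apply/ffunP => j; have := ab j; rewrite !ffunE.
    by case: ifP => // _ /(can_inj (@ordSK _)).
  rewrite [X in _ == X](reindex_inj sh_inj) /=; apply/eqP; apply: eq_bigr => a _.
  have [aS|aS] := ltnP (a i).+1 (grid_size L N).
    congr w; apply/rowP => j; rewrite !mxE eqxx /= ffunE.
    have [->|ji] := eqVneq j i; last by rewrite mulr0 add0r.
    by rewrite /= modn_small// -natr1 /h; ring.
  have aE : (a i).+1 = grid_size L N by apply/eqP; rewrite eqn_leq aS ltn_ord.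
  have w0 (x : 'rV[R]_d) : `|x ord0 i| >= L%:R -> w x = 0.
    by apply: contraTeq => wx; rewrite -ltNge; exact: wL.
  rewrite !w0//.
    rewrite !mxE ffunE !eqxx /= aE modnn mul0r sub0r normrN ger0_norm//.
  rewrite !mxE !eqxx /= (_ : h * 1 + _ = (a i).+1%:R * h - L%:R); last first.
    by rewrite -natr1 /h; ring.
  by rewrite aE /h mulrC mesh_grid_size -addnn natrD addrK ger0_norm.
have -> : \int[mu]_x g x = \int[mu]_x (g x - step K x).
  rewrite RintegralB// ?Rintegral_step ?K0 ?mulr0 ?subr0//.
    exact: integrable_lipschitz gL gB B0.
  exact: integrable_step.
have intB : mu.-integrable setT (EFin \o (fun x => g x - step K x)).
  rewrite (_ : _ \o _ = (EFin \o g) \- (EFin \o step K))%E; last by apply/funext.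
  apply: integrableB => //; last exact: integrable_step.
  exact: integrable_lipschitz gL gB B0.
apply: (le_trans (le_normr_Rintegral _ intB)) => //.
rewrite -mulrA -(mesh_sum_const d L N) -Rintegral_step.
apply: le_Rintegral => //.
- by have := integrable_abse intB.
- exact: integrable_step.
move=> x _; have [[a ax]|nx] := pselect (exists a : {ffun 'I_d -> 'I_(grid_size L N)}, cell_set a x).
  rewrite !(step_cell _ ax) /K.
  have [t /andP[t0 th] ->] := MVT_line (corner a) dw (ltW m0).
  rewrite mulrAC divff ?gt_eqF// mul1r; apply: gB => j.
  rewrite distrC.
  have -> : (t *: unit_vec i + corner a) ord0 j - x ord0 j =
      t * (j == i)%:R + (corner a ord0 j - x ord0 j).
    by move: (corner a) => c; rewrite !mxE eqxx addrA.
  have /andP[x1 x2] := ax j; rewrite -/h in x2.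
  by case: eqP => _; rewrite ?mulr1 ?mulr0 ler_norml; apply/andP; split; lra.
have nx' a : ~ @cell_set R d L N a x by move=> ax; apply: nx; exists a.
rewrite !step_out//.
have [->|/(support_cell gL N)//] := eqVneq (g x) 0.
by rewrite subr0 normr0.
Qed.

End integration_by_parts.

(** * Classical derivatives of test functions are weak derivatives *)

Section weak_derivative.
Context {R : realType} {d : nat}.
Local Notation mu := (@lebesgue_rV R d).
Implicit Types (f g u psi : 'rV[R]_d -> R) (s : seq 'I_d).

Lemma box_support_le L L' f : (L <= L')%N -> box_support L f -> box_support L' f.
Proof.
by move=> LL fL x fx i; apply: (lt_le_trans (fL x fx i)); rewrite ler_nat.
Qed.

Lemma box_supportMl L f g : box_support L f -> box_support L (fun x => f x * g x).
Proof. by move=> fL x; rewrite mulf_eq0 negb_or => /andP[/fL]. Qed.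

Lemma box_supportD L f g : box_support L f -> box_support L g ->
  box_support L (fun x => f x + g x).
Proof.
move=> fL gL x; have [->|/fL//] := eqVneq (f x) 0.
by rewrite add0r => /gL.
Qed.

Lemma sup_lipschitzM (A B A' B' : R) f g :
    (forall x, `|f x| <= A) -> (forall x, `|g x| <= A') ->
    sup_lipschitz B f -> sup_lipschitz B' g ->
  sup_lipschitz (B * A' + A * B') (fun x => f x * g x).
Proof.
move=> fA gA fB gB x y h xyh.
have -> : f x * g x - f y * g y = (f x - f y) * g x + f y * (g x - g y) by ring.
apply: (le_trans (ler_normD _ _)); rewrite [leRHS]mulrDl; apply: lerD; rewrite normrM.
  by rewrite mulrAC ler_pM// fB.
by rewrite -mulrA ler_pM// gB.
Qed.

Lemma sup_lipschitzD (B B' : R) f g : sup_lipschitz B f -> sup_lipschitz B' g ->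
  sup_lipschitz (B + B') (fun x => f x + g x).
Proof.
move=> fB gB x y h xyh; rewrite opprD addrACA mulrDl.
by apply: (le_trans (ler_normD _ _)); apply: lerD; [exact: fB|exact: gB].
Qed.

Lemma test_integrable f : test_function f -> mu.-integrable setT (EFin \o f).
Proof.
move=> tf; have [L _ fL] := test_box tf; have [B B0 fB] := test_lipschitz tf.
exact: integrable_lipschitz fL fB B0.
Qed.

Lemma test_measurable f : test_function f -> measurable_fun setT f.
Proof.
move=> tf; have [L _ fL] := test_box tf; have [B B0 fB] := test_lipschitz tf.
exact: measurable_lipschitz fL fB.
Qed.

Lemma test_mul_integrable f g : test_function f -> test_function g ->
  mu.-integrable setT (EFin \o (fun x => f x * g x)).
Proof.
move=> tf tg; have [L _ fL] := test_box tf; have [B B0 fB] := test_lipschitz tf.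
have [B' B'0 gB] := test_lipschitz tg.
have [A A0 fA] := test_bounded tf; have [A' A'0 gA] := test_bounded tg.
apply: (integrable_lipschitz (box_supportMl fL) (sup_lipschitzM fA gA fB gB)).
by rewrite addr_ge0// mulr_ge0.
Qed.

Lemma integration_by_parts u psi (i : 'I_d) : test_function u -> test_function psi ->
  \int[mu]_x (u x * 'D_(unit_vec i) psi x) =
  - \int[mu]_x ('D_(unit_vec i) u x * psi x).
Proof.
move=> tu tp; have tu' := test_partial i tu; have tp' := test_partial i tp.
have [B B0 uB] := test_lipschitz tu; have [B' B'0 uB'] := test_lipschitz tu'.
have [C C0 pC] := test_lipschitz tp; have [C' C'0 pC'] := test_lipschitz tp'.
have [A A0 uA] := test_bounded tu; have [A' A'0 uA'] := test_bounded tu'.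
have [E E0 pE] := test_bounded tp; have [E' E'0 pE'] := test_bounded tp'.
have [L _ uL] := test_box tu; have [L' _ uL'] := test_box tu'.
have {}uL := box_support_le (leq_maxl L L') uL.
have {}uL' := box_support_le (leq_maxr L L') uL'.
have wE : 'D_(unit_vec i) (u * psi) =
    (fun x => u x * 'D_(unit_vec i) psi x + 'D_(unit_vec i) u x * psi x).
  apply/funext => x; rewrite deriveM; [|exact: test_derivable..].
  by rewrite [X in _ + X]mulrC.
have := @Rintegral_partial_eq0 R d (maxn L L') (u * psi) i
  (B * E' + A * C' + (B' * E + A' * C)).
rewrite wE => H; have := H _ _ _ _ _; rewrite RintegralD//; last 2 first.
- exact: test_mul_integrable.
- exact: test_mul_integrable.
move=> K; apply/eqP; rewrite -addr_eq0; apply/eqP/K.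
- exact: box_supportMl.
- by apply: box_supportD; exact: box_supportMl.
- by move=> x; apply: derivableM; exact: test_derivable.
- by apply: sup_lipschitzD; exact: sup_lipschitzM.
- by rewrite !addr_ge0// mulr_ge0.
Qed.

(** Each integration by parts takes the outermost derivative of the test function and applies it to
    [u] before those still to come, so the list is reversed. *)
Lemma weak_partial_classical s u : test_function u ->
  weak_partial s u (iter_partial (rev s) u).
Proof.
elim: s u => [|i s IH] u tu psi tpsi /=.
  by rewrite expr0 mul1r.
rewrite integration_by_parts//; last exact: test_iter_partial.
rewrite IH//; last exact: test_partial.
by rewrite exprS -mulrA mulN1r rev_cons iter_partial_rcons.
Qed.

End weak_derivative.

(** * Smooth functions of one variable *)

Section smooth_line.
Context {R : realType}.
Implicit Types (f g : R -> R) (m n k : nat).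

(** The recursion differentiates first and then asks for the remaining order, which suits the
    Leibniz rule by induction on the order; [smooth_lineP] links it to [smooth_line]. *)
Fixpoint derivable_upto n g : Prop :=
  if n is m.+1 then (forall x, derivable g x 1) /\ derivable_upto m (derive1 g) else True.

Lemma derivable_upto_le m n g : (m <= n)%N -> derivable_upto n g -> derivable_upto m g.
Proof.
elim: n m g => [|n IH] [|m] g //= mn [dg dg']; split => //.
exact: IH.
Qed.

Lemma derivable_uptoD n f g : derivable_upto n f -> derivable_upto n g ->
  derivable_upto n (fun x => f x + g x).
Proof.
elim: n f g => //= n IH f g [df cf] [dg cg]; split.
  by move=> x; apply: derivableD.
rewrite (_ : derive1 _ = fun x => (derive1 f) x + (derive1 g) x); first exact: IH.
by apply/funext => x; rewrite !derive1E deriveD.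
Qed.

Lemma derivable_uptoM n f g : derivable_upto n f -> derivable_upto n g ->
  derivable_upto n (fun x => f x * g x).
Proof.
elim: n f g => //= n IH f g [df cf] [dg cg]; split.
  by move=> x; apply: derivableM.
have -> : derive1 (fun x => f x * g x) = fun x => f x * (derive1 g) x + g x * (derive1 f) x.
  by apply/funext => x; rewrite !derive1E deriveM.
apply: derivable_uptoD; apply: IH => //.
- by apply: (@derivable_upto_le n n.+1).
- by apply: (@derivable_upto_le n n.+1).
Qed.

Lemma derivable_upto_cst n (c : R) : derivable_upto n (fun=> c).
Proof.
elim: n c => //= n IH c; split; first by move=> x; exact: derivable_cst.
rewrite (_ : derive1 _ = fun=> 0); first exact: IH.
by apply/funext => x; rewrite derive1E derive_cst.
Qed.

Lemma is_derive_affine f (a b x l : R) : is_derive (a * x + b) 1 f l ->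
  is_derive x 1 (fun t => f (a * t + b)) (a * l).
Proof.
move=> df.
have da : is_derive x 1 (fun t : R => a * t + b) a.
  by apply: is_derive_eq; rewrite !addr0 /GRing.scale /= mulr1 ?mulr0 ?addr0.
have := @is_derive1_comp R f (fun t => a * t + b) x l a df da.
by rewrite mulrC.
Qed.

Lemma derivable_upto_affine n f (a b : R) : derivable_upto n f ->
  derivable_upto n (fun t => f (a * t + b)).
Proof.
elim: n f => //= n IH f [df cf].
have H (x : R) : is_derive x 1 (fun t => f (a * t + b)) (a * (derive1 f) (a * x + b)).
  by apply: is_derive_affine; rewrite derive1E; exact: derivableP.
split; first by move=> x; exact: ex_derive.
rewrite (_ : derive1 _ = fun x => (fun=> a) x * (derive1 f) (a * x + b)).
  by apply: derivable_uptoM; [exact: derivable_upto_cst|exact: IH].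
by apply/funext => x; rewrite derive1E derive_val.
Qed.

Definition smooth_line g := forall n x, derivable (derive1n n g) x 1.

Lemma derive1nSr n g : derive1n n.+1 g = derive1n n (derive1 g).
Proof. by rewrite /derive1n iterSr. Qed.

Lemma smooth_lineP g : smooth_line g <-> forall n, derivable_upto n g.
Proof.
split=> [sg n|dg n].
  elim: n g sg => //= n IH g sg; split; first exact: (sg 0%N).
  by apply: IH => m; rewrite -derive1nSr.
by elim: n g dg => [|n IH] g dg; [have [] := dg 1%N|rewrite derive1nSr; apply: IH => m; have [] := dg m.+1].
Qed.

(** The flat function $x^{-m} e^{-1/x}$, continued by $0$. The powers of $1/x$ make the linear span
    of the family closed under differentiation. *)
Definition exp_inv m (x : R) : R := if 0 < x then expR (- x^-1) * x^-1 ^+ m else 0.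

Lemma exp_inv_ge0 m x : 0 <= exp_inv m x.
Proof. by rewrite /exp_inv; case: ifP => // x0; rewrite mulr_ge0 ?expR_ge0// exprn_ge0// invr_ge0 ltW. Qed.

(** The term of order [m.+1] of the exponential series at $1/x$ leaves one power of $x$ to spare,
    which is what differentiability at the origin requires. *)
Lemma exp_inv_le m (x : R) : exp_inv m x <= (m.+1)`!%:R * `|x|.
Proof.
rewrite /exp_inv; case: ifPn => [x0|_]; last by rewrite mulr_ge0.
rewrite gtr0_norm// expRN mulrC ler_pdivrMr ?expR_gt0//.
have y0 : 0 <= x^-1 by rewrite invr_ge0 ltW.
have h : x^-1 ^+ m.+1 / (m.+1)`!%:R <= expR x^-1.
  by apply: le_trans (expR_ge1Dxn m y0); rewrite lerDr.
rewrite ler_pdivrMr ?ltr0n ?fact_gt0// in h.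
have -> : x^-1 ^+ m = x * x^-1 ^+ m.+1 by rewrite exprS mulrA divff ?mul1r// gt_eqF.
have := ler_wpM2l (ltW x0) h; move=> /le_trans; apply.
by rewrite le_eqVlt; apply/orP; left; apply/eqP; ring.
Qed.

Lemma is_derive_exp_inv m (x : R) :
  is_derive x 1 (exp_inv m) (exp_inv m.+2 x - m%:R * exp_inv m.+1 x).
Proof.
have [x0|x0|->] := ltgtP x 0.
- have -> : exp_inv m.+2 x - m%:R * exp_inv m.+1 x = 0.
    by rewrite /exp_inv ltNge (ltW x0)/= mulr0 subr0.
  apply: (near_eq_is_derive (f := cst 0)).
  near=> y; rewrite /exp_inv ltNge (_ : y <= 0)//.
  by near: y; apply: filterS (lt_nbhsl x0) => y /ltW.
- have -> : exp_inv m.+2 x - m%:R * exp_inv m.+1 x =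
      expR (- x^-1) * (m%:R * x^-1 ^+ m.-1 * (- x ^- 2)) + x^-1 ^+ m * (expR (- x^-1) * x ^- 2).
    rewrite /exp_inv x0; case: m => [|m] /=; rewrite !exprS ?expr0; field; exact: lt0r_neq0.
  have x0' : x != 0 by rewrite gt_eqF.
  have di : is_derive x 1 (fun y : R => y^-1) (- x ^- 2).
    have := is_deriveV x0' (is_derive_id x 1); rewrite /GRing.scale/= mulr1.
    exact.
  have dN : is_derive x 1 (fun y : R => - y^-1) (x ^- 2).
    by have := is_deriveN di; rewrite opprK.
  have dE : is_derive x 1 (fun y : R => expR (- y^-1)) (expR (- x^-1) * x ^- 2).
    exact: (is_derive1_comp (is_derive_expR _) dN).
  have dX : is_derive x 1 (fun y : R => y^-1 ^+ m) (m%:R * x^-1 ^+ m.-1 * (- x ^- 2)).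
    have := is_deriveX m di; rewrite /GRing.scale/= => H.
    by rewrite (_ : (fun y : R => y^-1 ^+ m) = (fun y : R => y^-1) ^+ m)//; apply/funext => y; rewrite fctE.
  have K := is_deriveM dE dX.
  apply: near_eq_is_derive K.
  near=> y; rewrite /exp_inv (_ : 0 < y)//.
  by near: y; exact: lt_nbhsr.
- have -> : exp_inv m.+2 0 - m%:R * exp_inv m.+1 0 = 0 :> R.
    by rewrite /exp_inv ltxx mulr0 subr0.
  (* At the origin the difference quotient is again a function of the family, [exp_inv m.+1], and
     tends to zero by [exp_inv_le]. *)
  have C : (h^-1 *: ((exp_inv m \o shift 0) (h *: 1) - exp_inv m 0)) @[h --> 0^'] --> (0 : R).
    apply: (@cvg_trans _ ((fun h : R => exp_inv m.+1 h) @ 0^')).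
      apply: near_eq_cvg; near=> h.
      rewrite /= scaler1 addr0 /exp_inv ltxx subr0; case: ifPn => h0.
        by rewrite /GRing.scale/= exprS; ring.
      by rewrite scaler0.
    apply/cvgrPdist_le => e e0; near=> h.
    rewrite sub0r normrN ger0_norm ?exp_inv_ge0//.
    apply: (le_trans (exp_inv_le _ _)).
    have F0 : 0 < (m.+2)`!%:R :> R by rewrite ltr0n fact_gt0.
    rewrite mulrC -ler_pdivlMr//; near: h.
    have : 0 < e / (m.+2)`!%:R by rewrite divr_gt0.
    exact: dnbhs0_le.
  split; first by apply/cvg_ex; exists 0.
  exact/cvg_lim.
Unshelve. all: by end_near. Qed.

Lemma smooth_exp_inv m n : derivable_upto n (exp_inv m).
Proof.
elim: n m => //= n IH m; split; first by move=> x; apply: ex_derive; exact: is_derive_exp_inv.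
rewrite (_ : derive1 _ = fun x => exp_inv m.+2 x + (fun=> - m%:R) x * exp_inv m.+1 x).
  by apply: derivable_uptoD => //; apply: derivable_uptoM => //; exact: derivable_upto_cst.
apply/funext => x; have H := is_derive_exp_inv m x.
by rewrite derive1E derive_val mulNr.
Qed.

Lemma smooth_lineM f g : smooth_line f -> smooth_line g -> smooth_line (fun x => f x * g x).
Proof. by rewrite !smooth_lineP => sf sg n; exact: derivable_uptoM. Qed.

Lemma smooth_lineZ (c : R) f : smooth_line f -> smooth_line (fun x => c * f x).
Proof.
rewrite !smooth_lineP => sf n.
by apply: (@derivable_uptoM _ (fun=> c)) => //; exact: derivable_upto_cst.
Qed.

Lemma smooth_line_affine (a b : R) f : smooth_line f -> smooth_line (fun x => f (a * x + b)).
Proof. by rewrite !smooth_lineP => sf n; exact: derivable_upto_affine. Qed.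

Lemma smooth_line_exp_inv m : smooth_line (exp_inv m).
Proof. by apply/smooth_lineP => n; exact: smooth_exp_inv. Qed.

Lemma smooth_line_continuous n f : smooth_line f -> continuous (derive1n n f).
Proof. by move=> sf x; apply/differentiable_continuous/derivable1_diffP/sf. Qed.

End smooth_line.

(** * Products and rescalings of test functions *)

Section product_functions.
Context {R : realType} {d : nat}.
Implicit Types (f : 'rV[R]_d -> R) (g : 'I_d -> R -> R) (s : seq 'I_d) (x p : 'rV[R]_d).

Lemma compact_support_box f (M : R) :
  (forall x, f x != 0 -> forall i, `|x ord0 i| <= M) ->
  compact (closure [set x | f x != 0]).
Proof.
move=> fM.
have cB : compact [set v : 'rV[R]_d | forall i, `[- M, M]%classic (v ord0 i)].
  by apply: (@rV_compact _ _ (fun=> `[- M, M]%classic)) => _; exact: segment_compact.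
apply: (subclosed_compact _ cB); first exact: closed_closure.
have /closure_id -> : closed [set v : 'rV[R]_d | forall i, `[- M, M]%classic (v ord0 i)].
  by apply: compact_closed => //; exact: norm_hausdorff.
by apply: closure_subset => x /= /fM H i; rewrite in_itv /= -ler_norml.
Qed.

Lemma closed_box_partial f (M : R) i :
  (forall x, f x != 0 -> forall j, `|x ord0 j| <= M) ->
  forall x, 'D_(unit_vec i) f x != 0 -> forall j, `|x ord0 j| <= M.
Proof.
move=> fM x Dx j; rewrite leNgt; apply/negP => Mx.
have cx : continuous (fun y : 'rV[R]_d => `|y ord0 j|).
  by move=> y; apply: continuous_comp; [exact: coord_continuous|exact: norm_continuous].
have f0 : \near x, f x = cst 0 x.
  have : \forall y \near x, M < `|(y : 'rV[R]_d) ord0 j| by exact: (cx x [set r | M < r] (lt_nbhsr Mx)).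
  apply: filterS => y My /=; apply/eqP; apply: contraTT My => /fM/(_ j).
  by rewrite -leNgt.
by move: Dx; rewrite (near_eq_derive (unit_vec i) f0) derive_cst eqxx.
Qed.

Lemma closed_box_iter_partial f (M : R) s :
  (forall x, f x != 0 -> forall j, `|x ord0 j| <= M) ->
  forall x, iter_partial s f x != 0 -> forall j, `|x ord0 j| <= M.
Proof. by move=> fM; elim: s => //= i s IH; exact: closed_box_partial. Qed.

Definition prod_fun g x : R := \prod_i g i (x ord0 i).

Lemma prod_fun_continuous g : (forall i, continuous (g i)) -> continuous (prod_fun g).
Proof.
move=> cg; apply: continuous_big => [|i _ x]; first exact: mul_continuous.
apply: (@cvg_comp _ _ _ (fun y : 'rV[R]_d => y ord0 i) (g i)); last exact: cg.
exact: coord_continuous.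
Qed.

Lemma is_derive_prod_fun g (k : 'I_d) x : (forall i, smooth_line (g i)) ->
  is_derive x (unit_vec k) (prod_fun g)
    (prod_fun (fun i => if i == k then derive1 (g i) else g i) x).
Proof.
move=> sg; apply: is_derive_line.
pose c := \prod_(i | i != k) g i (x ord0 i).
have -> : (fun h : R => prod_fun g (h *: unit_vec k + x)) =
    fun h => c * g k (1 * h + x ord0 k).
  apply/funext => h; rewrite /prod_fun (bigD1 k)//= mulrC; congr (_ * g k _).
    apply: eq_bigr => i ik; congr (g i _).
    by rewrite !mxE eqxx /= (negbTE ik) mulr0 add0r.
  by rewrite !mxE !eqxx /= mulr1 mul1r.
have -> : prod_fun (fun i => if i == k then derive1 (g i) else g i) x =
    c * (1 * derive1 (g k) (1 * 0 + x ord0 k)).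
  rewrite /prod_fun (bigD1 k)//= eqxx mulr0 add0r mul1r mulrC; congr (_ * _).
  by apply: eq_bigr => i /negbTE ->.
have H : is_derive (0 : R) 1 (fun t : R => g k (1 * t + x ord0 k))
    (1 * derive1 (g k) (1 * 0 + x ord0 k)).
  by apply: is_derive_affine; rewrite derive1E; apply: derivableP; exact: (sg k 0%N).
exact: is_deriveZ.
Qed.

Lemma iter_partial_prod_fun g s : (forall i, smooth_line (g i)) ->
  iter_partial s (prod_fun g) = prod_fun (fun i => derive1n (count_mem i s) (g i)).
Proof.
move=> sg; elim: s => //= k s ->.
apply/funext => x.
have sg' i : smooth_line (derive1n (count_mem i s) (g i)).
  by move=> n y; rewrite /derive1n -iterD; exact: sg.
have H := is_derive_prod_fun k x sg'; rewrite derive_val.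
congr prod_fun; apply/funext => i; rewrite eq_sym; by case: eqP.
Qed.

Lemma smooth_prod_fun g : (forall i, smooth_line (g i)) -> smooth (prod_fun g).
Proof.
move=> sg s; rewrite iter_partial_prod_fun//.
have sg' i : smooth_line (derive1n (count_mem i s) (g i)).
  by move=> n y; rewrite /derive1n -iterD; exact: sg.
split; first by apply: prod_fun_continuous => i; exact: smooth_line_continuous.
by move=> i x; have [] := is_derive_prod_fun i x sg'.
Qed.

Lemma test_prod_fun g (M : R) : (forall i, smooth_line (g i)) ->
  (forall i t, g i t != 0 -> `|t| <= M) -> test_function (prod_fun g).
Proof.
move=> sg gM; split; first exact: smooth_prod_fun.
apply: (@compact_support_box _ M) => x.
rewrite /prod_fun prodf_seq_neq0 => /allP H i.
by apply: (gM i); apply: H; rewrite mem_index_enum.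
Qed.

Definition rescale p (l : R) f x : R := f (l^-1 *: (x - p)).

Lemma is_derive_rescale p (l : R) f i x : derivable f (l^-1 *: (x - p)) (unit_vec i) ->
  is_derive x (unit_vec i) (rescale p l f)
    (l^-1 * 'D_(unit_vec i) f (l^-1 *: (x - p))).
Proof.
move=> df; apply: is_derive_line.
pose F (r : R) := f (r *: unit_vec i + l^-1 *: (x - p)).
have -> : (fun h : R => rescale p l f (h *: unit_vec i + x)) = fun h => F (l^-1 * h + 0).
  by apply/funext => h; rewrite /F /rescale addr0 -addrA scalerDr scalerA.
apply: is_derive_affine.
have -> : 'D_(unit_vec i) f (l^-1 *: (x - p)) =
    'D_(unit_vec i) f ((l^-1 * 0 + 0) *: unit_vec i + l^-1 *: (x - p)).
  by rewrite mulr0 addr0 scale0r add0r.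
by apply: line_derive; rewrite mulr0 addr0 scale0r add0r.
Qed.

Lemma iter_partial_rescale p (l : R) f s : smooth f ->
  iter_partial s (rescale p l f) =
  fun x => l^-1 ^+ size s * rescale p l (iter_partial s f) x.
Proof.
move=> sf; elim: s => [|i s IH]; first by apply/funext => x /=; rewrite expr0 mul1r.
apply/funext => x; rewrite [LHS]/= -/(iter_partial s _) IH.
have H := is_derive_rescale ((sf s).2 i (l^-1 *: (x - p))).
have := is_deriveZ (l^-1 ^+ size s) H => K.
rewrite [LHS](_ : _ = 'D_(unit_vec i) (l^-1 ^+ size s \*: rescale p l (iter_partial s f)) x)//.
by rewrite derive_val /= exprSr -mulrA.
Qed.

Lemma test_rescale p (l : R) f : 0 < l -> test_function f -> test_function (rescale p l f).
Proof.
move=> l0 tf; have sf := tf.1; split.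
  move=> s; rewrite iter_partial_rescale//; split.
    move=> x.
    have c0 : {for x, continuous (fun y : 'rV[R]_d => l^-1 *: (y - p))}.
      exact: (cvgZ (cvg_cst l^-1) (cvgB cvg_id (cvg_cst p))).
    have c1 : {for x, continuous (rescale p l (iter_partial s f))}.
      exact: (continuous_comp c0 ((sf s).1 _)).
    exact: (cvgM (cvg_cst _) c1).
  move=> i x; have [H _] := is_deriveZ (l^-1 ^+ size s) (is_derive_rescale ((sf s).2 i (l^-1 *: (x - p)))).
  exact: H.
have [L _ fL] := test_box tf.
apply: (@compact_support_box _ (l * L%:R + `|p|)) => x /fL H i.
have := H i; rewrite !mxE normrM gtr0_norm ?invr_gt0// ltr_pdivrMl// => /ltW H1.
rewrite -[x ord0 i](subrK (p ord0 i)); apply: (le_trans (ler_normD _ _)).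
by apply: lerD => //; exact: le_coord_norm.
Qed.

End product_functions.

(** * Sums and multiples of test functions *)

Section sums.
Context {R : realType} {d : nat}.
Implicit Types (f g : 'rV[R]_d -> R) (s : seq 'I_d).

Lemma smoothD_iter f g s : smooth f -> smooth g ->
  iter_partial s (f \+ g) = iter_partial s f \+ iter_partial s g.
Proof.
move=> sf sg; elim: s => //= i s ->; apply/funext => x.
by rewrite /= -deriveD//; [exact: (sf s).2|exact: (sg s).2].
Qed.

Lemma smoothZ_iter (c : R) f s : smooth f ->
  iter_partial s (fun x => c * f x) = fun x => c * iter_partial s f x.
Proof.
move=> sf; elim: s => //= i s ->; apply/funext => x.
by rewrite -[RHS]/(c *: _) -deriveZ//; exact: (sf s).2.
Qed.

Lemma smoothD f g : smooth f -> smooth g -> smooth (f \+ g).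
Proof.
move=> sf sg s; rewrite smoothD_iter//; split.
  by move=> x; exact: (cvgD ((sf s).1 x) ((sg s).1 x)).
by move=> i x; apply: derivableD; [exact: (sf s).2|exact: (sg s).2].
Qed.

Lemma smoothZ (c : R) f : smooth f -> smooth (fun x => c * f x).
Proof.
move=> sf s; rewrite smoothZ_iter//; split.
  by move=> x; exact: (cvgM (cvg_cst _) ((sf s).1 x)).
by move=> i x; exact: (derivableZ ((sf s).2 i x)).
Qed.

Lemma testZ (c : R) f : test_function f -> test_function (fun x => c * f x).
Proof.
move=> tf; split; first exact: smoothZ tf.1.
have [L _ fL] := test_box tf; apply: (@compact_support_box _ _ _ L%:R) => x.
by rewrite mulf_eq0 negb_or => /andP[_ /fL H] i; exact: ltW.
Qed.

Lemma testD f g : test_function f -> test_function g -> test_function (f \+ g).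
Proof.
move=> tf tg; split; first exact: smoothD tf.1 tg.1.
have [L _ fL] := test_box tf; have [L' _ gL] := test_box tg.
apply: (@compact_support_box _ _ _ (maxn L L')%:R) => x /= fgx i.
have [f0|/fL/(_ i) H] := eqVneq (f x) 0.
  rewrite f0 add0r in fgx; have := gL x fgx i => /ltW/le_trans; apply.
  by rewrite ler_nat leq_maxr.
by apply: (le_trans (ltW H)); rewrite ler_nat leq_maxl.
Qed.

Lemma test0 : test_function (fun _ : 'rV[R]_d => 0).
Proof.
have E s : iter_partial s (fun _ : 'rV[R]_d => 0 : R) = fun=> 0.
  by elim: s => //= i s ->; apply/funext => x; rewrite derive_cst.
split; first by move=> s; rewrite E; split => [|i] x; [exact: cst_continuous|exact: derivable_cst].
by apply: (@compact_support_box _ _ _ 0) => x; rewrite eqxx.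
Qed.

Lemma test_sum (I : finType) (F : I -> 'rV[R]_d -> R) :
  (forall i, test_function (F i)) -> test_function (fun x => \sum_i F i x).
Proof.
move=> tF; elim: (index_enum I) => [|i r IH].
  by under eq_fun do rewrite big_nil; exact: test0.
under eq_fun do rewrite big_cons.
exact: (testD (tF i) IH).
Qed.

Lemma iter_partial_sum (I : finType) (F : I -> 'rV[R]_d -> R) s :
  (forall i, test_function (F i)) ->
  iter_partial s (fun x => \sum_i F i x) = fun x => \sum_i iter_partial s (F i) x.
Proof.
move=> tF.
have H : forall r, test_function (fun x => \sum_(i <- r) F i x) /\
  iter_partial s (fun x => \sum_(i <- r) F i x) = fun x => \sum_(i <- r) iter_partial s (F i) x.
  elim=> [|i r [IH1 IH2]].
    split; first by under eq_fun do rewrite big_nil; exact: test0.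
    under eq_fun do rewrite big_nil; under [RHS]eq_fun do rewrite big_nil.
    by elim: s => //= i s ->; apply/funext => x; rewrite derive_cst.
  have E : (fun x => \sum_(j <- i :: r) F j x) = F i \+ (fun x => \sum_(j <- r) F j x).
    by apply/funext => x; rewrite big_cons.
  split; rewrite E; first exact: testD.
  rewrite smoothD_iter ?IH2; [|exact: (tF i).1|exact: IH1.1].
  by apply/funext => x; rewrite /= big_cons.
by have [] := H (index_enum I).
Qed.

End sums.

(** * Functions that integrate to zero against test functions *)

Section exp_inv_limits.
Context {R : realType}.

Lemma exp_inv0_le1 (x : R) : exp_inv 0 x <= 1.
Proof.
rewrite /exp_inv; case: ifP => // x0.
by rewrite expr0 mulr1 -[leRHS]expR0 ler_expR oppr_le0 invr_ge0 ltW.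
Qed.

Lemma exp_inv_neq0 m (x : R) : exp_inv m x != 0 -> 0 < x.
Proof. by rewrite /exp_inv; case: ifP => //; rewrite eqxx. Qed.

Lemma exp_inv0_cvg1 (u : nat -> R) (c C : R) : 0 < c ->
  (forall n, c * n%:R - C <= u n) -> exp_inv 0 (u n) @[n --> \oo] --> (1 : R).
Proof.
move=> c0 uc; apply/cvgrPdist_le => e e0; near=> n.
have ne : e^-1 <= u n.
  apply: le_trans (uc n); rewrite lerBrDr -ler_pdivrMl//.
  by near: n; exact: nbhs_infty_ger.
have u0 : 0 < u n by apply: lt_le_trans ne; rewrite invr_gt0.
rewrite ger0_norm ?subr_ge0 ?exp_inv0_le1//.
rewrite /exp_inv u0 expr0 mulr1 lerBlDr -lerBlDl.
apply: le_trans (expR_ge1Dx _); rewrite lerD2l lerN2.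
by rewrite -[leRHS]invrK lef_pV2// ?posrE ?invr_gt0.
Unshelve. all: by end_near. Qed.

Lemma cvg_prod1 (I : finType) (u : nat -> I -> R) :
  (forall i, u n i @[n --> \oo] --> (1 : R)) -> \prod_i u n i @[n --> \oo] --> (1 : R).
Proof.
move=> u1; have E : \prod_(i : I) (1 : R) = 1 by rewrite big1.
rewrite -{2}E; apply: cvg_big => [|i _]; [exact: mul_continuous|exact: u1].
Qed.

Lemma cvgM1 (u v : nat -> R) : u n @[n --> \oo] --> (1 : R) ->
  v n @[n --> \oo] --> (1 : R) -> u n * v n @[n --> \oo] --> (1 : R).
Proof. by move=> u1 v1; have := @cvgM _ _ _ _ u v _ _ u1 v1; rewrite mulr1; exact. Qed.

End exp_inv_limits.

Section orthants.
Context {R : realType} {d : nat}.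
Local Notation mu := (@lebesgue_rV R d).

(** Open orthants are stable under intersection, generate the sigma-algebra, and have indicators
    that are limits of products of functions of one variable. *)
Definition orthant (a : 'I_d -> R) : set 'rV[R]_d := [set x | forall i, a i < x ord0 i].

Definition orthants : set (set 'rV[R]_d) := range orthant.

Lemma setI_closed_orthants : setI_closed orthants.
Proof.
move=> _ _ [a _ <-] [b _ <-]; exists (fun i => Num.max (a i) (b i)) => //.
apply/seteqP; split=> [x H|x [ax bx] i].
  by split => i; have := H i; rewrite gt_max => /andP[].
by rewrite gt_max ax bx.
Qed.

Lemma measurable_orthant a : measurable (orthant a).
Proof.
rewrite (_ : orthant a = [set x | forall i, `]a i, +oo[%classic (x ord0 i)]).
  apply: (@measurable_box R d (fun i => `]a i, +oo[%classic)) => i.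
  exact: measurable_itv.
by apply/seteqP; split => x H i; have := H i; rewrite /= in_itv /= andbT.
Qed.

(** A half-space $x_i > r$ is the union over $n$ of the orthants whose other bounds are all $-n$. *)
Lemma measurable_rV_orthants : (@measurable _ 'rV[R]_d) = <<s orthants >>.
Proof.
apply/seteqP; split; last first.
  apply: smallest_sub; first exact: sigma_algebra_measurable.
  by move=> _ [a _ <-]; exact: measurable_orthant.
apply: smallest_sub; first exact: smallest_sigma_algebra.
move=> A; rewrite -bigcup_seq => -[i _ [B mB <-]]; rewrite setTI.
have [s0 sC sU] := smallest_sigma_algebra setT orthants.
pose D : set (set R) := [set B | <<s orthants >> (rV_coord i @^-1` B)].
suff : @measurable _ R `<=` D by apply.
rewrite [X in X `<=` _]RGenOInfty.measurableE.
apply: smallest_sub.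
  split => [|E DE|F DF].
  - by rewrite /D /= preimage_set0; exact: s0.
  - by rewrite /D /= setTD preimage_setC; rewrite -setTD; exact: sC.
  - by rewrite /D /= preimage_bigcup; exact: sU.
move=> _ [r ->]; rewrite /D /=.
rewrite (_ : _ @^-1` _ = \bigcup_n orthant (fun j => if j == i then r else - n%:R)).
  apply: sU => n; apply: sub_sigma_algebra.
  by exists (fun j => if j == i then r else - n%:R).
apply/seteqP; split => x /=.
  rewrite in_itv /= andbT => rx; exists (Num.truncn `|x|).+1 => // j.
  case: eqP => [->//|_]; rewrite ltrNl.
  apply: (le_lt_trans (ler_norm _)); rewrite normrN.
  by apply: (le_lt_trans (le_coord_norm x j)); exact: truncnS_gt.
by move=> [n _ /(_ i)]; rewrite eqxx in_itv /= andbT.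
Qed.

End orthants.

(** * The fundamental lemma of the calculus of variations *)

Section fundamental_lemma.
Context {R : realType} {d : nat}.
Local Notation mu := (@lebesgue_rV R d).
Variable g : 'rV[R]_d -> R.
Hypothesis ig : mu.-integrable setT (EFin \o g).
Hypothesis g0 : forall psi, test_function psi -> \int[mu]_x (g x * psi x) = 0.

Lemma integral_limit_test (A : set 'rV[R]_d) (psi : nat -> 'rV[R]_d -> R) :
    measurable A -> (forall n, test_function (psi n)) ->
    (forall n x, `|psi n x| <= 1) ->
    (forall x, psi n x @[n --> \oo] --> (\1_A x : R)) ->
  (\int[mu]_(x in A) (g x)%:E = 0)%E.
Proof.
move=> mA tp p1 pA.
have mg : measurable_fun setT g by case/integrableP : ig => /measurable_EFinP.
have [|||||_ _ H] := @dominated_convergence _ _ _ mu setT measurableT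
  (fun n x => (g x * psi n x)%:E) (fun x => (g x * \1_A x)%:E) (fun x => `|g x|%:E).
- move=> n; apply/measurable_EFinP; apply: measurable_funM => //.
  exact: test_measurable.
- by apply/measurable_EFinP; apply: measurable_funM => //; exact: measurable_indic.
- apply: aeW => x _; apply: cvg_EFin; first exact: nearW.
  exact: (cvgM (cvg_cst _) (pA x)).
- exact: integrable_abse ig.
- apply: aeW => x n _; rewrite lee_fin normrM -[leRHS]mulr1.
  by rewrite ler_wpM2l.
- move: H; rewrite (_ : [sequence _]_n = cst 0%E); last first.
    apply/funext => n /=; have := g0 (tp n); rewrite /Rintegral => E.
    rewrite -[LHS]fineK ?E//.
    apply: integrable_fin_num => //.
    have := @le_integrable _ _ _ mu setT measurableT (EFin \o (fun x => g x * psi n x)) (EFin \o g).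
    apply => //.
      apply/measurable_EFinP; apply: measurable_funM => //.
      exact: test_measurable.
    move=> x _; rewrite lee_fin normrM -[leRHS]mulr1.
    by rewrite ler_wpM2l.
  move=> /cvg_lim -/(_ (@ereal_hausdorff _)); rewrite lim_cst; last exact: ereal_hausdorff.
  move=> ->; rewrite [LHS]integral_mkcond; apply: eq_integral => x _.
  rewrite /patch indicE; case: ifP => _; by rewrite ?mulr1 ?mulr0.
Qed.

(** The indicators of the whole space and of the orthants are bounded limits of test functions, so
    [g] integrates to zero over these sets. Dynkin's lemma extends this to all measurable sets; the
    whole space serves for complements. *)
Lemma ae_eq0_of_test : ae_eq mu setT g (cst 0).
Proof.
have mg : measurable_fun setT g by case/integrableP : ig => /measurable_EFinP.
suff H E : measurable E -> (\int[mu]_(x in E) (g x)%:E = 0)%E.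
  have /(_ _) := @integral_ae_eq _ _ _ mu setT measurableT (cst 0%E) (EFin \o g) ig.
  move=> /(_ (measurable_cst _)) K.
  have {K} : ae_eq mu setT (EFin \o g) (cst 0%E).
    by apply: K => E _ mE; rewrite H// integral0.
  by apply: filterS => x /= h /h [].
have HT : (\int[mu]_x (g x)%:E = 0)%E.
  apply: (@integral_limit_test _ (fun n => prod_fun (fun _ t =>
    exp_inv 0 (1 * t + n.+1%:R) * exp_inv 0 (-1 * t + n.+1%:R)))) => //.
  - move=> n; apply: (@test_prod_fun _ _ _ n.+1%:R) => i.
        apply: smooth_lineM; apply: smooth_line_affine; exact: smooth_line_exp_inv.
      move=> t; rewrite mulf_eq0 negb_or => /andP[/exp_inv_neq0 t1 /exp_inv_neq0 t2].
      by rewrite ler_norml; apply/andP; split; lra.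
  - move=> n x; rewrite ger0_norm; last by apply: prodr_ge0 => i _; rewrite mulr_ge0 ?exp_inv_ge0.
      by apply: prodr_ile1 => i _; rewrite mulr_ge0 ?exp_inv_ge0//= mulr_ile1 ?exp_inv_ge0 ?exp_inv0_le1.
  - move=> x; rewrite indicT /=.
      rewrite /prod_fun; apply: cvg_prod1 => i; apply: cvgM1;
        apply: (@exp_inv0_cvg1 _ _ 1 (`|x ord0 i|)) => // n.
      * have := ler_norm (- x ord0 i); rewrite normrN -natr1; lra.
      * have := ler_norm (x ord0 i); rewrite -natr1; lra.
rewrite measurable_rV_orthants => mE; move: E mE.
apply: (dynkin_induction measurable_rV_orthants (@setI_closed_orthants R d)) => //.
- move=> _ [a _ <-].
  (* As [n] grows the first factor tends to the indicator of $t > a_i$, being zero for $t \le a_i$;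
     the second bounds the support from above and tends to $1$. *)
  apply: (@integral_limit_test _ (fun n => prod_fun (fun i t =>
    exp_inv 0 (n.+1%:R * t + (- (n.+1%:R * a i))) * exp_inv 0 (-1 * t + n.+1%:R)))).
  + exact: measurable_orthant.
  + move=> n; apply: (@test_prod_fun _ _ _ (\sum_i `|a i| + n.+1%:R)) => i.
      apply: smooth_lineM; apply: smooth_line_affine; exact: smooth_line_exp_inv.
    move=> t; rewrite mulf_eq0 negb_or => /andP[/exp_inv_neq0 t1 /exp_inv_neq0 t2].
    have n0 : 0 < n.+1%:R :> R by rewrite ltr0n.
    rewrite -mulrBr pmulr_rgt0// in t1.
    have ai : `|a i| <= \sum_j `|a j| by rewrite (bigD1 i)//= lerDl sumr_ge0.
    have := ler_norm (- a i); rewrite normrN => ai'.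
    have S0 : 0 <= \sum_j `|a j| by rewrite sumr_ge0.
    by rewrite ler_norml; apply/andP; split; lra.
  + move=> n x; rewrite ger0_norm; last by apply: prodr_ge0 => i _; rewrite mulr_ge0 ?exp_inv_ge0.
    by apply: prodr_ile1 => i _; rewrite mulr_ge0 ?exp_inv_ge0//= mulr_ile1 ?exp_inv_ge0 ?exp_inv0_le1.
  + move=> x; have [xa|xa] := pselect (orthant a x).
      rewrite indicE mem_set//=.
      rewrite /prod_fun; apply: cvg_prod1 => i; apply: cvgM1.
        apply: (@exp_inv0_cvg1 _ _ (x ord0 i - a i) 0) => [|n].
          by rewrite subr_gt0.
        by have := xa i; rewrite -natr1; lra.
      apply: (@exp_inv0_cvg1 _ _ 1 (`|x ord0 i|)) => // n.
      have := ler_norm (x ord0 i); rewrite -natr1; lra.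
    rewrite indicE memNset//=.
    have [i xi] : exists i, x ord0 i <= a i.
      by apply: contrapT => nx; apply: xa => i; rewrite ltNge; apply/negP => ai; apply: nx; exists i.
    rewrite (_ : (fun n => _) = fun=> 0); first exact: cvg_cst.
    apply/funext => n; rewrite /prod_fun (bigD1 i)//= /exp_inv.
    by rewrite -mulrBr pmulr_rgt0 ?ltr0n// subr_gt0 ltNge xi /= !mul0r.
- move=> S mS S0; have := @integral_setU _ _ _ mu S (~` S) (EFin \o g) mS (measurableC mS).
  rewrite setUv HT S0 add0e => <- //; first by apply/measurable_EFinP.
  by rewrite disj_set2E setICr.
- move=> F mF tF F0; rewrite integral_bigcup//.
    by rewrite eseries0.
  by apply: integrableS ig => //; exact: bigcup_measurable.
Qed.

End fundamental_lemma.

(** * Sobolev norms of test functions *)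

Lemma ge0_eq_integral_ae d (T : measurableType d) (R : realType)
    (mu : {measure set T -> \bar R}) (f g : T -> \bar R) :
  (forall x, 0 <= f x)%E -> (forall x, 0 <= g x)%E ->
  {ae mu, forall x, f x = g x} ->
  (\int[mu]_x f x = \int[mu]_x g x)%E.
Proof.
move=> f0 g0 fg; apply/eqP; rewrite eq_le; apply/andP; split;
  by apply: ge0_le_integral_ae => //; apply: filterS fg => x ->.
Qed.

Section norms.
Context {R : realType}.

Lemma sqrt_sum_ge (I : finType) (T : I -> R) i : `|T i| <= Num.sqrt (\sum_j T j ^+ 2).
Proof.
rewrite -sqrtr_sqr ler_wsqrtr// (bigD1 i)//= lerDl.
by apply: sumr_ge0 => j _; exact: sqr_ge0.
Qed.

Lemma sqrt_sum_le (I : finType) (T : I -> R) : Num.sqrt (\sum_j T j ^+ 2) <= \sum_j `|T j|.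
Proof.
have S0 : 0 <= \sum_j `|T j| by rewrite sumr_ge0.
rewrite -[leRHS]ger0_norm// -sqrtr_sqr ler_wsqrtr//.
rewrite [leRHS]expr2 mulr_suml; apply: ler_sum => i _.
rewrite -real_normK ?num_real// expr2 ler_wpM2l//.
by rewrite (bigD1 i)//= lerDl sumr_ge0.
Qed.

Lemma tensor_norm_ge d i (T : i.-tuple 'I_d -> R) s : `|T s| <= tensor_norm T.
Proof. exact: sqrt_sum_ge. Qed.

Lemma tensor_norm_le d i (T : i.-tuple 'I_d -> R) : tensor_norm T <= \sum_s `|T s|.
Proof. exact: sqrt_sum_le. Qed.

Lemma tensor_norm_ge0 d i (T : i.-tuple 'I_d -> R) : 0 <= tensor_norm T.
Proof. exact: sqrtr_ge0. Qed.

Lemma euclidean_norm_ge d (x : 'rV[R]_d) j : `|x ord0 j| <= euclidean_norm x.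
Proof. exact: (sqrt_sum_ge (fun j => x ord0 j)). Qed.

Lemma euclidean_norm_le d (x : 'rV[R]_d) : euclidean_norm x <= \sum_j `|x ord0 j|.
Proof. exact: (sqrt_sum_le (fun j => x ord0 j)). Qed.

End norms.

Section classical_derivatives.
Context {R : realType} {d : nat}.
Local Notation mu := (@lebesgue_rV R d).
Implicit Types (u phi psi : 'rV[R]_d -> R).

(** The reversal is the one produced by [weak_partial_classical]. *)
Definition Dc i phi (x : 'rV[R]_d) (s : i.-tuple 'I_d) : R := iter_partial (rev s) phi x.

Lemma weak_derivative_classical i phi : test_function phi ->
  weak_derivative phi (@Dc i phi).
Proof.
move=> tp s; split; first by apply: test_integrable; exact: test_iter_partial.
exact: weak_partial_classical.
Qed.

Lemma L1_test_integrable u psi : L1 u -> test_function psi ->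
  mu.-integrable setT (EFin \o (fun x => u x * psi x)).
Proof.
move=> iu tp; have [M M0 pM] := test_bounded tp.
have mu_ : measurable_fun setT u by case/integrableP : iu => /measurable_EFinP.
apply: (@le_integrable _ _ _ mu setT measurableT _ (fun x => (M%:E * (u x)%:E)%E)).
- apply/measurable_EFinP; apply: measurable_funM => //; exact: test_measurable.
- by move=> x _; rewrite lee_fin !normrM (ger0_norm M0) mulrC ler_wpM2r.
- exact: integrableZl.
Qed.

(** [Dw] is an arbitrary choice among the weak derivatives. Two of them differ by a function that
    integrates to zero against test functions, hence almost everywhere by zero, and there are
    finitely many index tuples. *)
Lemma Dw_test i phi : test_function phi ->
  {ae mu, forall x, forall s : i.-tuple 'I_d, Dw i phi x s = Dc phi x s}.
Proof.
move=> tp; case: i => [|i].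
  by apply: aeW => x s; rewrite /= /Dc tuple0.
have wV : weak_derivative phi (Dw i.+1 phi).
  by rewrite /Dw; case: xgetP => [V -> //|/(_ (@Dc i.+1 phi)) /(_ (@weak_derivative_classical i.+1 phi tp))].
apply: filter_forall => s.
have [iV pV] := wV s; have [iD pD] := @weak_derivative_classical i.+1 phi tp s.
have ig : mu.-integrable setT (EFin \o (fun x => Dw i.+1 phi x s - Dc phi x s)).
  rewrite (_ : _ \o _ = (EFin \o (Dw i.+1 phi)^~ s) \- (EFin \o (@Dc i.+1 phi)^~ s))%E; last by apply/funext.
  exact: integrableB.
have := @ae_eq0_of_test R d _ ig.
move=> H; have {H} : ae_eq mu setT (fun x => Dw i.+1 phi x s - Dc phi x s) (cst 0).
  apply: H => psi tpsi.
  under eq_Rintegral do rewrite mulrBl.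
  rewrite RintegralB//; [|exact: L1_test_integrable..].
  apply/eqP; rewrite subr_eq0; apply/eqP.
  apply: (@mulfI _ ((-1) ^+ size s)); first by rewrite signr_eq0.
  by rewrite -pV// -pD.
by apply: filterS => x /= /(_ I) /eqP; rewrite subr_eq0 => /eqP.
Qed.

Lemma sobolev_int_test k phi : test_function phi -> sobolev_int k phi.
Proof.
move=> tp; split; first exact: test_integrable.
by move=> i _; exists (@Dc i phi); exact: weak_derivative_classical.
Qed.

Lemma sobolev_int_norm_test k phi : test_function phi ->
  (sobolev_int_norm k phi = \sum_(i < k.+1) \int[mu]_x (tensor_norm (@Dc i phi x))%:E)%E.
Proof.
move=> tp; rewrite /sobolev_int_norm; case: asboolP; last by move=> /(_ (sobolev_int_test k tp)).
move=> _; apply: eq_bigr => i _; apply: ge0_eq_integral_ae.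
- by move=> x; rewrite lee_fin tensor_norm_ge0.
- by move=> x; rewrite lee_fin tensor_norm_ge0.
- apply: filterS (Dw_test i tp) => x H; congr (tensor_norm _)%:E.
  by apply/funext => s.
Qed.

Lemma gagliardo_test k (theta : R) phi : test_function phi ->
  (gagliardo k theta phi = \int[mu]_y \int[mu]_x
     (tensor_norm (fun s : k.-tuple 'I_d => Dc phi x s - Dc phi y s)
      / euclidean_norm (x - y) `^ (theta + d%:R))%:E)%E.
Proof.
move=> tp; have q0 (T : k.-tuple 'I_d -> R) (x : 'rV[R]_d) :
    (0 <= (tensor_norm T / euclidean_norm x `^ (theta + d%:R))%:E)%E.
  by rewrite lee_fin divr_ge0 ?tensor_norm_ge0 ?powR_ge0.
rewrite /gagliardo; apply: ge0_eq_integral_ae.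
- by move=> y; apply: integral_ge0 => x _; exact: q0.
- by move=> y; apply: integral_ge0 => x _; exact: q0.
- apply: filterS (Dw_test k tp) => y Hy; apply: ge0_eq_integral_ae => //.
  apply: filterS (Dw_test k tp) => x Hx; congr (tensor_norm _ / _)%:E.
  by apply/funext => s; rewrite Hx Hy.
Qed.

Lemma sobolev_int_norm_ge0 k phi : (0 <= sobolev_int_norm k phi)%E.
Proof.
rewrite /sobolev_int_norm; case: ifP => // _; apply: sume_ge0 => i _.
by apply: integral_ge0 => x _; rewrite lee_fin tensor_norm_ge0.
Qed.

Lemma gagliardo_ge0 k (theta : R) phi : (0 <= gagliardo k theta phi)%E.
Proof.
apply: integral_ge0 => y _; apply: integral_ge0 => x _.
by rewrite lee_fin divr_ge0 ?tensor_norm_ge0 ?powR_ge0.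
Qed.

Lemma sobolev_norm_ge0 (alpha : R) phi : (0 <= sobolev_norm alpha phi)%E.
Proof.
rewrite /sobolev_norm; case: ifP => _; first exact: sobolev_int_norm_ge0.
by apply: adde_ge0; [exact: sobolev_int_norm_ge0|exact: gagliardo_ge0].
Qed.

Lemma L1_le_sobolev (alpha : R) phi (s : seq 'I_d) : test_function phi ->
  (size s <= Num.truncn alpha)%N ->
  (\int[mu]_x `|iter_partial s phi x|%:E <= sobolev_norm alpha phi)%E.
Proof.
move=> tp sk; set k := Num.truncn alpha in sk.
apply: (@le_trans _ _ (sobolev_int_norm k phi)); last first.
  rewrite /sobolev_norm -/k; case: ifP => // _.
  by rewrite leeDl// gagliardo_ge0.
rewrite sobolev_int_norm_test// (bigD1 (Ordinal (sk : size s < k.+1)%N))//=.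
apply: (@le_trans _ _ (\int[mu]_x (tensor_norm (@Dc (size s) phi x))%:E)%E).
  apply: ge0_le_integralT => [x|x]; rewrite lee_fin//.
  have sz : size (rev s) == size s by rewrite size_rev.
  by have := tensor_norm_ge (@Dc (size s) phi x) (Tuple sz); rewrite /Dc /= revK.
rewrite leeDl// sume_ge0// => i _.
by apply: integral_ge0 => x _; rewrite lee_fin tensor_norm_ge0.
Qed.

Lemma gagliardo_le_sobolev (alpha : R) phi (s : seq 'I_d) : test_function phi ->
  size s = Num.truncn alpha -> alpha - (Num.truncn alpha)%:R != 0 ->
  (\int[mu]_y \int[mu]_x
     (`|iter_partial s phi x - iter_partial s phi y|
      / euclidean_norm (x - y) `^ (alpha - (Num.truncn alpha)%:R + d%:R))%:E
   <= sobolev_norm alpha phi)%E.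
Proof.
move=> tp sk a0; rewrite /sobolev_norm (negbTE a0) gagliardo_test//.
rewrite -sk; apply: le_trans (leeDr _ (sobolev_int_norm_ge0 _ _)).
apply: ge0_le_integralT => y.
  by apply: integral_ge0 => x _; rewrite lee_fin divr_ge0// powR_ge0.
apply: ge0_le_integralT => x; first by rewrite lee_fin divr_ge0// powR_ge0.
rewrite lee_fin ler_wpM2r ?invr_ge0 ?powR_ge0//.
have sz : size (rev s) == size s by rewrite size_rev.
have := tensor_norm_ge (fun s0 : (size s).-tuple 'I_d => Dc phi x s0 - Dc phi y s0) (Tuple sz).
by rewrite /Dc /= revK.
Qed.

End classical_derivatives.

(** * Discrete sums bounded by norms *)

Lemma sum_osc (R : realFieldType) d n q (f : {ffun 'I_d -> 'I_n} -> R) :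
    (0 < q)%N -> (q %| n)%N ->
  \sum_a osc q f a = (q ^ d)%:R^-1 * \sum_y \sum_(z | same q y z) `|f y - f z|.
Proof.
move=> q0 qn; pose F y := \sum_(z | same q y z) `|f y - f z|.
have E a : osc q f a = (q ^ d)%:R^-1 * avg q F a.
  rewrite /osc /avg expr2 -mulrA; congr (_ * (_ * _)).
  by apply: eq_bigr => y ay; apply: eq_bigl => z; rewrite (same_eq ay).
by under eq_bigr do rewrite E; rewrite -mulr_sumr sum_avg.
Qed.

Lemma powR2_gt1 (R : realType) (p : R) : 0 < p -> 1 < 2 `^ p.
Proof.
move=> p0; rewrite lt_neqAle eq_sym powR_eq1 (gt_eqF p0) orbF negb_or.
rewrite -leNgt ler0n pnatr_eq1 /=.
by have := @ler_powR R 2 (ler1n _ _) 0 p (ltW p0); rewrite powRr0.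
Qed.

Lemma side_mesh (R : realType) N j : (j <= N)%N -> (2 ^ (N - j))%:R * @mesh R N = mesh j.
Proof.
move=> jN; have -> : @mesh R N = mesh (N - j) * mesh j by rewrite /mesh -exprD subnK.
by rewrite natrX mulrA mesh_inv mul1r.
Qed.

Section lower_bounds.
Context {R : realType} {d : nat}.
Variables (L : nat).
Local Notation mu := (@lebesgue_rV R d).
Local Notation cell N := {ffun 'I_d -> 'I_(grid_size L N)}.
Local Notation mesh N := (@mesh R N).
Implicit Types (phi : 'rV[R]_d -> R).

Definition sample N phi (a : cell N) : R := phi (corner a).

Lemma grid_dvd N : (2 ^ N %| grid_size L N)%N.
Proof. exact: dvdn_mull. Qed.

Lemma sample_near (B : R) phi N (a : cell N) x : sup_lipschitz B phi -> cell_set a x ->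
  `|phi x - sample phi a| <= B * mesh N.
Proof. by move=> pB ax; apply: pB; exact: (cell_set_near ax (corner_in a)). Qed.

(** Lowered by its Lipschitz error on a cell, the sampled modulus becomes a step function below
    [|phi|]. The constant [A] depends on [phi], which its factor [mesh N] makes harmless. *)
Lemma sample_L1 phi : test_function phi -> exists2 A, 0 <= A &
  forall (B : R) N, (\int[mu]_x `|phi x|%:E <= B%:E)%E ->
    mesh N ^+ d * \sum_(a : cell N) `|sample phi a| <= B + A * mesh N.
Proof.
move=> tp; have [l l0 pl] := test_lipschitz tp.
exists (L.*2%:R ^+ d * l); first by rewrite mulr_ge0// exprn_ge0.
move=> B N HB; pose K (a : cell N) := Num.max (`|sample phi a| - l * mesh N) 0.
have K0 a : 0 <= K a by rewrite le_max lexx orbT.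
have : ((mesh N ^+ d * \sum_a K a)%:E <= B%:E)%E.
  apply: le_trans HB; apply: lower_sum => //.
  apply: aeW => x a ax; rewrite lee_fin ge_max normr_ge0 andbT lerBlDl.
  have := sample_near pl ax; rewrite distrC.
  by have := lerB_dist (sample phi a) (phi x); lra.
rewrite lee_fin => H.
have -> : L.*2%:R ^+ d * l * mesh N = mesh N ^+ d * \sum_(a : cell N) (l * mesh N).
  by rewrite mesh_sum_const mulrA.
rewrite -lerBlDr -mulrBr -sumrB; apply: le_trans H.
rewrite ler_wpM2l ?exprn_ge0 ?(ltW (@mesh_gt0 R N))//.
by apply: ler_sum => a _; rewrite le_max lexx.
Qed.

Definition block_corner N j (a : cell N) : 'rV[R]_d :=
  \row_i ((a i %/ 2 ^ (N - j))%:R * mesh j - L%:R).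

Lemma cell_set_block N j (a b : cell N) x : (j <= N)%N -> same (2 ^ (N - j)) a b ->
  cell_set b x -> cube (block_corner j a) (mesh j) x.
Proof.
move=> jN /sameP ab bx i; rewrite mxE ab.
have q0 : (0 < 2 ^ (N - j))%N by rewrite expn_gt0.
have qh := @side_mesh R N j jN.
set q := (2 ^ (N - j))%N in q0 qh *.
have /andP[x1 x2] := bx i; rewrite !mxE in x1 x2.
have m0 := @mesh_gt0 R N.
have e1 : (b i %/ q * q <= b i)%N by rewrite leq_trunc_div.
have e2 : ((b i).+1 <= b i %/ q * q + q)%N by rewrite -mulSnr -ltnS ltnS ltn_ceil.
have h1 : (b i %/ q * q)%:R * mesh N <= (b i)%:R * mesh N by rewrite ler_pM2r// ler_nat.
have h2 : (b i).+1%:R * mesh N <= (b i %/ q * q + q)%:R * mesh N.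
  by rewrite ler_pM2r// ler_nat.
move: h1 h2; rewrite natrD -natr1 natrM !mulrDl -!mulrA qh mul1r => h1 h2.
by apply/andP; split; lra.
Qed.

Lemma class_near N j (a b : cell N) x y : (j <= N)%N -> same (2 ^ (N - j)) a b ->
  cell_set a x -> cell_set b y -> forall i, `|x ord0 i - y ord0 i| <= mesh j.
Proof.
move=> jN ab ax by_ i.
have /andP[x1 x2] := cell_set_block jN (same_refl _ _) ax i.
have /andP[y1 y2] := cell_set_block jN ab by_ i.
by rewrite ler_norml; apply/andP; split; lra.
Qed.

(** Exchanging the sums, a pair of cells is counted at every generation where they share a cube.
    With $w = 2^\theta$ its total weight is a discrete form of the Gagliardo kernel. *)
Lemma sum_osc_levels N (w : R) (f : cell N -> R) :
  mesh N ^+ d * \sum_(j < N) w ^+ j * \sum_a osc (2 ^ (N - j)) f a =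
  mesh N ^+ d * (mesh N ^+ d * \sum_y \sum_z `|f y - f z| *
    \sum_(j < N | same (2 ^ (N - j)) y z) (w * 2 ^+ d) ^+ j).
Proof.
congr (_ * _).
have E (j : 'I_N) : w ^+ j * \sum_a osc (2 ^ (N - j)) f a =
    mesh N ^+ d * \sum_y \sum_(z | same (2 ^ (N - j)) y z) `|f y - f z| * (w * 2 ^+ d) ^+ j.
  rewrite sum_osc ?expn_gt0//; last exact: (dvdn_trans (dvdn_exp2l _ (leq_subr _ _)) (grid_dvd N)).
  rewrite mulrCA mulr_sumr [in RHS]mulr_sumr [in LHS]mulr_sumr; apply: eq_bigr => y _.
  rewrite -mulr_suml.
  have -> : ((2 ^ (N - j)) ^ d)%:R^-1 = mesh N ^+ d * 2 ^+ d ^+ j :> R.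
    rewrite -exprM mulnC exprM -exprMn natrX -exprVn; congr (_ ^+ d).
    apply: (@mulfI _ (2 ^ (N - j))%:R); first by rewrite pnatr_eq0 expn_eq0.
    rewrite mulfV ?pnatr_eq0 ?expn_eq0// mulrA (side_mesh _ (ltnW (ltn_ord j))).
    by rewrite mulrC mesh_inv.
  by rewrite exprMn; ring.
rewrite (eq_bigr _ (fun j _ => E j)) -mulr_sumr; congr (_ * _).
rewrite exchange_big; apply: eq_bigr => y _.
rewrite (exchange_big_dep xpredT)//=; apply: eq_bigr => z _.
by rewrite mulr_sumr.
Qed.

(** The geometric sum is comparable with its last term, at the finest generation [J] where the two
    cells share a cube, and there the distance of [x] and [y] is at most $d 2^{-J}$. Writing [d.+1]
    keeps the base of the power positive. *)
Lemma kernel_bound N (p : R) (a b : cell N) x y : 0 < p -> a != b ->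
  cell_set a x -> cell_set b y ->
  \sum_(j < N | same (2 ^ (N - j)) a b) (2 `^ p) ^+ j <=
  2 `^ p / (2 `^ p - 1) * d.+1%:R `^ p / euclidean_norm (x - y) `^ p.
Proof.
move=> p0 ab ax by_.
set v := 2 `^ p.
have v1 : 1 < v by apply: powR2_gt1.
have [[j0 jj]|nj] := pselect (exists j : 'I_N, same (2 ^ (N - j)) a b); last first.
  rewrite big_pred0 => [|j]; last by apply/negP => sj; apply: nj; exists j.
  by rewrite divr_ge0 ?powR_ge0// mulr_ge0 ?powR_ge0// divr_ge0 ?powR_ge0// subr_ge0 ltW.
pose J := [arg max_(j > j0 | same (2 ^ (N - j)) a b) (j : nat)]%N.
have [sJ Jmax] : same (2 ^ (N - J)) a b /\ forall j : 'I_N, same (2 ^ (N - j)) a b -> (j <= J)%N.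
  by rewrite /J; case: arg_maxnP.
have v0 : 0 <= v by rewrite (le_trans _ (ltW v1)).
apply: (@le_trans _ _ (v / (v - 1) * v ^+ J)).
  apply: le_trans (sum_pow_le J v1).
  rewrite (big_ord_widen N (fun j => v ^+ j) (ltn_ord J)).
  rewrite big_mkcond [leRHS]big_mkcond; apply: ler_sum => j _.
  case: ifPn => [/Jmax|_]; first by rewrite ltnS => ->.
  by case: ifP => // _; rewrite exprn_ge0.
rewrite -[leRHS]mulrA; apply: ler_wpM2l; first by rewrite divr_ge0// subr_ge0 ltW.
have e0 : 0 < euclidean_norm (x - y).
  rewrite lt_def sqrtr_ge0 andbT; apply/eqP => e0.
  have xy : x = y.
    apply/rowP => i; have := euclidean_norm_ge (x - y) i.
    by rewrite e0 normr_le0 !mxE subr_eq0 => /eqP.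
  by rewrite xy in ax; rewrite (cell_set_inj ax by_) eqxx in ab.
rewrite ler_pdivlMr ?powR_gt0//.
have -> : v ^+ J = (2 ^+ J) `^ p by rewrite -[2 ^+ J]powR_mulrn// -powRrM mulrC powRrM powR_mulrn// powR_ge0.
rewrite -powRM ?exprn_ge0//; last exact: ltW.
rewrite ge0_ler_powR ?nnegrE ?(ltW p0)//; first by rewrite mulr_ge0 ?exprn_ge0// ltW.
rewrite -ler_pdivlMl ?exprn_gt0//.
apply: (le_trans (euclidean_norm_le _)).
apply: (@le_trans _ _ (\sum_(i < d) mesh J)); last first.
  have -> : (2 ^+ J)^-1 = mesh J :> R by rewrite meshE exprVn.
  rewrite sumr_const card_ord mulrC [leRHS]mulr_natl ler_wpMn2l// ltW//.
  exact: mesh_gt0.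
apply: ler_sum => i _; rewrite !mxE.
by apply: class_near sJ ax by_ i; exact: ltnW.
Qed.

(** Lowering the differences of samples by [e], the Lipschitz error of two cells, puts them below
    those of [phi]. What is given up is [e] times the sum of all kernel weights, of order $2^{\theta
    N}$, whence an error of order $2^{-N} 2^{\theta N}$. *)
Lemma sample_gagliardo (theta : R) phi : 0 < theta -> test_function phi ->
  exists2 A, 0 <= A & forall (B : R) N,
    (\int[mu]_y \int[mu]_x
     (`|phi x - phi y| / euclidean_norm (x - y) `^ (theta + d%:R))%:E <= B%:E)%E ->
    mesh N ^+ d * \sum_(j < N) (2 `^ theta) ^+ j *
        \sum_(a : cell N) osc (2 ^ (N - j)) (@sample N phi) a
    <= 2 `^ (theta + d%:R) / (2 `^ (theta + d%:R) - 1) * d.+1%:R `^ (theta + d%:R) * B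
       + A * (mesh N * (2 `^ theta) ^+ N).
Proof.
move=> t0 tp; have [l l0 pl] := test_lipschitz tp.
set p := theta + d%:R; set w := 2 `^ theta; set C := _ / _ * _.
have p0 : 0 < p by rewrite ltr_wpDr.
have w1 : 1 < w by apply: powR2_gt1.
have wd : w * 2 ^+ d = 2 `^ p.
  by rewrite /p powRD ?powR_mulrn//; apply/implyP => _; rewrite pnatr_eq0.
have w10 : 0 <= w / (w - 1) by rewrite divr_ge0 ?powR_ge0// subr_ge0 ltW.
exists (2 * l * L.*2%:R ^+ d * (w / (w - 1))).
  by apply: mulr_ge0 => //; apply: mulr_ge0; [exact: mulr_ge0|exact: exprn_ge0].
move=> B N HB.
pose W (a b : cell N) := \sum_(j < N | same (2 ^ (N - j)) a b) (w * 2 ^+ d) ^+ j.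
have W0 a b : 0 <= W a b.
  by apply: sumr_ge0 => j _; rewrite exprn_ge0// wd powR_ge0.
pose e := 2 * l * mesh N.
have m0 := @mesh_gt0 R N.
have e0 : 0 <= e by apply: mulr_ge0; [exact: mulr_ge0|exact: ltW].
pose K (a b : cell N) := Num.max (`|sample phi a - sample phi b| - e) 0 * W a b.
have K0 a b : 0 <= K a b by rewrite mulr_ge0// le_max lexx orbT.
have v1 : 1 < 2 `^ p by apply: powR2_gt1.
have C0 : 0 <= C by rewrite mulr_ge0 ?powR_ge0// divr_ge0 ?powR_ge0// subr_ge0 ltW.
have Kb a b x y : cell_set a x -> cell_set b y ->
    K a b <= C * (`|phi x - phi y| / euclidean_norm (x - y) `^ p).
  move=> ax by_; have [ab|ab] := eqVneq a b.
    rewrite /K ab subrr normr0 sub0r max_r ?oppr_le0// mul0r.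
    by rewrite mulr_ge0// divr_ge0 ?powR_ge0.
  have := kernel_bound p0 ab ax by_; rewrite -wd -/(W a b) wd -/C => Wb.
  rewrite [leRHS]mulrCA.
  apply: ler_pM => //; first by rewrite le_max lexx orbT.
    rewrite ge_max normr_ge0 andbT.
    have h1 := sample_near pl ax; have h2 := sample_near pl by_.
    have -> : sample phi a - sample phi b =
       (phi x - phi y) - (phi x - sample phi a) + (phi y - sample phi b) by ring.
    have := ler_normD ((phi x - phi y) - (phi x - sample phi a)) (phi y - sample phi b).
    have := ler_normB (phi x - phi y) (phi x - sample phi a).
    by rewrite /e; lra.
have : ((mesh N ^+ d * \sum_b (mesh N ^+ d * \sum_a K a b))%:E <= (C * B)%:E)%E.
  have Cp : 0 < C by rewrite mulr_gt0 ?powR_gt0// divr_gt0 ?powR_gt0// subr_gt0.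
  have -> : mesh N ^+ d * \sum_b (mesh N ^+ d * \sum_a K a b) =
    C * (mesh N ^+ d * \sum_b (mesh N ^+ d * \sum_a (K a b / C))).
    rewrite mulrCA; congr (_ * _); rewrite mulr_sumr; apply: eq_bigr => b _.
    rewrite mulrCA; congr (_ * _); rewrite mulr_sumr; apply: eq_bigr => a _.
    by rewrite mulrC divfK// gt_eqF.
  rewrite lee_fin ler_pM2l// -lee_fin; apply: le_trans HB.
  apply: lower_sum.
  - by move=> b; rewrite mulr_ge0 ?exprn_ge0 ?(ltW m0)// sumr_ge0// => a _; rewrite divr_ge0.
  - by move=> y; apply: integral_ge0 => x _; rewrite lee_fin divr_ge0// powR_ge0.
  apply: aeW => y b by_; apply: lower_sum.
  - by move=> a; rewrite divr_ge0.
  - by move=> x; rewrite lee_fin divr_ge0// powR_ge0.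
  apply: aeW => x a ax; rewrite lee_fin ler_pdivrMr// mulrC; exact: Kb.
rewrite lee_fin => H.
rewrite sum_osc_levels -/(W _ _).
have -> : 2 * l * L.*2%:R ^+ d * (w / (w - 1)) * (mesh N * w ^+ N) =
   e * (L.*2%:R ^+ d * (w / (w - 1) * w ^+ N)) by rewrite /e; ring.
(* A cell shares its cube of generation [j] with $(2^{N-j})^d$ cells, which cancels the factor
   $2^{dj}$ of the weight and leaves $w^j$ per cell. *)
have err : mesh N ^+ d * (mesh N ^+ d * \sum_a \sum_b W a b) <=
    L.*2%:R ^+ d * (w / (w - 1) * w ^+ N).
  have -> : mesh N ^+ d * (mesh N ^+ d * \sum_a \sum_b W a b) =
      mesh N ^+ d * \sum_(a : cell N) \sum_(j < N) w ^+ j.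
    congr (_ * _); rewrite mulr_sumr; apply: eq_bigr => a _.
    rewrite /W (exchange_big_dep xpredT)//= mulr_sumr; apply: eq_bigr => j _.
    rewrite sumr_const card_same; last first.
      exact: (dvdn_trans (dvdn_exp2l _ (leq_subr _ _)) (grid_dvd N)).
    rewrite -[_ *+ _]mulr_natl mulrA natrX -exprMn mulrC [mesh N * _]mulrC.
    rewrite (side_mesh _ (ltnW (ltn_ord j))) exprMn -mulrA -exprM mulnC exprM -exprMn.
    by rewrite mesh_inv expr1n mulr1.
  rewrite mesh_sum_const ler_wpM2l ?exprn_ge0//.
  apply: le_trans (sum_pow_le N w1).
  by rewrite big_ord_recr/= lerDl exprn_ge0 ?powR_ge0.
apply: (@le_trans _ _ (mesh N ^+ d * (mesh N ^+ d * \sum_a \sum_b (K a b + e * W a b)))).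
  rewrite !ler_wpM2l ?exprn_ge0 ?(ltW m0)//.
  apply: ler_sum => a _; apply: ler_sum => b _; rewrite -/(W a b) -mulrDl ler_wpM2r//.
  by rewrite -lerBlDr le_max lexx.
under eq_bigr do rewrite big_split/= -mulr_sumr.
rewrite big_split/= -mulr_sumr !mulrDr; apply: lerD.
  by apply: le_trans H; rewrite exchange_big/= -[X in _ <= _ * X]mulr_sumr.
rewrite [X in _ * X <= _]mulrCA [leLHS]mulrCA; exact: ler_wpM2l.
Qed.

End lower_bounds.

(** * Decomposition of test functions *)

Section decompose_test.
Context {R : realType} {d : nat}.
Local Notation mu := (@lebesgue_rV R d).
Local Notation cell L N := {ffun 'I_d -> 'I_(grid_size L N)}.
Local Notation mesh N := (@mesh R N).
Implicit Types (phi : 'rV[R]_d -> R) (beta B : R).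

(* For [beta = 1] the order [m + beta] is an integer and no seminorm is
   involved; otherwise [m] is its integer part. *)
Definition derivatives_le m beta phi B : Prop :=
  (forall s : seq 'I_d, (size s <= m + (beta == 1%R))%N ->
     (\int[mu]_x `|iter_partial s phi x|%:E <= B%:E)%E) /\
  (beta != 1 -> forall s : seq 'I_d, size s = m ->
     (\int[mu]_y \int[mu]_x
       (`|iter_partial s phi x - iter_partial s phi y|
        / euclidean_norm (x - y) `^ (beta + d%:R))%:E <= B%:E)%E).

Lemma derivatives_leS m beta phi B (k : 'I_d) :
  derivatives_le m.+1 beta phi B -> derivatives_le m beta ('D_(unit_vec k) phi) B.
Proof.
move=> [H1 H2]; split=> [s sm|b1 s sm].
  by rewrite -iter_partial_rcons; apply: H1; rewrite size_rcons.
by rewrite -iter_partial_rcons; apply: H2 => //; rewrite size_rcons sm.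
Qed.

Lemma cvg_mesh_pow (w : R) : 0 <= w < 2 -> (mesh N * w ^+ N) @[N --> \oo] --> (0 : R).
Proof.
move=> /andP[w0 w2].
have -> : (fun N => mesh N * w ^+ N) = (fun N => (2^-1 * w) ^+ N).
  by apply/funext => N; rewrite exprMn.
apply: cvg_expr; rewrite ger0_norm ?mulr_ge0 ?invr_ge0//.
by rewrite mulrC ltr_pdivrMr// mul1r.
Qed.

Lemma cvg0D (u v : nat -> R) : u n @[n --> \oo] --> (0 : R) -> v n @[n --> \oo] --> (0 : R) ->
  (u n + v n) @[n --> \oo] --> (0 : R).
Proof. by move=> u0 v0; have := @cvgD _ _ _ _ _ u v _ _ u0 v0; rewrite addr0; exact. Qed.

Lemma cvg0M (c : R) (u : nat -> R) : u n @[n --> \oo] --> (0 : R) ->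
  (c * u n) @[n --> \oo] --> (0 : R).
Proof.
by move=> u0; have := @cvgM _ _ _ _ (fun=> c) u _ _ (cvg_cst c) u0; rewrite mulr0; exact.
Qed.

Lemma cvg0_sum (I : finType) (u : I -> nat -> R) :
  (forall i, u i n @[n --> \oo] --> (0 : R)) -> (\sum_i u i n) @[n --> \oo] --> (0 : R).
Proof.
move=> u0; elim: (index_enum I) => [|i r IH].
  by under eq_fun do rewrite big_nil; exact: cvg_cst.
by under eq_fun do rewrite big_cons; apply: cvg0D.
Qed.

(** The mean value theorem on an edge, whose intermediate point is within one mesh of the corner. On
    the boundary of the grid the left side is zero. *)
Lemma sample_next (L : nat) phi (k : 'I_d) (l : R) N (a : cell L N) : test_function phi -> 0 <= l ->
    sup_lipschitz l ('D_(unit_vec k) phi) ->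
  2 ^+ N * `|sample phi (next k a) - sample phi a| <=
  `|sample ('D_(unit_vec k) phi) a| + l * mesh N.
Proof.
move=> tp l0 pl; have m0 := @mesh_gt0 R N.
have rhs0 : 0 <= `|sample ('D_(unit_vec k) phi) a| + l * mesh N.
  by rewrite addr_ge0// mulr_ge0// ltW.
have [lt|ge] := ltnP (a k).+1 (grid_size L N); last first.
  rewrite (_ : next k a = a) ?subrr ?normr0 ?mulr0//.
  apply/ffunP => i; rewrite ffunE; case: eqP => // ->.
  by apply/val_inj; rewrite /next_ord val_insubd ltnNge ge.
have -> : sample phi (next k a) = phi (mesh N *: unit_vec k + corner a).
  congr phi; apply/rowP => i; rewrite !mxE eqxx ffunE /=.
  have [->|_] := eqVneq i k; last by rewrite mulr0 add0r.
  by rewrite /next_ord val_insubd lt mulr1 -natr1; ring.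
have [t /andP[t0 tm] ->] := MVT_line (corner a) (fun y => @test_derivable _ _ phi k y tp) (ltW m0).
rewrite normrM (gtr0_norm m0) mulrA mesh_inv mul1r -lerBlDl.
apply: le_trans (lerB_dist _ _) _; apply: le_trans (pl _ _ t _) _; last by rewrite ler_wpM2l.
move=> j; rewrite [_ ord0 j]mxE addrK !mxE eqxx /= normrM ger0_norm//.
by case: eqP => _; rewrite ?normr1 ?mulr1// normr0 mulr0.
Qed.

(** The order of the quantifiers matters: [C] is the same for all functions and boxes, while the
    vanishing error [e] may depend on both, but not on [B]. *)
Lemma decompose_test_frac beta : 0 < beta < 1 -> exists2 C, 0 <= C &
  forall (L : nat) phi, test_function phi -> exists2 e : nat -> R, e n @[n --> \oo] --> (0 : R) &
  forall B, derivatives_le 0 beta phi B -> forall N, exists2 c,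
    decomposes N (fun a : cell L N => `|sample phi a|) c &
    mesh N ^+ d * cost N (2 `^ beta) c <= C * B + e N.
Proof.
move=> /andP[b0 b1].
set C1 := 2 `^ (beta + d%:R) / (2 `^ (beta + d%:R) - 1) * d.+1%:R `^ (beta + d%:R).
have w1 := powR2_gt1 b0.
have C10 : 0 <= C1.
  rewrite mulr_ge0 ?powR_ge0// divr_ge0 ?powR_ge0// subr_ge0 ltW// powR2_gt1//.
  by rewrite ltr_wpDr.
exists (1 + 2 ^+ d * C1); first by rewrite addr_ge0// mulr_ge0// exprn_ge0.
move=> L phi tp; have [A1 A10 H1] := sample_L1 L tp; have [A2 A20 H2] := sample_gagliardo L b0 tp.
exists (fun N => A1 * mesh N + 2 ^+ d * (A2 * (mesh N * (2 `^ beta) ^+ N))).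
  apply: cvg0D; first by apply: cvg0M; exact: mesh_cvg0.
  apply: cvg0M; apply: cvg0M; apply: cvg_mesh_pow; rewrite powR_ge0/=.
  have h : 1 < 2 `^ (1 - beta) :> R by rewrite powR2_gt1// subr_gt0.
  have h2 : 2 `^ beta * 2 `^ (1 - beta) = 2 :> R.
    rewrite -powRD; last by apply/implyP => _; rewrite pnatr_eq0.
    by rewrite addrC subrK powRr1.
  by rewrite -[ltRHS]h2 ltr_pMr// powR_gt0.
move=> B [HB1 HB2] N.
have [c dc cc] := decompose_osc (grid_dvd L N) (@sample R d L N phi) (powR_ge0 2 beta).
exists c => //; have m0 := @mesh_gt0 R N.
apply: le_trans (ler_wpM2l (exprn_ge0 d (ltW m0)) cc) _.
have h1 := H1 B N (HB1 [::] (leq0n _)).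
have h2 := H2 B N (HB2 (negbT (lt_eqF b1)) [::] erefl).
rewrite mulrDr [mesh N ^+ d * (2 ^+ d * _)]mulrCA mulrDl mul1r.
have := ler_wpM2l (exprn_ge0 d (ler0n R 2)) h2; rewrite -/C1 mulrDr mulrA.
by move: h1; lra.
Qed.

Lemma decompose_test_one : exists2 C, 0 <= C &
  forall (L : nat) phi, test_function phi -> exists2 e : nat -> R, e n @[n --> \oo] --> (0 : R) &
  forall B, derivatives_le 0 1 phi B -> forall N, exists2 c,
    decomposes N (fun a : cell L N => `|sample phi a|) c &
    mesh N ^+ d * cost N 2 c <= C * B + e N.
Proof.
exists (2 + 2 ^+ d.+2 * d%:R); first by rewrite addr_ge0// mulr_ge0// exprn_ge0.
move=> L phi tp; have [A A0 H] := sample_L1 L tp.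
have /fin_all_exists2[A' A'0 H'] (k : 'I_d) := sample_L1 L (test_partial k tp).
have /fin_all_exists2[l l0 pl] (k : 'I_d) := test_lipschitz (test_partial k tp).
pose E := \sum_k (A' k + L.*2%:R ^+ d * l k).
exists (fun N => (2 * A + 2 ^+ d.+2 * E) * mesh N).
  by apply: cvg0M; exact: mesh_cvg0.
move=> B [HB1 _] N.
have [c dc cc] := decompose_edges (grid_dvd L N) (@sample R d L N phi).
exists c => //; have m0 := @mesh_gt0 R N.
have md0 : 0 <= mesh N ^+ d by rewrite exprn_ge0// ltW.
apply: le_trans (ler_wpM2l md0 cc) _.
have h1 := H B N (HB1 [::] (leq0n _)).
have h2 : mesh N ^+ d * (2 ^+ N * edge_sum (2 ^ N) xpredT (@sample R d L N phi)) <=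
    d%:R * B + E * mesh N.
  rewrite (_ : d%:R * B = \sum_(k < d) B); last by rewrite sumr_const card_ord mulr_natl.
  rewrite /E mulr_suml -big_split /edge_sum !mulr_sumr; apply: ler_sum => k _ /=.
  apply: (@le_trans _ _ (mesh N ^+ d * \sum_a (`|sample ('D_(unit_vec k) phi) a| + l k * mesh N))).
    rewrite ler_wpM2l// mulr_sumr big_mkcond; apply: ler_sum => a _.
    case: ifP => _; first exact: sample_next.
    by rewrite addr_ge0// mulr_ge0// ltW.
  rewrite big_split mulrDr mesh_sum_const mulrDl addrA mulrA lerD2r.
  by apply: (H' k); apply: (HB1 [:: k]); rewrite eqxx.
have D0 : 0 <= 2 ^+ d.+2 :> R by exact: exprn_ge0.
have := ler_wpM2l D0 h2.
have -> : mesh N ^+ d * (2 * \sum_(a : cell L N) `|sample phi a| +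
    2 ^+ N * 2 ^+ d.+2 * edge_sum (2 ^ N) xpredT (@sample R d L N phi)) =
  2 * (mesh N ^+ d * \sum_(a : cell L N) `|sample phi a|) +
  2 ^+ d.+2 * (mesh N ^+ d * (2 ^+ N * edge_sum (2 ^ N) xpredT (@sample R d L N phi))).
  move: (edge_sum _ _ _) (\sum_(_ | _) _) (2 ^+ d.+2) (2 ^+ N) => *; ring.
have -> : (2 + 2 ^+ d.+2 * d%:R) * B + (2 * A + 2 ^+ d.+2 * E) * mesh N =
  2 * (B + A * mesh N) + 2 ^+ d.+2 * (d%:R * B + E * mesh N).
  move: (2 ^+ d.+2) => *; ring.
by move=> h3; apply: lerD => //; rewrite ler_wpM2l.
Qed.

(** The decompositions of the first partial derivatives are added up and serve as the decomposition
    of the gradient in [decompose_gradient], which doubles the base of the cost, as $2^{m+1+\beta} =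
    2 \cdot 2^{m+\beta}$ asks. *)
Lemma decompose_test_raise m beta : 0 < beta -> 
  (exists2 C, 0 <= C & forall (L : nat) phi, test_function phi ->
    exists2 e : nat -> R, e n @[n --> \oo] --> (0 : R) &
    forall B, derivatives_le m beta phi B -> forall N, exists2 c,
      decomposes N (fun a : cell L N => `|sample phi a|) c &
      mesh N ^+ d * cost N (2 `^ (m%:R + beta)) c <= C * B + e N) ->
  exists2 C, 0 <= C & forall (L : nat) phi, test_function phi ->
    exists2 e : nat -> R, e n @[n --> \oo] --> (0 : R) &
    forall B, derivatives_le m.+1 beta phi B -> forall N, exists2 c,
      decomposes N (fun a : cell L N => `|sample phi a|) c &
      mesh N ^+ d * cost N (2 `^ (m.+1%:R + beta)) c <= C * B + e N.
Proof.
move=> b0 [C C0 IH]; set v : R := 2 `^ (m%:R + beta).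
have v1 : 1 < v by rewrite powR2_gt1// ltr_wpDl.
have vS : 2 `^ (m.+1%:R + beta) = 2 * v.
  have -> : m.+1%:R + beta = 1 + (m%:R + beta) by rewrite -natr1; ring.
  rewrite powRD ?powRr1//.
  by apply/implyP => _; rewrite pnatr_eq0.
set Q := raise_const d v.
have Q0 : 0 <= Q.
  rewrite /Q /raise_const mulr_ge0 ?exprn_ge0// addr_ge0// divr_ge0 ?powR_ge0//.
  by rewrite subr_ge0 ltW.
exists (1 + Q * (d%:R * C)).
  by rewrite addr_ge0//; apply: mulr_ge0 => //; exact: mulr_ge0.
move=> L phi tp; have [A A0 H] := sample_L1 L tp.
have /fin_all_exists2[e e0 He] (k : 'I_d) := IH L _ (test_partial k tp).
have /fin_all_exists2[l l0 pl] (k : 'I_d) := test_lipschitz (test_partial k tp).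
pose l' := \sum_k l k.
have l'0 : 0 <= l' by rewrite sumr_ge0.
exists (fun N => A * mesh N + Q * (\sum_k e k N + L.*2%:R ^+ d * l' * mesh N)).
  apply: cvg0D; first by apply: cvg0M; exact: mesh_cvg0.
  apply: cvg0M; apply: cvg0D; first by apply: cvg0_sum => k; exact: e0.
  by apply: cvg0M; exact: mesh_cvg0.
move=> B HB N; have m0 := @mesh_gt0 R N.
have md0 : 0 <= mesh N ^+ d by rewrite exprn_ge0// ltW.
have /fin_all_exists2[ck dck cck] (k : 'I_d) := He k B (derivatives_leS k HB) N.
(* The error of [sample_next] is constant over the grid, so it goes to generation [0], whose weight
   is $1$. *)
pose c j (a : cell L N) := \sum_k ck k j a + if j == 0%N then l' * mesh N else 0.
have dc : decomposes N (fun a : cell L N => \sum_(k < d)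
    (`|sample ('D_(unit_vec k) phi) a| + l k * mesh N)) c.
  split.
  - move=> j a; rewrite addr_ge0//.
      by apply: sumr_ge0 => k _; have [+ _ _] := dck k; apply.
    by case: ifP => // _; rewrite mulr_ge0// ltW.
  - move=> j a b ab; rewrite /c; congr (_ + _).
    by apply: eq_bigr => k _; have [_ + _] := dck k; apply.
  - move=> a; rewrite big_split/= /c big_split/=; apply: lerD.
      rewrite exchange_big; apply: ler_sum => k _.
      by have [_ _] := dck k; apply.
    by rewrite -mulr_suml big_ord_recl/= lerDl sumr_ge0.
have [||c' dc' cc'] := decompose_gradient (grid_dvd L N) v1 _ _ dc (f := (@sample R d L N phi)).
- by move=> k w _; exact: sample_next.
- by move=> k w; rewrite addr_ge0// mulr_ge0// ltW.
exists c' => //; rewrite vS.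
apply: le_trans (ler_wpM2l md0 cc') _.
have h1 := H B N (HB.1 [::] (leq0n _)).
have costE : cost N v c = \sum_k cost N v (ck k) + \sum_(a : cell L N) (l' * mesh N).
  rewrite /cost exchange_big/=.
  rewrite [X in _ = _ + X](_ : _ =
     \sum_(j < N.+1) v ^+ j * \sum_(a : cell L N) (if j == 0%N :> nat then l' * mesh N else 0)).
    rewrite -big_split/=; apply: eq_bigr => j _; rewrite -mulr_sumr -mulrDr; congr (_ * _).
    by rewrite /c big_split/= exchange_big.
  rewrite big_ord_recl/= expr0 mul1r [X in _ = _ + X]big1 ?addr0// => i _.
  by rewrite big1 ?mulr0.
have h2 : mesh N ^+ d * cost N v c <= d%:R * C * B + (\sum_k e k N + L.*2%:R ^+ d * l' * mesh N).
  rewrite costE mulrDr mesh_sum_const -[_ * l' * _]mulrA addrA lerD2r mulr_sumr.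
  rewrite (_ : d%:R * C * B = \sum_(k < d) (C * B)); last first.
    by rewrite sumr_const card_ord -mulrA mulr_natl.
  by rewrite -big_split/=; apply: ler_sum.
have h3 := ler_wpM2l Q0 h2.
apply: (@le_trans _ _ (mesh N ^+ d * (\sum_(a : cell L N) `|sample phi a|) +
    Q * (mesh N ^+ d * cost N v c))).
  by rewrite mulrDr [X in _ + X <= _]mulrCA.
apply: le_trans (lerD h1 h3) _; rewrite le_eqVlt; apply/orP; left; apply/eqP.
by move: (\sum_k e k N) => *; ring.
Qed.

Lemma decompose_test m beta : 0 < beta <= 1 -> exists2 C, 0 <= C &
  forall (L : nat) phi, test_function phi -> exists2 e : nat -> R, e n @[n --> \oo] --> (0 : R) &
  forall B, derivatives_le m beta phi B -> forall N, exists2 c,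
    decomposes N (fun a : cell L N => `|sample phi a|) c &
    mesh N ^+ d * cost N (2 `^ (m%:R + beta)) c <= C * B + e N.
Proof.
move=> /andP[b0 b1]; elim: m => [|m IH]; last exact: decompose_test_raise.
rewrite add0r; have [->|nb] := eqVneq beta 1.
  by rewrite powRr1//; exact: decompose_test_one.
by apply: decompose_test_frac; rewrite b0 lt_neqAle nb.
Qed.

End decompose_test.

(** * Gagliardo seminorms of sums of bumps *)

Section integral_EFin.
Context d (T : measurableType d) (R : realType) (mu : {measure set T -> \bar R}).
Implicit Types f g : T -> R.

Lemma ge0_integralD_EFin f g : measurable_fun setT f -> measurable_fun setT g ->
  (forall x, 0 <= f x) -> (forall x, 0 <= g x) ->
  (\int[mu]_x (f x + g x)%:E = \int[mu]_x (f x)%:E + \int[mu]_x (g x)%:E)%E.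
Proof.
move=> mf mg f0 g0; under eq_integral do rewrite EFinD.
apply: ge0_integralD => //; first [by move=> x _; rewrite lee_fin | by apply/measurable_EFinP].
Qed.

Lemma ge0_integralM_EFin (c : R) f : measurable_fun setT f -> (forall x, 0 <= f x) ->
  0 <= c -> (\int[mu]_x (c * f x)%:E = c%:E * \int[mu]_x (f x)%:E)%E.
Proof.
move=> mf f0 c0; under eq_integral do rewrite EFinM.
apply: ge0_integralZl_EFin => //; first [by move=> x _; rewrite lee_fin | by apply/measurable_EFinP].
Qed.

Lemma measurable_nneseries_EFin (f : nat -> T -> R) :
  (forall n, measurable_fun setT (f n)) -> (forall n x, 0 <= f n x) ->
  measurable_fun setT (fun x => \sum_(n <oo) (f n x)%:E)%E.
Proof.
move=> mf f0.
have H : measurable_fun setT (fun x => \sum_(n <oo | n \in xpredT) (f n x)%:E)%E.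
  apply: ge0_emeasurable_sum => [n x _ _|n _]; first by rewrite lee_fin.
  by apply/measurable_EFinP.
by apply: eq_measurable_fun H => x _; apply: eq_eseriesl.
Qed.

Lemma integral_sum_nneseries (I : finType) (k : I -> R) (f : I -> nat -> T -> R) :
  (forall i n, measurable_fun setT (f i n)) -> (forall i n x, 0 <= f i n x) ->
  (forall i, 0 <= k i) ->
  (\int[mu]_x \sum_i (k i)%:E * \sum_(n <oo) (f i n x)%:E =
   \sum_i (k i)%:E * \sum_(n <oo) \int[mu]_x (f i n x)%:E)%E.
Proof.
move=> mf f0 k0.
have s0 i x : (0 <= \sum_(n <oo) (f i n x)%:E)%E.
  by apply: nneseries_ge0 => n _ _; rewrite lee_fin.
have ms i := measurable_nneseries_EFin (mf i) (f0 i).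
rewrite ge0_integral_sum//.
- apply: eq_bigr => i _; rewrite ge0_integralZl_EFin//; congr (_ * _)%E.
  rewrite integral_nneseries// => [n|n x _]; last by rewrite lee_fin.
  by apply/measurable_EFinP.
- by move=> i; apply: emeasurable_funM => //; exact: measurable_cst.
- by move=> i x _; apply: mule_ge0; rewrite ?lee_fin.
Qed.

End integral_EFin.

(** * Double integrals over pairs of nearby points *)

Section boxes.
Context {R : realType} {d : nat}.
Local Notation mu := (@lebesgue_rV R d).

Definition cbox (p : 'rV[R]_d) (r : R) : set 'rV[R]_d :=
  [set x | forall i, `[p ord0 i - r, p ord0 i + r]%classic (x ord0 i)].

Lemma cboxP p r x : cbox p r x <-> forall i, `|x ord0 i - p ord0 i| <= r.
Proof.
by split=> H i; have := H i; rewrite /= in_itv /= ler_distl.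
Qed.

Lemma measurable_cbox p r : measurable (cbox p r).
Proof.
apply: (@measurable_box R d (fun i => `[p ord0 i - r, p ord0 i + r]%classic)) => i.
exact: measurable_itv.
Qed.

Lemma lebesgue_cbox p r : 0 <= r -> mu (cbox p r) = ((2 * r) ^+ d)%:E.
Proof.
move=> r0; rewrite /cbox (@lebesgue_rV_box _ _ (fun i => `[p ord0 i - r, p ord0 i + r]%classic)); last first.
  by move=> i; exact: measurable_itv.
rewrite (eq_bigr (fun=> (2 * r)%:E)) => [|i _].
  by rewrite prodEFin prodr_const card_ord.
rewrite lebesgue_measure_itv/= lte_fin; case: ltP => h1.
  by rewrite -EFinB; congr EFin; ring.
by congr EFin; move: h1 r0; lra.
Qed.

(** The boxes of radius [r] about [q] and of radius [l] about [p] meet only if [q] is within [l + r]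
    of [p], and the volume of what they share is at most that of the smaller one. *)
Lemma integral_cbox (p q : 'rV[R]_d) (l r : R) : 0 <= l -> 0 <= r ->
  (\int[mu]_x (\1_(cbox q r) x * (\1_(cbox p l) x + \1_(cbox p l) q))%:E
   <= ((2 * r) ^+ d * \1_(cbox p l) q +
       Num.min ((2 * l) ^+ d) ((2 * r) ^+ d) * \1_(cbox p (l + r)) q)%:E)%E.
Proof.
move=> l0 r0.
have m1 : measurable_fun setT (\1_(cbox q r) : 'rV[R]_d -> R).
  by apply: measurable_indic; exact: measurable_cbox.
have m2 : measurable_fun setT (\1_(cbox p l) : 'rV[R]_d -> R).
  by apply: measurable_indic; exact: measurable_cbox.
under eq_integral do rewrite mulrDr.
rewrite ge0_integralD_EFin; [|exact: measurable_funM|exact: measurable_funM|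
  by move=> x; rewrite mulr_ge0|by move=> x; rewrite mulr_ge0].
rewrite EFinD [leRHS]addeC; apply: leeD; last first.
  under eq_integral do rewrite mulrC.
  rewrite ge0_integralM_EFin//.
  rewrite integral_indic//; last exact: measurable_cbox.
  by rewrite setIT [X in (_ * X <= _)%E]lebesgue_cbox// -EFinM lee_fin mulrC.
have [qp|qp] := pselect (cbox p (l + r) q); last first.
  rewrite indicE memNset// mulr0 (eq_integral (cst 0%E)) ?integral0// => x _.
  rewrite !indicE; have [xq|xq] := boolP (x \in cbox q r); last by rewrite mul0r.
  rewrite memNset ?mulr0// => /cboxP xp; apply: qp; apply/cboxP => i.
  move/set_mem/cboxP : xq => /(_ i) xq; have := xp i.
  have := ler_normD (q ord0 i - x ord0 i) (x ord0 i - p ord0 i).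
  rewrite addrA subrK; rewrite distrC in xq; lra.
rewrite [\1__ q]indicE mem_set// mulr1 EFin_min le_min; apply/andP; split.
- apply: (@le_trans _ _ (\int[mu]_x (\1_(cbox p l) x)%:E)%E).
    apply: ge0_le_integralT => x; rewrite lee_fin ?mulr_ge0//.
    by rewrite !indicE -natrM mulnb ler_nat; case: (_ \in _).
  rewrite integral_indic ?setIT//; last exact: measurable_cbox.
  by rewrite [X in (X <= _)%E]lebesgue_cbox.
- apply: (@le_trans _ _ (\int[mu]_x (\1_(cbox q r) x)%:E)%E).
    apply: ge0_le_integralT => x; rewrite lee_fin ?mulr_ge0//.
    by rewrite !indicE -natrM mulnb ler_nat andbC; case: (_ \in _).
  rewrite integral_indic ?setIT//; last exact: measurable_cbox.
  by rewrite [X in (X <= _)%E]lebesgue_cbox.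
Qed.

(** After integration in [y] the bound is a multiple of $(l r)^d$ whichever of the two radii is
    larger, because $\min(l, r)(l + r) \le 2 l r$; this gives $8^d$ for each of the two terms of
    [integral_cbox]. *)
Lemma double_integral_annuli (T : finType) (p : T -> 'rV[R]_d) (l k : T -> R)
    (a r : T -> nat -> R) :
    (forall t, 0 <= l t) -> (forall t, 0 <= k t) ->
    (forall t n, 0 <= a t n) -> (forall t n, 0 <= r t n) ->
  (\int[mu]_y \int[mu]_x \sum_t (k t)%:E * \sum_(n <oo)
      (a t n * (\1_(cbox y (r t n)) x * (\1_(cbox (p t) (l t)) x + \1_(cbox (p t) (l t)) y)))%:E
   <= \sum_t (k t)%:E * \sum_(n <oo)
      (a t n * (2 * 8 ^+ d * (l t * r t n) ^+ d))%:E)%E.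
Proof.
move=> l0 k0 a0 r0.
have mI q s : measurable_fun setT (\1_(cbox q s) : 'rV[R]_d -> R).
  by apply: measurable_indic; exact: measurable_cbox.
pose h t n (y : 'rV[R]_d) : R := (2 * r t n) ^+ d * \1_(cbox (p t) (l t)) y +
       Num.min ((2 * l t) ^+ d) ((2 * r t n) ^+ d) * \1_(cbox (p t) (l t + r t n)) y.
have min0 t n : 0 <= Num.min ((2 * l t) ^+ d) ((2 * r t n) ^+ d).
  by rewrite le_min !exprn_ge0 ?mulr_ge0.
have h0 t n y : 0 <= h t n y.
  by rewrite addr_ge0// mulr_ge0// exprn_ge0// mulr_ge0.
have mh t n : measurable_fun setT (h t n).
  by apply: measurable_funD; apply: measurable_funM.
have mg y t n : measurable_fun setT (fun x => \1_(cbox y (r t n)) x *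
      (\1_(cbox (p t) (l t)) x + \1_(cbox (p t) (l t)) y) : R).
  by apply: measurable_funM => //; exact: measurable_funD.
have g0 y t n x : 0 <= \1_(cbox y (r t n)) x *
      (\1_(cbox (p t) (l t)) x + \1_(cbox (p t) (l t)) y) :> R.
  by rewrite mulr_ge0// addr_ge0.
apply: (@le_trans _ _ (\int[mu]_y \sum_t (k t)%:E * \sum_(n <oo) (a t n * h t n y)%:E)%E).
  apply: ge0_le_integralT => y.
    apply: integral_ge0 => x _; apply: sume_ge0 => t _; apply: mule_ge0; first by rewrite lee_fin.
    by apply: nneseries_ge0 => n _ _; rewrite lee_fin mulr_ge0.
  rewrite integral_sum_nneseries//; last 2 first.
  - by move=> t n; exact: measurable_funM.
  - by move=> t n x; rewrite mulr_ge0.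
  apply: lee_sum => t _; apply: lee_wpmul2l; first by rewrite lee_fin.
  apply: lee_nneseries => [n _ _|n _].
    by apply: integral_ge0 => x _; rewrite lee_fin mulr_ge0.
  rewrite ge0_integralM_EFin// EFinM.
  by apply: lee_wpmul2l; [rewrite lee_fin|exact: integral_cbox].
rewrite integral_sum_nneseries//; last 2 first.
- by move=> t n; exact: measurable_funM.
- by move=> t n x; rewrite mulr_ge0.
apply: lee_sum => t _; apply: lee_wpmul2l; first by rewrite lee_fin.
apply: lee_nneseries => [n _ _|n _].
  by apply: integral_ge0 => x _; rewrite lee_fin mulr_ge0.
rewrite ge0_integralM_EFin// EFinM; apply: lee_wpmul2l; first by rewrite lee_fin.
have c0 c s : 0 <= s -> 0 <= c -> 0 <= (2 * c) ^+ d by move=> *; rewrite exprn_ge0// mulr_ge0.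
rewrite ge0_integralD_EFin; [|exact: measurable_funM|exact: measurable_funM|
  by move=> x; rewrite mulr_ge0// exprn_ge0// mulr_ge0|by move=> x; rewrite mulr_ge0].
have intI c q s : 0 <= c -> 0 <= s ->
    (\int[mu]_x (c * \1_(cbox q s) x)%:E = (c * (2 * s) ^+ d)%:E)%E.
  move=> cc0 s0; rewrite ge0_integralM_EFin//.
  rewrite integral_indic ?setIT//; last exact: measurable_cbox.
  by rewrite [X in (_ * X)%E]lebesgue_cbox// -EFinM.
rewrite !intI ?addr_ge0 ?exprn_ge0 ?mulr_ge0// -EFinD lee_fin.
have lr0 : 0 <= (l t * r t n) ^+ d by rewrite exprn_ge0// mulr_ge0.
have l0t := l0 t; have r0t := r0 t n.
have pw (u v : R) : 0 <= u -> u <= v -> u ^+ d <= v ^+ d.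
  by move=> u0 uv; apply: lerXn2r => //; rewrite nnegrE// (le_trans u0).
have e1 : (2 * r t n) ^+ d * (2 * l t) ^+ d <= 8 ^+ d * (l t * r t n) ^+ d.
  by rewrite -!exprMn; apply: pw; nra.
have e2 : Num.min ((2 * l t) ^+ d) ((2 * r t n) ^+ d) * (2 * (l t + r t n)) ^+ d
    <= 8 ^+ d * (l t * r t n) ^+ d.
  have [lr|rl] := leP (l t) (r t n).
    apply: (@le_trans _ _ ((2 * l t) ^+ d * (2 * (l t + r t n)) ^+ d)).
      by rewrite ler_wpM2r ?exprn_ge0 ?mulr_ge0 ?addr_ge0// ge_min lexx.
    by rewrite -!exprMn; apply: pw; nra.
  apply: (@le_trans _ _ ((2 * r t n) ^+ d * (2 * (l t + r t n)) ^+ d)).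
    by rewrite ler_wpM2r ?exprn_ge0 ?mulr_ge0 ?addr_ge0// ge_min lexx orbT.
  by rewrite -!exprMn; apply: pw; nra.
by lra.
Qed.

Lemma eseries_geometric_le (a : nat -> R) (C q : R) : 0 <= C -> 0 <= q < 1 ->
  (forall n, 0 <= a n) -> (forall n, a n <= C * q ^+ n) ->
  (\sum_(n <oo) (a n)%:E <= (C / (1 - q))%:E)%E.
Proof.
move=> C0 /andP[q0 q1] a0 aC; apply: lime_le.
  by apply: is_cvg_nneseries => n _ _; rewrite lee_fin.
apply: nearW => N; rewrite sumEFin lee_fin.
apply: (@le_trans _ _ (\sum_(0 <= n < N) C * q ^+ n)); first by apply: ler_sum.
rewrite -mulr_sumr ler_wpM2l// big_mkord.
have q10 : 1 - q != 0 by rewrite subr_eq0 gt_eqF.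
rewrite -[leRHS]mul1r ler_pdivlMr ?subr_gt0// [leLHS]mulrC.
have -> : (1 - q) * \sum_(i < N) q ^+ i = 1 - q ^+ N.
  by rewrite -[LHS]opprK -mulNr opprB -subrX1 opprB.
by rewrite gerBl exprn_ge0.
Qed.

End boxes.

Lemma sum_pair_bool (R : realType) (I : finType) (G : I * bool -> \bar R) :
  (\sum_t G t = \sum_i (G (i, true) + G (i, false)))%E.
Proof.
transitivity (\sum_i \sum_b G (i, b))%E; first by rewrite pair_big; apply: eq_bigr => -[].
by apply: eq_bigr => i _; rewrite big_bool.
Qed.

(** * The Gagliardo seminorm of bumps by dyadic annuli *)

Section gagliardo_bound.
Context {R : realType} {d : nat}.
Local Notation mu := (@lebesgue_rV R d).
Variable theta : R.
Hypotheses (t0 : 0 < theta) (t1 : theta < 1).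
Local Notation p := (theta + d%:R).
Local Notation v := (2 `^ p).
Implicit Types (x y P : 'rV[R]_d) (l : R) (n : nat).

Let p0 : 0 < p. Proof. by rewrite ltr_wpDr. Qed.
Let v1 : 1 < v. Proof. exact: powR2_gt1. Qed.
Let v0 : 0 < v. Proof. by rewrite (lt_trans _ v1). Qed.

(** With [annuli_radius], these dominate $\min(1, r/l) / r^p$, for $r$ the sup distance, by a series
    of indicators of boxes. For [b] true, $2^n l \le r < 2^{n+1} l$ and the coefficient is $(2^n
    l)^{-p}$. For [b] false, $2^{-n-1} l < r \le 2^{-n} l$ and the coefficient is $2^{-n} (2^{-n-1}
    l)^{-p}$. *)
Definition annuli_coef (b : bool) l n : R :=
  (l `^ p)^-1 * (if b then v^-1 ^+ n else 2^-1 ^+ n * v ^+ n.+1).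

Definition annuli_radius (b : bool) l n : R :=
  (if b then 2 ^+ n.+1 else 2^-1 ^+ n) * l.

Lemma annuli_coef_ge0 b l n : 0 <= annuli_coef b l n.
Proof.
rewrite mulr_ge0 ?invr_ge0 ?powR_ge0//; case: b; first by rewrite exprn_ge0// invr_ge0 ltW.
by rewrite mulr_ge0 ?exprn_ge0 ?invr_ge0// ltW.
Qed.

Lemma annuli_radius_ge0 b l n : 0 <= l -> 0 <= annuli_radius b l n.
Proof. by move=> l0; rewrite mulr_ge0//; case: b; rewrite exprn_ge0// invr_ge0. Qed.

Lemma pow2_between (z : R) : 1 <= z -> exists n, 2 ^+ n <= z < 2 ^+ n.+1.
Proof.
move=> z1; have z0 : 0 <= z by rewrite (le_trans _ z1).
have t0' : (0 < Num.truncn z)%N by rewrite truncn_gt0.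
have /andP[n1 n2] := trunc_log_bounds (isT : 1 < 2)%N t0'.
have /andP[z2 z3] := truncn_itv z0.
exists (trunc_log 2 (Num.truncn z)); apply/andP; split.
  by apply: le_trans z2; rewrite -natrX ler_nat.
by apply: (lt_le_trans z3); rewrite -natrX ler_nat.
Qed.

Lemma powR_pow2 n (r : R) : 0 <= r -> (2 ^+ n * r) `^ p = v ^+ n * r `^ p.
Proof.
move=> r0; rewrite powRM ?exprn_ge0//; congr (_ * _).
by rewrite -[2 ^+ n]powR_mulrn// -powRrM mulrC powRrM powR_mulrn// powR_ge0.
Qed.

Lemma annuli_cover x y l : 0 < l -> x != y -> exists b n,
  cbox y (annuli_radius b l n) x /\
  Num.min 1 (`|x - y| / l) / euclidean_norm (x - y) `^ p <= annuli_coef b l n.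
Proof.
move=> l0 xy; set r := `|x - y|.
have r0 : 0 < r by rewrite normr_gt0 subr_eq0.
have re : r <= euclidean_norm (x - y).
  rewrite /r /Num.Def.normr/= mx_normrE; apply/bigmax_leP; split; first exact: sqrtr_ge0.
  by move=> [i j] _ /=; rewrite (ord1 i); exact: euclidean_norm_ge.
have rp : r `^ p <= euclidean_norm (x - y) `^ p.
  by apply: ge0_ler_powR => //; rewrite ?nnegrE ?sqrtr_ge0 ?ltW.
have rp0 : 0 < r `^ p by exact: powR_gt0.
have lp0 : 0 < l `^ p by exact: powR_gt0.
have box_r s : r <= s -> cbox y s x.
  move=> rs; apply/cboxP => i; apply: le_trans rs.
  by have := le_coord_norm (x - y) i; rewrite !mxE.
have red m c : 0 <= m -> m / r `^ p <= c -> m / euclidean_norm (x - y) `^ p <= c.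
  move=> m_ge0; apply: le_trans; rewrite ler_wpM2l// lef_pV2// posrE//.
  exact: lt_le_trans rp.
have min0 : 0 <= Num.min 1 (r / l) by rewrite le_min ler01 divr_ge0// ltW.
have [lr|rl] := leP l r.
  have [n /andP[n1 n2]] : exists n, 2 ^+ n <= r / l < 2 ^+ n.+1.
    by apply: pow2_between; rewrite ler_pdivlMr// mul1r.
  rewrite ler_pdivlMr// in n1; rewrite ltr_pdivrMr// in n2.
  exists true, n; split; first by apply: box_r; exact: ltW.
  apply: red => //; apply: (@le_trans _ _ (1 / r `^ p)).
    by rewrite ler_wpM2r ?invr_ge0 ?powR_ge0// ge_min lexx.
  rewrite div1r /annuli_coef exprVn -invfM lef_pV2 ?posrE// ?mulr_gt0 ?exprn_gt0//.
  rewrite mulrC -powR_pow2 ?(ltW l0)//; apply: ge0_ler_powR => //; rewrite ?nnegrE ?ltW//.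
  by rewrite mulr_gt0 ?exprn_gt0.
have [n /andP[n1 n2]] : exists n, 2 ^+ n <= l / r < 2 ^+ n.+1.
  by apply: pow2_between; rewrite ler_pdivlMr// mul1r ltW.
rewrite ler_pdivlMr// in n1; rewrite ltr_pdivrMr// in n2.
have rn : r <= 2^-1 ^+ n * l by rewrite exprVn ler_pdivlMl ?exprn_gt0.
exists false, n; split; first exact: box_r.
apply: red => //; rewrite /annuli_coef mulrCA; apply: ler_pM => //.
- by rewrite invr_ge0 powR_ge0.
- by rewrite ge_min ler_pdivrMr// rn orbT.
rewrite -ler_pdivrMr// ?exprn_gt0//.
rewrite -invfM lef_pV2 ?posrE ?mulr_gt0 ?exprn_gt0//.
rewrite mulrC -powR_pow2 ?(ltW r0)//; apply: ge0_ler_powR => //; rewrite ?nnegrE ?ltW//.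
by rewrite mulr_gt0 ?exprn_gt0.
Qed.

Definition annuli_sum P l y x (b : bool) : \bar R := (\sum_(n <oo)
      (annuli_coef b l n * (\1_(cbox y (annuli_radius b l n)) x *
        (\1_(cbox P (2 * l)) x + \1_(cbox P (2 * l)) y)))%:E)%E.

Lemma annuli_sum_ge0 P l y x b : (0 <= annuli_sum P l y x b)%E.
Proof.
apply: nneseries_ge0 => n _ _; rewrite lee_fin; apply: mulr_ge0.
  exact: annuli_coef_ge0.
by rewrite mulr_ge0// addr_ge0.
Qed.

(** Far increments are bounded through the size of [F] and near ones through its Lipschitz constant,
    whence $\min(1, r/l)$. The factor [S] counts how many of the two points lie in the box outside
    which [F] vanishes: it is zero or at least one, so it may multiply the Lipschitz bound too. *)
Lemma annuli_pointwise (F : 'rV[R]_d -> R) P l (M : R) x y : 0 < l -> 0 <= M ->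
  (forall z, `|F z| <= M * \1_(cbox P (2 * l)) z) -> sup_lipschitz (M / l) F ->
  ((`|F x - F y| / euclidean_norm (x - y) `^ p)%:E <=
   M%:E * annuli_sum P l y x true + M%:E * annuli_sum P l y x false)%E.
Proof.
move=> l0 M0 FM Fl.
have ser0 b : (0 <= M%:E * annuli_sum P l y x b)%E.
  by apply: mule_ge0; [rewrite lee_fin|exact: annuli_sum_ge0].
set S : R := \1_(cbox P (2 * l)) x + \1_(cbox P (2 * l)) y.
have S0 : 0 <= S by rewrite addr_ge0.
have [xy|xy] := eqVneq x y.
  by rewrite {1 2}xy subrr normr0 mul0r; apply: adde_ge0.
have FS : `|F x - F y| <= M * Num.min 1 (`|x - y| / l) * S.
  have h1 : `|F x - F y| <= M * S.
    apply: (le_trans (ler_normB _ _)); rewrite /S mulrDr.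
    by apply: lerD; exact: FM.
  have h2 : `|F x - F y| <= M * (`|x - y| / l).
    rewrite mulrA mulrAC; apply: Fl => i.
    by have := le_coord_norm (x - y) i; rewrite !mxE.
  have [S1|S1] : S = 0 \/ 1 <= S.
    rewrite /S !indicE; case: (x \in _); case: (y \in _) => /=; rewrite ?addr0 ?add0r;
      by [left|right; rewrite ?lerDl].
  - by move: h1; rewrite S1 !mulr0.
  - rewrite -mulrA minr_pMl// mul1r minr_pMr// le_min h1 /=.
    apply: (le_trans h2); rewrite ler_wpM2l// ler_peMr//.
    by apply: divr_ge0 => //; exact: ltW.
have [b [n [bx bc]]] := annuli_cover l0 xy.
apply: (@le_trans _ _ (M%:E * annuli_sum P l y x b)%E); last first.
  by case: (b); [exact: leeDl|exact: leeDr].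
apply: (@le_trans _ _ (M%:E * (annuli_coef b l n * (\1_(cbox y (annuli_radius b l n)) x * S))%:E)%E).
  rewrite -EFinM lee_fin [\1_(cbox y _) x]indicE mem_set// mul1r.
  apply: (@le_trans _ _ (M * Num.min 1 (`|x - y| / l) * S / euclidean_norm (x - y) `^ p)).
    by rewrite ler_wpM2r// invr_ge0 powR_ge0.
  rewrite mulrAC mulrA ler_wpM2r// -mulrA ler_wpM2l//.
apply: lee_wpmul2l; first by rewrite lee_fin.
apply: le_trans (nneseries_lim_ge n.+1 _) => //.
rewrite big_nat_recr//= leeDr//; apply: sume_ge0 => i _.
  rewrite lee_fin; apply: mulr_ge0; [exact: annuli_coef_ge0|exact: mulr_ge0].
move=> i _ _; rewrite lee_fin; apply: mulr_ge0; [exact: annuli_coef_ge0|].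
by rewrite mulr_ge0// addr_ge0.
Qed.

(** The volume factor turns the ratio of the far series into $2^{-\theta}$ and that of the near
    series into $2^{\theta - 1}$: they converge because $\theta > 0$ and $\theta < 1$
    respectively. *)
Lemma annuli_series b l : 0 < l ->
  (\sum_(n <oo) (annuli_coef b l n * (2 * 8 ^+ d * (2 * l * annuli_radius b l n) ^+ d))%:E
   <= ((2 * 8 ^+ d * 2 ^+ d * (2 ^+ d + v) *
        ((1 - 2 `^ (- theta))^-1 + (1 - 2 `^ (theta - 1))^-1))
       * (l ^+ d * (l^-1 `^ theta)))%:E)%E.
Proof.
move=> l0; set D := 2 * 8 ^+ d * 2 ^+ d.
have D0 : 0 <= D by rewrite !mulr_ge0// exprn_ge0.
have two0 : (2 : R) != 0 by rewrite pnatr_eq0.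
have pw_lt1 (s : R) : 0 < s -> 0 <= (2 : R) `^ (- s) < 1.
  by move=> s0; rewrite powR_ge0 powRN invf_lt1 ?powR_gt0// powR2_gt1.
have q1 := pw_lt1 _ t0.
have q2 : 0 <= (2 : R) `^ (theta - 1) < 1 by rewrite -opprB pw_lt1// subr_gt0.
have vE : v = 2 `^ theta * 2 ^+ d by rewrite powRD ?powR_mulrn//; apply/implyP.
have lE : (l `^ p)^-1 = (l^-1 `^ theta) / l ^+ d.
  rewrite powRD; last by apply/implyP => _; rewrite gt_eqF.
  rewrite powR_mulrn ?(ltW l0)// invfM; congr (_ / _).
  by rewrite -powR_inv1 ?(ltW l0)// -powRrM mulN1r powRN.
have ld0 : l ^+ d != 0 by rewrite expf_neq0// gt_eqF.
set U := l ^+ d * l^-1 `^ theta.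
have U0 : 0 <= U by rewrite mulr_ge0 ?exprn_ge0 ?powR_ge0// ltW.
have g1 : 0 <= (1 - 2 `^ (- theta))^-1 by rewrite invr_ge0 subr_ge0; case/andP : q1 => _ /ltW.
have g2 : 0 <= (1 - 2 `^ (theta - 1))^-1 by rewrite invr_ge0 subr_ge0; case/andP : q2 => _ /ltW.
have d0 : 0 <= 2 ^+ d :> R by rewrite exprn_ge0.
have tn0 n : 0 <= annuli_coef b l n * (2 * 8 ^+ d * (2 * l * annuli_radius b l n) ^+ d).
  rewrite mulr_ge0 ?annuli_coef_ge0// mulr_ge0 ?mulr_ge0 ?exprn_ge0//.
  by rewrite mulr_ge0 ?annuli_radius_ge0 ?mulr_ge0// ltW.
have fin (a b' u k1 k2 : R) : 0 <= a -> 0 <= b' -> 0 <= u -> 0 <= k1 -> 0 <= k2 ->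
    D * a * u * k1 <= D * (a + b') * (k1 + k2) * u /\
    D * b' * u * k2 <= D * (a + b') * (k1 + k2) * u.
  move=> a0 b0 u0 k10 k20; have w0 : 0 <= D * u by exact: mulr_ge0.
  have := mulr_ge0 w0 (mulr_ge0 a0 k20); have := mulr_ge0 w0 (mulr_ge0 b0 k10).
  have := mulr_ge0 w0 (mulr_ge0 b0 k20); have := mulr_ge0 w0 (mulr_ge0 a0 k10).
  by move=> h1 h2 h3 h4; split; lra.
case: b tn0 => tn0.
- apply: le_trans (@eseries_geometric_le R _ (D * 2 ^+ d * U) (2 `^ (- theta)) _ q1 tn0 _) _.
  + by apply: mulr_ge0 => //; exact: mulr_ge0.
  + move=> n; rewrite le_eqVlt; apply/orP; left; apply/eqP.
    rewrite /annuli_coef /annuli_radius lE vE !exprMn exprVn exprMn powRN !exprVn /D /U.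
    rewrite exprS !exprMn [(2 ^+ n) ^+ d]exprAC.
    by field; rewrite ld0 !expf_neq0// gt_eqF// powR_gt0.
  + by rewrite lee_fin; apply: (fin _ _ _ _ _ d0 (ltW v0) U0 g1 g2).1.
- apply: le_trans (@eseries_geometric_le R _ (D * v * U) (2 `^ (theta - 1)) _ q2 tn0 _) _.
  + by apply: mulr_ge0 => //; apply: mulr_ge0 => //; exact: ltW.
  + move=> n; rewrite le_eqVlt; apply/orP; left; apply/eqP.
    have -> : 2 `^ (theta - 1) = 2 `^ theta / 2 :> R.
      by rewrite powRD ?powR_inv1//; apply/implyP.
    rewrite /annuli_coef /annuli_radius lE exprS !vE !exprMn !exprVn /D /U.
    rewrite ![(_ ^+ n) ^+ d]exprAC.
    by field; rewrite ld0 !expf_neq0.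
  + by rewrite lee_fin; apply: (fin _ _ _ _ _ d0 (ltW v0) U0 g1 g2).2.
Qed.

Definition gagliardo_const : R := 2 * (2 * 8 ^+ d * 2 ^+ d * (2 ^+ d + v) *
        ((1 - 2 `^ (- theta))^-1 + (1 - 2 `^ (theta - 1))^-1)).

(** [u] stands for the tensor norm of the increment of the derivatives of order $k$ of a sum of
    bumps, and [I] for the pairs of an index tuple and a bump. *)
Lemma gagliardo_family (I : finType) (F : I -> 'rV[R]_d -> R) (P : I -> 'rV[R]_d)
    (l M c : I -> R) (u : 'rV[R]_d -> 'rV[R]_d -> R) :
    (forall i, 0 < l i) -> (forall i, 0 <= M i) -> (forall i, 0 <= c i) ->
    (forall i z, `|F i z| <= M i * \1_(cbox (P i) (2 * l i)) z) ->
    (forall i, sup_lipschitz (M i / l i) (F i)) ->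
    (forall x y, 0 <= u x y <= \sum_i c i * `|F i x - F i y|) ->
  (\int[mu]_y \int[mu]_x (u x y / euclidean_norm (x - y) `^ p)%:E <=
   (gagliardo_const * \sum_i c i * M i * (l i ^+ d * ((l i)^-1 `^ theta)))%:E)%E.
Proof.
move=> l0 M0 c0 FM Fl uF.
apply: (@le_trans _ _ (\int[mu]_y \int[mu]_x \sum_t (c (t : I * bool).1 * M t.1)%:E *
   annuli_sum (P t.1) (l t.1) y x t.2)%E).
  have u0 x y : (0 <= (u x y / euclidean_norm (x - y) `^ p)%:E)%E.
    by rewrite lee_fin divr_ge0 ?powR_ge0//; case/andP : (uF x y).
  apply: ge0_le_integralT => y; first by apply: integral_ge0 => x _; exact: u0.
  apply: ge0_le_integralT => x; first exact: u0.
  apply: (@le_trans _ _ (\sum_i (c i)%:E * (`|F i x - F i y| / euclidean_norm (x - y) `^ p)%:E)%E).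
    under eq_bigr do rewrite -EFinM; rewrite sumEFin lee_fin.
    under eq_bigr do rewrite mulrA; rewrite -mulr_suml ler_wpM2r ?invr_ge0 ?powR_ge0//.
    by case/andP : (uF x y).
  rewrite sum_pair_bool; apply: lee_sum => i _ /=.
  apply: le_trans (lee_wpmul2l _ (annuli_pointwise x y (l0 i) (M0 i) (FM i) (Fl i))) _.
    by rewrite lee_fin.
  rewrite ge0_muleDr; last 2 first.
  - by apply: mule_ge0; [rewrite lee_fin|exact: annuli_sum_ge0].
  - by apply: mule_ge0; [rewrite lee_fin|exact: annuli_sum_ge0].
  by rewrite !muleA -!EFinM.
apply: le_trans.
  apply: double_integral_annuli => [t|t|t n|t n].
  - by rewrite mulr_ge0// ltW.
  - by rewrite mulr_ge0.
  - exact: annuli_coef_ge0.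
  - by apply: annuli_radius_ge0; exact: ltW.
rewrite sum_pair_bool mulr_sumr -sumEFin; apply: lee_sum => i _ /=.
set A := (\sum_(n <oo) _)%E; set B := (\sum_(n <oo) _)%E.
have HA := annuli_series true (l0 i); have HB := annuli_series false (l0 i).
have cM0 : (0 <= (c i * M i)%:E)%E by rewrite lee_fin mulr_ge0.
apply: le_trans (leeD (lee_wpmul2l cM0 HA) (lee_wpmul2l cM0 HB)) _.
rewrite -!EFinM -EFinD lee_fin le_eqVlt; apply/orP; left; apply/eqP.
rewrite /gagliardo_const; move: (2 * 8 ^+ d * _) => *; ring.
Qed.

End gagliardo_bound.

(** * Sobolev norms of sums of bumps *)

Section bump.
Context {R : realType} {d : nat}.
Local Notation mu := (@lebesgue_rV R d).
Implicit Types (x y p : 'rV[R]_d) (l : R) (s : seq 'I_d).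

(** For $0 \le t \le 1$ both arguments are at least $1$, so each factor is at least $e^{-1}$ and the
    constant lifts the product to at least $2$. A value above $1$ leaves room for the strict
    inequality in the definition of capacity. *)
Definition bump_line (t : R) : R :=
  2 * expR 2 * (exp_inv 0 (1 * t + 1) * exp_inv 0 (-1 * t + 2)).

Definition unit_bump x : R := prod_fun (fun _ : 'I_d => bump_line) x.

Lemma bump_line_ge0 t : 0 <= bump_line t.
Proof. by rewrite !mulr_ge0 ?exp_inv_ge0 ?expR_ge0. Qed.

Lemma bump_line_ge2 t : 0 <= t <= 1 -> 2 <= bump_line t.
Proof.
move=> /andP[t0 t1].
have e1 u : 1 <= u -> expR (-1) <= exp_inv 0 u.
  move=> u1; have u0 : 0 < u by rewrite (lt_le_trans _ u1).
  by rewrite /exp_inv u0 expr0 mulr1 ler_expR lerN2 invf_le1.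
have h1 : expR (-1) <= exp_inv 0 (1 * t + 1) by apply: e1; lra.
have h2 : expR (-1) <= exp_inv 0 (-1 * t + 2) by apply: e1; lra.
have := ler_pM (expR_ge0 _) (expR_ge0 _) h1 h2.
rewrite -expRD => h3; rewrite /bump_line -mulrA ler_peMr//.
apply: le_trans (ler_wpM2l (expR_ge0 2) h3); rewrite -expRD.
by rewrite (_ : 2 + (-1 + -1) = 0 :> R) ?expR0//; ring.
Qed.

Lemma bump_line_support t : bump_line t != 0 -> `|t| <= 2.
Proof.
rewrite /bump_line !mulf_eq0 !negb_or => /andP[_ /andP[/exp_inv_neq0 t1 /exp_inv_neq0 t2]].
by rewrite ler_norml; apply/andP; split; lra.
Qed.

Lemma smooth_bump_line : smooth_line bump_line.
Proof.
apply: smooth_lineZ; apply: smooth_lineM; apply: smooth_line_affine;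
  exact: smooth_line_exp_inv.
Qed.

Lemma test_unit_bump : test_function unit_bump.
Proof.
apply: (@test_prod_fun _ _ _ 2) => i; first exact: smooth_bump_line.
exact: bump_line_support.
Qed.

Lemma unit_bump_support s x : iter_partial s unit_bump x != 0 -> forall j, `|x ord0 j| <= 2.
Proof.
apply: closed_box_iter_partial => {}x.
rewrite /unit_bump /prod_fun prodf_seq_neq0 => /allP H i.
by apply: bump_line_support; apply: H; rewrite mem_index_enum.
Qed.

Hypothesis d_gt0 : (0 < d)%N.

Lemma sup_lipschitz_le (B B' : R) (f : 'rV[R]_d -> R) : B <= B' ->
  sup_lipschitz B f -> sup_lipschitz B' f.
Proof.
move=> BB fB x y h xyh; apply: (le_trans (fB x y h xyh)); rewrite ler_wpM2r//.
exact: le_trans (xyh (Ordinal d_gt0)).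
Qed.

Lemma test_uniform_bound k (f : 'rV[R]_d -> R) : test_function f -> exists2 M, 0 <= M &
  forall s, (size s <= k)%N ->
    (forall x, `|iter_partial s f x| <= M) /\ sup_lipschitz M (iter_partial s f).
Proof.
elim: k f => [|k IH] f tf; have [A A0 fA] := test_bounded tf;
    have [B B0 fB] := test_lipschitz tf.
  exists (A + B); first exact: addr_ge0.
  move=> [|//] _; split=> [x|] /=; first by apply: (le_trans (fA x)); rewrite lerDl.
  by apply: sup_lipschitz_le fB; rewrite lerDr.
have /fin_all_exists2[M M0 HM] (i : 'I_d) := IH _ (test_partial i tf).
have S0 : 0 <= \sum_i M i by rewrite sumr_ge0.
exists (A + B + \sum_i M i); first by rewrite !addr_ge0.
move=> s; case/lastP: s => [_|s i].
  split=> [x|] /=; first by apply: (le_trans (fA x)); rewrite -addrA lerDl addr_ge0.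
  by apply: sup_lipschitz_le fB; rewrite addrAC lerDr addr_ge0.
rewrite size_rcons ltnS iter_partial_rcons => /HM - /(_ i) [H1 H2].
have Mi : M i <= A + B + \sum_j M j.
  by rewrite (bigD1 i)//= addrCA lerDl !addr_ge0// sumr_ge0.
by split=> [x|]; [exact: le_trans (H1 x) Mi|exact: sup_lipschitz_le H2].
Qed.

Definition bump p l : 'rV[R]_d -> R := rescale p l unit_bump.

Lemma test_bump p l : 0 < l -> test_function (bump p l).
Proof. by move=> l0; apply: test_rescale => //; exact: test_unit_bump. Qed.

Lemma bump_ge0 p l x : 0 <= bump p l x.
Proof. by apply: prodr_ge0 => i _; exact: bump_line_ge0. Qed.

Lemma bump_ge2 p l x : 0 < l -> cube p l x -> 2 <= bump p l x.
Proof.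
move=> l0 px; have h i : 2 <= bump_line ((l^-1 *: (x - p)) ord0 i).
  apply: bump_line_ge2; rewrite !mxE; have /andP[x1 x2] := px i.
  rewrite mulr_ge0 ?invr_ge0 ?(ltW l0) ?subr_ge0//= mulrC ler_pdivrMr// mul1r.
  by rewrite lerBlDl ltW.
rewrite /bump /rescale /unit_bump /prod_fun (bigD1 (Ordinal d_gt0))//=.
apply: le_trans (h (Ordinal d_gt0)) _; rewrite ler_peMr ?bump_line_ge0//.
apply: (big_ind (fun u => 1 <= u)) => // [u w u1 w1|i _].
  by rewrite -[leLHS]mul1r ler_pM.
by apply: le_trans (h i); rewrite ler1n.
Qed.

Lemma bump_derivatives k : exists2 M, 0 <= M & forall p l s, 0 < l -> (size s <= k)%N ->
  (forall z, `|iter_partial s (bump p l) z| <= M * l^-1 ^+ size s * \1_(cbox p (2 * l)) z) /\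
  sup_lipschitz (M * l^-1 ^+ size s / l) (iter_partial s (bump p l)).
Proof.
have [M M0 HM] := test_uniform_bound k test_unit_bump.
exists M => // p l s l0 /HM[H1 H2].
have li0 : 0 <= l^-1 ^+ size s by rewrite exprn_ge0// invr_ge0 ltW.
rewrite iter_partial_rescale; last exact: test_unit_bump.1.
split=> [z|x y h xyh].
  rewrite normrM (ger0_norm li0) [M * _]mulrC -mulrA ler_wpM2l// /rescale.
  have [->|nz] := eqVneq (iter_partial s unit_bump (l^-1 *: (z - p))) 0.
    by rewrite normr0 mulr_ge0.
  rewrite indicE mem_set ?mulr1//; apply/cboxP => i.
  have := unit_bump_support nz i; rewrite !mxE normrM gtr0_norm ?invr_gt0//.
  by rewrite mulrC ler_pdivrMr.
rewrite -mulrBr normrM (ger0_norm li0) [M * _]mulrC -!mulrA ler_wpM2l//.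
apply: H2 => i; rewrite !mxE -mulrBr normrM gtr0_norm ?invr_gt0// ler_wpM2l ?invr_ge0 ?(ltW l0)//.
by rewrite opprB addrA subrK; exact: xyh.
Qed.

Section sum_of_bumps.
Variables (I : finType) (c l : I -> R) (p : I -> 'rV[R]_d).
Hypotheses (c0 : forall i, 0 <= c i) (l0 : forall i, 0 < l i) (l1 : forall i, l i <= 1).

Definition bump_sum x := \sum_i c i * bump (p i) (l i) x.

Let tcb i : test_function (fun x => c i * bump (p i) (l i) x).
Proof. by apply: testZ; exact: test_bump. Qed.

Lemma test_bump_sum : test_function bump_sum.
Proof. exact: test_sum tcb. Qed.

Lemma iter_partial_bump_sum s :
  iter_partial s bump_sum = fun x => \sum_i c i * iter_partial s (bump (p i) (l i)) x.
Proof.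
rewrite /bump_sum (iter_partial_sum s tcb); apply/funext => x; apply: eq_bigr => i _.
by rewrite smoothZ_iter//; exact: (test_bump (p i) (l0 i)).1.
Qed.

Variable (alpha : R).
Hypothesis alpha_gt0 : 0 < alpha.
Let k := Num.truncn alpha.

Let k_le : k%:R <= alpha.
Proof. by have /andP[] := truncn_itv (ltW alpha_gt0). Qed.

Let weight := \sum_i c i * (l i ^+ d * (l i)^-1 `^ alpha).

Variable M : R.
Hypothesis M0 : 0 <= M.
Hypothesis HM : forall p l s, 0 < l -> (size s <= k)%N ->
  (forall z, `|iter_partial s (bump p l) z| <= M * l^-1 ^+ size s * \1_(cbox p (2 * l)) z) /\
  sup_lipschitz (M * l^-1 ^+ size s / l) (iter_partial s (bump p l)).

(** A derivative of order [i] of a bump is of size $l^{-i}$ on a box of volume $(4l)^d$. As $l \le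
    1$ and $i \le \alpha$, the factor $l^{-i}$ is at most $l^{-\alpha}$, and all orders share one
    weight. *)
Lemma integral_bump_sum i : (i <= k)%N ->
  (\int[mu]_x (tensor_norm (Dc (i:=i) bump_sum x))%:E <=
   (#|{: i.-tuple 'I_d}|%:R * M * 4 ^+ d * weight)%:E)%E.
Proof.
move=> ik.
pose K (t : i.-tuple 'I_d * I) := c t.2 * (M * (l t.2)^-1 ^+ i).
have K0 t : 0 <= K t by rewrite mulr_ge0// mulr_ge0// exprn_ge0// invr_ge0 ltW.
apply: (@le_trans _ _ (\int[mu]_x (\sum_t K t * \1_(cbox (p t.2) (2 * l t.2)) x)%:E)%E).
  apply: ge0_le_integralT => x; rewrite lee_fin ?tensor_norm_ge0//.
  apply: (le_trans (tensor_norm_le _)).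
  rewrite -(pair_big xpredT xpredT (fun (s : i.-tuple 'I_d) r => K (s, r) * \1_(cbox (p r) (2 * l r)) x))/=.
  apply: ler_sum => s _; rewrite /Dc iter_partial_bump_sum.
  apply: (le_trans (ler_norm_sum _ _ _)); apply: ler_sum => r _.
  rewrite normrM (ger0_norm (c0 r)) /K/= -mulrA ler_wpM2l//.
  have sz : size (rev s) = i by rewrite size_rev size_tuple.
  have [H _] := @HM (p r) (l r) (rev s) (l0 r) (leq_trans (eq_leq sz) ik).
  by have := H x; rewrite sz.
rewrite integral_sum_indic//; last by move=> t; exact: measurable_cbox.
rewrite -(pair_big xpredT xpredT
  (fun (s : i.-tuple 'I_d) r => (K (s, r))%:E * mu (cbox (p r) (2 * l r)))%E)/=.
rewrite (eq_bigr (fun=> \sum_r (c r * (M * (l r)^-1 ^+ i) * (2 * (2 * l r)) ^+ d)%:E)%E); last first.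
  move=> s _; apply: eq_bigr => r _.
  by rewrite [X in (_ * X)%E]lebesgue_cbox// mulr_ge0// ltW.
under eq_bigr do rewrite sumEFin; rewrite sumEFin lee_fin sumr_const.
rewrite -[leLHS]mulr_natl -[leRHS]mulrA -[leRHS]mulrA; apply: ler_wpM2l => //.
rewrite mulrA mulr_sumr.
apply: ler_sum => r _.
have lr := l0 r; have lr1 : 1 <= (l r)^-1 by rewrite invf_ge1.
have H : (l r)^-1 ^+ i <= (l r)^-1 `^ alpha.
  rewrite -powR_mulrn ?invr_ge0 ?(ltW lr)//; apply: ler_powR => //.
  by apply: le_trans k_le; rewrite ler_nat.
have -> : (2 * (2 * l r)) ^+ d = 4 ^+ d * l r ^+ d.
  by rewrite -exprMn; congr (_ ^+ d); ring.
have C0 : 0 <= M * 4 ^+ d * c r * l r ^+ d.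
  by rewrite mulr_ge0 ?exprn_ge0 ?(ltW lr)// mulr_ge0// mulr_ge0// exprn_ge0.
have := ler_wpM2l C0 H; congr (_ <= _); ring.
Qed.

Lemma gagliardo_bump_sum : alpha - k%:R != 0 ->
  (gagliardo k (alpha - k%:R) bump_sum <=
   (@gagliardo_const R d (alpha - k%:R) * #|{: k.-tuple 'I_d}|%:R * M * weight)%:E)%E.
Proof.
move=> ak; have t0 : 0 < alpha - k%:R by rewrite lt_def ak subr_ge0.
have t1 : alpha - k%:R < 1.
  by have /andP[_ h] := truncn_itv (ltW alpha_gt0); rewrite ltrBlDl natr1.
rewrite gagliardo_test; last exact: test_bump_sum.
pose F (t : k.-tuple 'I_d * I) := iter_partial (rev t.1) (bump (p t.2) (l t.2)).
have sz (s : k.-tuple 'I_d) : size (rev s) = k by rewrite size_rev size_tuple.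
have := @gagliardo_family R d _ t0 t1 _ F (fun t => p t.2) (fun t => l t.2)
  (fun t => M * (l t.2)^-1 ^+ k) (fun t => c t.2)
  (fun x y => tensor_norm (fun s : k.-tuple 'I_d => Dc bump_sum x s - Dc bump_sum y s)).
have HF t : (forall z, `|F t z| <= M * (l t.2)^-1 ^+ k * \1_(cbox (p t.2) (2 * l t.2)) z) /\
  sup_lipschitz (M * (l t.2)^-1 ^+ k / l t.2) (F t).
  by have := @HM (p t.2) (l t.2) (rev t.1) (l0 _) (eq_leq (sz _)); rewrite sz.
move=> H; apply: le_trans (H _ _ _ _ _ _) _ => //.
- by move=> t; rewrite mulr_ge0// exprn_ge0// invr_ge0 ltW.
- by move=> t; have [] := HF t.
- by move=> t; have [] := HF t.
- move=> x y; rewrite tensor_norm_ge0/=; apply: (le_trans (tensor_norm_le _)).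
  rewrite -(pair_big xpredT xpredT (fun (s : k.-tuple 'I_d) r => c r * `|F (s, r) x - F (s, r) y|))/=.
  apply: ler_sum => s _; rewrite /Dc iter_partial_bump_sum -sumrB.
  apply: (le_trans (ler_norm_sum _ _ _)); apply: ler_sum => r _.
  by rewrite -mulrBr normrM (ger0_norm (c0 r)).
rewrite lee_fin -[leRHS]mulrA -[leRHS]mulrA le_eqVlt; apply/orP; left; apply/eqP; congr (_ * _).
rewrite -(pair_big xpredT xpredT (fun (s : k.-tuple 'I_d) r =>
   c r * (M * (l r)^-1 ^+ k) * (l r ^+ d * (l r)^-1 `^ (alpha - k%:R))))/=.
rewrite sumr_const -[X in X = _]mulr_natl; congr (_ * _); rewrite mulr_sumr; apply: eq_bigr => r _.
have -> : (l r)^-1 `^ alpha = (l r)^-1 ^+ k * (l r)^-1 `^ (alpha - k%:R).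
  rewrite -powR_mulrn ?invr_ge0 ?(ltW (l0 r))// -powRD ?subrKC//.
  by apply/implyP => _; rewrite invr_neq0// gt_eqF.
by ring.
Qed.

End sum_of_bumps.

Lemma sobolev_norm_bump_sum (alpha : R) : 0 < alpha -> exists2 C, 0 <= C &
  forall (I : finType) (c l : I -> R) (p : I -> 'rV[R]_d),
    (forall i, 0 <= c i) -> (forall i, 0 < l i) -> (forall i, l i <= 1) ->
  (sobolev_norm alpha (bump_sum c l p) <=
   (C * \sum_i c i * (l i ^+ d * (l i)^-1 `^ alpha))%:E)%E.
Proof.
move=> a0; set k := Num.truncn alpha.
have [M M0 HM] := bump_derivatives k.
pose C1 := \sum_(i < k.+1) #|{: i.-tuple 'I_d}|%:R * M * 4 ^+ d.
(* The absolute value fixes the sign before it is known whether [alpha] is an integer. *)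
pose C2 := `|@gagliardo_const R d (alpha - k%:R)| * #|{: k.-tuple 'I_d}|%:R * M.
have C10 : 0 <= C1 by rewrite sumr_ge0// => i _; rewrite mulr_ge0 ?exprn_ge0// mulr_ge0.
have C20 : 0 <= C2 by rewrite mulr_ge0// mulr_ge0.
exists (C1 + C2); first exact: addr_ge0.
move=> I c l p c0 l0 l1; set W := \sum_i _.
have W0 : 0 <= W.
  by apply: sumr_ge0 => i _; rewrite mulr_ge0// mulr_ge0 ?powR_ge0// exprn_ge0// ltW.
have h1 : (sobolev_int_norm k (bump_sum c l p) <= (C1 * W)%:E)%E.
  rewrite sobolev_int_norm_test; last exact: test_bump_sum.
  rewrite mulr_suml -sumEFin; apply: lee_sum => i _.
  by apply: (integral_bump_sum p c0 l0 l1 a0 M0 HM); rewrite -ltnS.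
rewrite /sobolev_norm -/k; case: eqP => [_|/eqP ak].
  by apply: (le_trans h1); rewrite lee_fin ler_wpM2r// lerDl.
rewrite mulrDl EFinD; apply: leeD => //.
apply: (le_trans (gagliardo_bump_sum p c0 l0 a0 M0 HM ak)).
rewrite lee_fin ler_wpM2r// ler_wpM2r// ler_wpM2r//; exact: ler_norm.
Qed.

End bump.

(** * Choquet integrals *)

Lemma partial_sum_crossing (R : realDomainType) (u : nat -> R) (t : R) n : 0 <= t ->
  t < \sum_(l < n) u l -> exists j : 'I_n, \sum_(l < j) u l <= t < \sum_(l < j) u l + u j.
Proof.
move=> t0; elim: n => [|n IH]; first by rewrite big_ord0 ltNge t0.
have [/IH[j Hj] _|tn] := ltP t (\sum_(l < n) u l).
  by exists (widen_ord (leqnSn n) j).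
by rewrite big_ord_recr/= => tn1; exists ord_max; rewrite tn.
Qed.

Section capacity.
Context {R : realType} {d : nat}.
Implicit Types (alpha : R) (K : set 'rV[R]_d).

Lemma cap_compact_ge0 alpha K : (0 <= cap_compact alpha K)%E.
Proof. by apply: le_ereal_inf_tmp => _ /= [phi _ <-]; exact: sobolev_norm_ge0. Qed.

Lemma cap_open_ge0 alpha K : (0 <= cap_open alpha K)%E.
Proof.
apply: (le_trans (cap_compact_ge0 alpha set0)); apply: ereal_sup_ubound.
by exists set0 => //; split => //; exact: compact0.
Qed.

End capacity.

Section covering.
Context {R : realType} {d : nat}.
Hypothesis d_gt0 : (0 < d)%N.
Variables (L N : nat) (alpha C : R) (phi : 'rV[R]_d -> R).
Local Notation cell := {ffun 'I_d -> 'I_(grid_size L N)}.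
Local Notation mesh N := (@mesh R N).
Variable c : nat -> cell -> R.
Hypothesis c0 : forall j a, 0 <= c j a.
Hypothesis c_level : forall j, level (2 ^ (N - j)) (c j).
Hypothesis phi_le : forall a x, cell_set a x -> `|phi x| <= \sum_(j < N.+1) c j a.
Hypothesis phiL : box_support L phi.
Hypothesis C0 : 0 <= C.
Hypothesis norm_le : forall (I : finType) (c l : I -> R) (p : I -> 'rV[R]_d),
  (forall i, 0 <= c i) -> (forall i, 0 < l i) -> (forall i, l i <= 1) ->
  (sobolev_norm alpha (bump_sum c l p) <=
   (C * \sum_i c i * (l i ^+ d * (l i)^-1 `^ alpha))%:E)%E.

Let active (t : R) j a := \sum_(l < j) c l a <= t < \sum_(l < j) c l a + c j a.

(** The partial sums up to generation [j] involve only cubes containing the given one, so they are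
    constant on it. *)
Let active_level t j a b : (j <= N)%N -> same (2 ^ (N - j)) a b ->
  active t j a = active t j b.
Proof.
move=> jN ab; rewrite /active (c_level ab).
have -> : \sum_(l < j) c l a = \sum_(l < j) c l b; last by [].
apply: eq_bigr => l _; apply: c_level; apply: same_dvd ab.
by rewrite dvdn_exp2l// leq_sub2l// ltnW.
Qed.

Let mesh_le1 j : mesh j <= 1.
Proof. by rewrite exprn_ile1 ?invr_ge0// invf_le1// ler1n. Qed.

(* A point where [|phi| > t] lies in a dyadic cube of side [mesh j] at which
   the partial sums of [c] cross [t]; the cubes are counted through the
   [(2 ^ (N - j)) ^ d] cells they contain, whence the weight of each bump. *)
Lemma cap_open_level (t : R) : 0 <= t ->
  (cap_open alpha [set x | (t < `|phi x|)%R] <=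
   (\sum_(i : 'I_N.+1 * cell)
      C * (mesh N ^+ d * (2 `^ alpha) ^+ i.1) * (active t i.1 i.2)%:R)%:E)%E.
Proof.
move=> t0.
pose e (i : 'I_N.+1 * cell) : R := (active t i.1 i.2)%:R * ((2 ^ (N - i.1)) ^ d)%:R^-1.
pose l (i : 'I_N.+1 * cell) : R := mesh i.1.
pose p (i : 'I_N.+1 * cell) : 'rV[R]_d := block_corner i.1 i.2.
have e0 i : 0 <= e i by rewrite mulr_ge0// invr_ge0.
have l0 i : 0 < l i by exact: mesh_gt0.
apply: ge_ereal_sup => _ /= [K [_ Kphi] <-].
apply: (@le_trans _ _ (sobolev_norm alpha (bump_sum e l p))).
  apply: ereal_inf_lbound; exists (bump_sum e l p) => //; split.
  - exact: test_bump_sum.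
  - by move=> x; apply: sumr_ge0 => i _; rewrite mulr_ge0// bump_ge0.
  move=> x /Kphi/= tx.
  have [a ax] : exists a : cell, cell_set a x.
    apply: (support_cell phiL); rewrite -normr_gt0; exact: le_lt_trans tx.
  have [j /= ja] := @partial_sum_crossing _ (c ^~ a) _ _ t0 (lt_le_trans tx (phi_le ax)).
  have jN : (j <= N)%N by rewrite -ltnS.
  (* The shares of the cells of one active cube add up to a whole bump, which is at least $2$ on the
     cube. *)
  apply: (@lt_le_trans _ _ 2); first by rewrite ltr1n.
  apply: (@le_trans _ _ (\sum_(b | same (2 ^ (N - j)) a b) e (j, b) * bump (p (j, b)) (mesh j) x)).
    rewrite (eq_bigr (fun b => ((2 ^ (N - j)) ^ d)%:R^-1 * bump (p (j, b)) (mesh j) x)).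
      rewrite -mulr_sumr mulrC ler_pdivlMr; last by rewrite ltr0n !expn_gt0.
      have <- := card_same a (dvdn_trans (dvdn_exp2l 2 (leq_subr j N)) (@grid_dvd L N)).
      rewrite mulr_natr -sumr_const; apply: ler_sum => b ab.
      apply: bump_ge2 => //; first exact: mesh_gt0.
      by apply: cell_set_block ax => //; rewrite same_sym.
    by move=> b ab; rewrite /e/= -(active_level _ jN ab) /active ja mul1r.
  rewrite /bump_sum -(pair_big xpredT xpredT (fun j b => e (j, b) * bump (p (j, b)) (l (j, b)) x))/=.
  have nn j' b : 0 <= e (j', b) * bump (p (j', b)) (l (j', b)) x.
    by rewrite mulr_ge0// bump_ge0.
  rewrite (bigD1 j)//= -[leLHS]addr0; apply: lerD; last first.
    by apply: sumr_ge0 => j' _; apply: sumr_ge0.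
  rewrite big_mkcond; apply: ler_sum => b _.
  by case: ifP => _ //; exact: nn.
apply: (le_trans (norm_le _ e0 l0 (fun i => mesh_le1 _))).
rewrite lee_fin mulr_sumr le_eqVlt; apply/orP; left; apply/eqP; apply: eq_bigr => -[j a] _.
rewrite /e /l /= -mulrA; congr (_ * _); rewrite mulrC.
have jN : (j <= N)%N by rewrite -ltnS.
have -> : mesh N ^+ d = ((2 ^ (N - j)) ^ d)%:R^-1 * mesh j ^+ d.
  by rewrite -(side_mesh R jN) exprMn natrX mulKf// expf_neq0// pnatr_eq0 expn_eq0.
have -> : (mesh j)^-1 `^ alpha = (2 `^ alpha) ^+ j.
  rewrite meshE -exprVn invrK -powR_mulrn// -powRrM mulrC powRrM.
  by rewrite powR_mulrn// powR_ge0.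
ring.
Qed.

(** The bound of [cap_open_level] is a combination of indicators of intervals of $t$, half-open so
    that they match [active]; its integral is read off from their lengths. *)
Lemma choquet_le_cost :
  (choquet_integral alpha phi <= (C * (mesh N ^+ d * cost N (2 `^ alpha) c))%:E)%E.
Proof.
pose A (i : 'I_N.+1 * cell) : set R :=
  `[\sum_(l < i.1) c l i.2, \sum_(l < i.1) c l i.2 + c i.1 i.2[%classic.
pose k (i : 'I_N.+1 * cell) : R := C * (mesh N ^+ d * (2 `^ alpha) ^+ i.1).
have k0 i : 0 <= k i.
  by rewrite mulr_ge0// mulr_ge0 ?exprn_ge0 ?powR_ge0// ltW// mesh_gt0.
have AE i t : \1_(A i) t = (active t i.1 i.2)%:R :> R.
  rewrite indicE; congr (_%:R); congr nat_of_bool.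
  by apply/idP/idP; rewrite inE /A/= in_itv.
apply: (@le_trans _ _ (\int[lebesgue_measure]_t (\sum_i k i * \1_(A i) t)%:E)%E).
  rewrite /choquet_integral integral_mkcond; apply: ge0_le_integralT => t.
    by rewrite patchE; case: ifP => // _; exact: cap_open_ge0.
  rewrite patchE; case: ifPn => [|_].
    rewrite inE/= in_itv/= andbT => t0.
    by under eq_bigr do rewrite AE; exact: cap_open_level (ltW t0).
  by rewrite lee_fin sumr_ge0// => i _; rewrite AE mulr_ge0.
rewrite integral_sum_indic//; last by move=> i; exact: measurable_itv.
rewrite (eq_bigr (fun i => (k i * c i.1 i.2)%:E)) => [|i _]; last first.
  rewrite [RHS]EFinM; congr (_ * _)%E.
  rewrite [LHS]lebesgue_measure_itv/= lte_fin ltrDl; case: ltP => h1.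
    by rewrite -EFinB addrAC subrr add0r.
  by congr EFin; apply/eqP; rewrite eq_le h1 c0.
rewrite sumEFin lee_fin -(pair_big xpredT xpredT (fun j a => k (j, a) * c j a))/=.
rewrite /cost mulr_sumr mulr_sumr le_eqVlt; apply/orP; left; apply/eqP.
apply: eq_bigr => j _; rewrite !mulr_sumr; apply: eq_bigr => a _.
by rewrite /k/= !mulrA.
Qed.

End covering.

Section choquet_inequality.
Context {R : realType} {d : nat}.
Hypothesis d_gt0 : (0 < d)%N.
Implicit Types (alpha beta : R) (phi : 'rV[R]_d -> R).

Lemma le_of_vanishing_error (x y : R) (e : nat -> R) : e n @[n --> \oo] --> (0 : R) ->
  (forall n, x <= y + e n) -> x <= y.
Proof.
move=> e0 xye; apply/ler_addgt0Pr => r r0.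
move/cvgr0Pnorm_le/(_ _ r0) : e0 => [n _ /(_ n (leqnn _))] /= h.
by apply: (le_trans (xye n)); rewrite lerD2l (le_trans (ler_norm _)).
Qed.

Lemma choquet_le_derivatives m beta : 0 < beta <= 1 -> exists2 C, 0 <= C &
  forall phi B, test_function phi -> derivatives_le m beta phi B ->
  (choquet_integral (m%:R + beta) phi <= (C * B)%:E)%E.
Proof.
move=> b01; have [C C0 HC] := @decompose_test R d m beta b01.
set alpha := m%:R + beta in HC *.
have a0 : 0 < alpha by have /andP[b0 _] := b01; rewrite ltr_wpDl.
have [Cb Cb0 HCb] := @sobolev_norm_bump_sum R d d_gt0 alpha a0.
exists (Cb * C); first exact: mulr_ge0.
move=> phi B tp HB; have [L _ phiL] := test_box tp; have [l l0 pl] := test_lipschitz tp.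
have [e e0 He] := HC L phi tp.
have e'0 : (Cb * (e N + L.*2%:R ^+ d * l * @mesh R N)) @[N --> \oo] --> (0 : R).
  by apply: cvg0M; apply: cvg0D => //; apply: cvg0M; exact: mesh_cvg0.
have bound N : (choquet_integral alpha phi <=
    (Cb * C * B + Cb * (e N + L.*2%:R ^+ d * l * @mesh R N))%:E)%E.
  have [c [c0 clev fc] cc] := He B HB N; have m0 := @mesh_gt0 R N.
  (* Passing from the corners to all points of the cells costs the Lipschitz error, which is put on
     generation [0]. *)
  pose c' j a := c j a + if j == 0%N then l * @mesh R N else 0.
  have c'E a : \sum_(j < N.+1) c' j a = \sum_(j < N.+1) c j a + l * @mesh R N.
    by rewrite big_split/= [X in _ + X]big_ord_recl/= [X in _ + (_ + X)]big1// addr0.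
  apply: le_trans (choquet_le_cost d_gt0 (c := c') _ _ _ phiL Cb0 HCb) _.
  - by move=> j a; rewrite addr_ge0//; case: ifP => // _; rewrite mulr_ge0// ltW.
  - by move=> j a b ab; rewrite /c' (clev _ _ _ ab).
  - move=> a x ax; rewrite c'E; apply: le_trans (lerD (fc a) (sample_near pl ax)).
    by rewrite -lerBlDl; exact: lerB_dist.
  rewrite lee_fin -mulrA -mulrDr ler_wpM2l//.
  have -> : cost N (2 `^ alpha) c' = cost N (2 `^ alpha) c +
      \sum_(a : {ffun 'I_d -> 'I_(grid_size L N)}) l * @mesh R N.
    rewrite /cost /c'; under eq_bigr do rewrite big_split/= mulrDr.
    rewrite big_split/=; congr (_ + _).
    rewrite big_ord_recl/= expr0 mul1r [X in _ + X]big1 ?addr0// => i _.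
    by rewrite big1 ?mulr0.
  by rewrite mulrDr mesh_sum_const mulrA addrA lerD2r.
(* The bound for a single [N] shows that the integral is finite, so the limit can be taken among
   real numbers. *)
have [oo|fin] := eqVneq (choquet_integral alpha phi) +oo%E.
  by have := bound 0%N; rewrite oo leye_eq.
have c0 : (0 <= choquet_integral alpha phi)%E.
  by apply: integral_ge0 => t _; exact: cap_open_ge0.
have fn : choquet_integral alpha phi \is a fin_num by rewrite ge0_fin_numE// ltey.
rewrite -(fineK fn) lee_fin; apply: le_of_vanishing_error e'0 _ => N.
by rewrite -lee_fin fineK.
Qed.

(** The induction on the order starts from orders in $(0, 1]$, so an integer is split with
    fractional part $1$, and then [m] is one less than its integer part. *)
Lemma order_split alpha : 0 < alpha -> exists m beta, [/\ 0 < beta <= 1, alpha = m%:R + beta,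
  beta = 1 -> m.+1 = Num.truncn alpha &
  beta != 1 -> m = Num.truncn alpha /\ beta = alpha - (Num.truncn alpha)%:R].
Proof.
move=> a0; set k := Num.truncn alpha.
have /andP[k1 k2] := truncn_itv (ltW a0); rewrite -/k in k1 k2.
have [ak|ak] := eqVneq alpha k%:R.
  have k0 : (0 < k)%N by rewrite -(ltr_nat R) -ak.
  exists k.-1, 1; rewrite ltr01 lexx eqxx prednK//; split => //.
  by rewrite natr1 prednK.
exists k, (alpha - k%:R); split => //.
- by rewrite subr_gt0 lt_neqAle eq_sym ak k1 /= lerBlDr addrC natr1 ltW.
- by rewrite addrC subrK.
- move=> b1; move: k2; rewrite -natr1 -ltrBlDl b1 ltxx //.
Qed.

End choquet_inequality.

Theorem theorem2p5 (R : realType) (d : nat) (alpha : R)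
    (d_ge1 : (1 <= d)%N) (alpha_gt0 : 0 < alpha) :
  exists2 C' : R, 0 < C' &
    forall phi : 'rV[R]_d -> R, test_function phi ->
      (choquet_integral alpha phi <= C'%:E * sobolev_norm alpha phi)%E.
Proof.
have [m [beta [b01 aE b1 bn1]]] := order_split alpha_gt0.
have [C C0 HC] := choquet_le_derivatives d_ge1 m b01.
(* [C] is only known to be nonnegative; adding $1$ makes it positive. *)
have C'0 : 0 < C + 1 by rewrite ltr_wpDl.
exists (C + 1) => // phi tp.
have [->|fin] := eqVneq (sobolev_norm alpha phi) +oo%E.
  by rewrite gt0_muley ?lte_fin// leey.
have s0 := sobolev_norm_ge0 alpha phi.
have fn : sobolev_norm alpha phi \is a fin_num by rewrite ge0_fin_numE// ltey.
have B0 := fine_ge0 s0; have BE := fineK fn.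
set B := fine _ in B0 BE.
apply: (@le_trans _ _ (C * B)%:E); last first.
  by rewrite -BE -EFinM lee_fin ler_wpM2r// lerDl.
rewrite [in leLHS]aE; apply: HC => //; split=> [s sm|nb s sm]; rewrite BE.
  apply: L1_le_sobolev => //; apply: (leq_trans sm).
  have [/b1 <-|/bn1[<- _]] := eqVneq beta 1; first by rewrite addn1.
  by rewrite addn0.
have [mE bE] := bn1 nb; rewrite bE; apply: gagliardo_le_sobolev => //; first by rewrite sm.
by rewrite -bE gt_eqF//; have /andP[] := b01.
Qed.
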